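(* Let $M$ be a non-degenerate (real) $d\times d$ matrix and $\delta\in(0,1]$. Suppose that 1) $\operatorname{supp}\widehat\varphi\subset\mathbb{T}^d$ and $\widehat\varphi\in L_\infty$; 2) $\widetilde\varphi\in\mathcal{S}'$ and $\widehat{\widetilde\varphi}$ is bounded on $\delta\mathbb{T}^d$; 3) $\varphi$ and $\widetilde\varphi$ are strictly compatible with respect to $\delta$, i.e. $\overline{\widehat\varphi}(\xi)\,\widehat{\widetilde\varphi}(\xi)=1$ for almost every $\xi\in\delta\mathbb{T}^d$. If a function $f$ is such that $\operatorname{supp}\widehat f\subset\delta M^*\mathbb{T}^d$ and $\widehat f\in L_q$ for some $q>1$, then $$f(x)=\lim_{n\to\infty}\sum_{k\in\mathbb{Z}^d,\ \|k\|_\infty\le n}\langle\widehat f,\widehat{\widetilde\varphi_{1k}}\rangle\,\varphi_{1k}(x)\quad\text{for almost all }x\in\mathbb{R}^d.$$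
   Context: $\mathbb{T}^d$ is identified with the cube $[-1/2,1/2]^d$; $L_q=L_q(\mathbb{R}^d)$; $M^*$ is the conjugate matrix of $M$ and $m=|\det M|$; $\|k\|_\infty=\max_i|k_i|$. $\mathcal{S}'$ is the space of tempered distributions on $\mathbb{R}^d$. $\widehat f(\xi)=\int_{\mathbb{R}^d}f(x)e^{-2\pi i(x,\xi)}dx$ (extended to tempered distributions by $\langle\widehat f,\widehat\phi\rangle=\langle f,\phi\rangle$ for Schwartz $f$, where $\langle f,\phi\rangle=\phi(f)$); $\langle f,g\rangle=\int f\overline g$ for functions. $\widehat{\widetilde\varphi}$ being bounded on $\delta\mathbb{T}^d$ means that it is there given by a bounded measurable function. $\varphi$ is a function on $\mathbb{R}^d$ with Fourier transform $\widehat\varphi$, and $\varphi_{1k}(x)=m^{1/2}\varphi(Mx+k)$. Correspondingly $\widehat{\widetilde\varphi_{1k}}(\xi)=m^{-1/2}\,\widehat{\widetilde\varphi}((M^* )^{-1}\xi)\,e^{2\pi i(k,(M^* )^{-1}\xi)}$, so that $$\langle\widehat f,\widehat{\widetilde\varphi_{1k}}\rangle=m^{-1/2}\int_{\delta M^*\mathbb{T}^d}\widehat f(\xi)\,\overline{\widehat{\widetilde\varphi}((M^* )^{-1}\xi)}\,e^{-2\pi i(k,(M^* )^{-1}\xi)}\,d\xi.$$ *)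

(* Defs.v *)
From HB Require Import structures.
From mathcomp Require Import all_boot all_order all_algebra.
From mathcomp Require Import complex.
From mathcomp Require Import all_classical all_reals all_analysis.
Set Implicit Arguments.
Unset Strict Implicit.
Unset Printing Implicit Defensive.
Import Order.TTheory GRing.Theory Num.Theory numFieldNormedType.Exports.
Import ComplexField.Normc.
Local Open Scope classical_set_scope.
Local Open Scope ring_scope.

(* 'cV[R]_n carries the product sigma-algebra generated by the coordinates,
   which is the Borel sigma-algebra of R^n. *)
Definition measure_cvec_display : measure_display -> measure_display.
Proof. exact. Qed.

Section measurable_cvec.
Context (R : realType) (n : nat).

Let coords : 'I_n -> 'cV[R]_n -> R := fun i x => x i ord0.

Let cvec_set0 : g_sigma_preimage coords set0.
Proof. exact: sigma_algebra0. Qed.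

Let cvec_setC A : g_sigma_preimage coords A -> g_sigma_preimage coords (~` A).
Proof. exact: sigma_algebraC. Qed.

Let cvec_bigcup (F : (set 'cV[R]_n)^nat) :
  (forall i, g_sigma_preimage coords (F i)) ->
  g_sigma_preimage coords (\bigcup_i (F i)).
Proof. exact: sigma_algebra_bigcup. Qed.

HB.instance Definition _ :=
  @isMeasurable.Build (measure_cvec_display default_measure_display)
    'cV[R]_n (g_sigma_preimage coords) cvec_set0 cvec_setC cvec_bigcup.

Lemma measurable_coord (i : 'I_n) :
  measurable_fun [set: 'cV[R]_n] (fun x : 'cV[R]_n => x i ord0).
Proof.
move=> _ Y mY; rewrite setTI; apply: sub_sigma_algebra => /=.
rewrite -bigcup_seq/=; exists i => /=; first by rewrite mem_index_enum.
by exists Y => //; rewrite setTI.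
Qed.

Lemma measurable_cvecP d (T : measurableType d) (f : T -> 'cV[R]_n) :
  (forall i, measurable_fun [set: T] (fun t => f t i ord0)) ->
  measurable_fun [set: T] f.
Proof.
move=> mf _ A mA; rewrite setTI.
suff: preimage_set_system setT f (g_sigma_preimage coords) `<=` measurable.
  by move=> /(_ (f @^-1` A)); apply; exists A => //; rewrite setTI.
rewrite -g_sigma_preimage_comp.
apply: smallest_sub; first exact: sigma_algebra_measurable.
rewrite -bigcup_seq/=; apply: bigcup_sub => i _ _ [B mB <-].
exact: mf.
Qed.

End measurable_cvec.

Section lebesgue_cvec.
Context (R : realType).

Definition vcons n (p : R * 'cV[R]_n) : 'cV[R]_n.+1 :=
  col_mx (p.1%:M : 'M[R]_1) p.2.

Definition vuncons n (x : 'cV[R]_n.+1) : R * 'cV[R]_n :=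
  ((usubmx (x : 'M[R]_(1 + n, 1))) ord0 ord0, dsubmx (x : 'M[R]_(1 + n, 1))).

Lemma vcons0 n (p : R * 'cV[R]_n) : vcons p ord0 ord0 = p.1.
Proof.
rewrite (_ : ord0 = lshift n ord0 :> 'I_(1 + n)); last exact/val_inj.
by apply: etrans (@col_mxEu R 1 n 1 _ _ _ _) _; rewrite mxE eqxx mulr1n.
Qed.

Lemma vconsS n (p : R * 'cV[R]_n) i : vcons p (lift ord0 i) ord0 = p.2 i ord0.
Proof.
rewrite (_ : lift ord0 i = rshift 1 i :> 'I_(1 + n)); last exact/val_inj.
exact: (@col_mxEd R 1 n 1).
Qed.

Lemma vconsK n : cancel (@vcons n) (@vuncons n).
Proof.
by case=> t y; rewrite /vuncons /vcons col_mxKu col_mxKd/= mxE eqxx mulr1n.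
Qed.

Lemma vunconsK n : cancel (@vuncons n) (@vcons n).
Proof.
move=> x; rewrite /vcons /vuncons/=.
set u := usubmx _; have -> : (u ord0 ord0)%:M = u.
  by apply/matrixP => i j; rewrite (ord1 i) (ord1 j) mxE eqxx mulr1n.
exact: (@vsubmxK R 1 n 1 x).
Qed.

Lemma measurable_vcons n :
  measurable_fun [set: measurableTypeR R * 'cV[R]_n] (@vcons n).
Proof.
apply: measurable_cvecP => i.
have [j ->|->] := unliftP ord0 i.
  rewrite (_ : (fun _ => _) = (fun y : 'cV[R]_n => y j ord0) \o snd).
    apply: measurableT_comp; first exact: measurable_coord.
    exact: measurable_snd.
  by apply/funext => p; rewrite vconsS.
rewrite (_ : (fun _ => _) = fst); first exact: measurable_fst.
by apply/funext => p; rewrite vcons0.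
Qed.

Lemma measurable_vuncons n :
  measurable_fun [set: 'cV[R]_n.+1]
    (@vuncons n : 'cV[R]_n.+1 -> measurableTypeR R * 'cV[R]_n).
Proof.
apply/measurable_fun_pairP; split.
  have -> : fst \o @vuncons n = (fun x : 'cV[R]_n.+1 => x ord0 ord0).
    by apply/funext => x /=; rewrite mxE; congr (x _ _); exact/val_inj.
  exact: measurable_coord.
apply: measurable_cvecP => i.
have -> : (fun t => (snd \o @vuncons n) t i ord0) =
    (fun x : 'cV[R]_n.+1 => x (rshift 1 i) ord0).
  by apply/funext => x /=; rewrite mxE.
exact: measurable_coord.
Qed.

Section cons_measure.
Context n (mu : {sigma_finite_measure set 'cV[R]_n -> \bar R}).

Definition cons_measure : set 'cV[R]_n.+1 -> \bar R :=
  pushforward (lebesgue_measure \x mu)%E (@vcons n).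

Let mv := @measurable_vcons n.

Let cons_measure0 : cons_measure set0 = 0%E.
Proof. exact: measure0. Qed.

Let cons_measure_ge0 A : (0 <= cons_measure A)%E.
Proof. exact: measure_ge0. Qed.

Let cons_measure_sigma_additive : semi_sigma_additive cons_measure.
Proof. exact: measure_semi_sigma_additive. Qed.

HB.instance Definition _ := isMeasure.Build _ _ _ cons_measure
  cons_measure0 cons_measure_ge0 cons_measure_sigma_additive.

Let cons_measure_sigma_finite : sigma_finite [set: 'cV[R]_n.+1] cons_measure.
Proof.
have /sigma_finiteP[F [FT ndF Foo]] :=
  sigma_finiteT (@lebesgue_measure R : {sigma_finite_measure set _ -> \bar R}).
have /sigma_finiteP[G [GT ndG Goo]] := sigma_finiteT mu.
exists (fun i => @vuncons n @^-1` (F i `*` G i)).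
  rewrite -preimage_bigcup; apply/esym/seteqP; split=> // x _ /=.
  have [i _ Fi] : (\bigcup_i F i) (vuncons x).1 by rewrite -FT.
  have [j _ Gj] : (\bigcup_i G i) (vuncons x).2 by rewrite -GT.
  exists (maxn i j) => //; split=> /=.
    by move: Fi; exact/subsetPset/ndF/leq_maxl.
  by move: Gj; exact/subsetPset/ndG/leq_maxr.
move=> i; have [mF Fi] := Foo i; have [mG Gi] := Goo i; split.
  by rewrite -[X in measurable X]setTI; apply: measurable_vuncons => //;
    exact: measurableX.
rewrite /cons_measure /pushforward -comp_preimage.
rewrite (_ : @vuncons n \o @vcons n = id); last exact/funext/vconsK.
by rewrite preimage_id product_measure1E// lte_mul_pinfty// ge0_fin_numE.
Qed.

HB.instance Definition _ := Measure_isSigmaFinite.Build _ _ _ cons_measure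
  cons_measure_sigma_finite.

End cons_measure.

Fixpoint lebesgue n : {sigma_finite_measure set 'cV[R]_n -> \bar R} :=
  match n with
  | 0 => \d_ (0 : 'cV[R]_0)
  | n'.+1 => cons_measure (lebesgue n')
  end.

Lemma measurable_cvec_box n (A : 'I_n -> set R) :
  (forall i, measurable (A i)) ->
  measurable [set x : 'cV[R]_n | forall i, A i (x i ord0)].
Proof.
move=> mA.
rewrite (_ : [set _ | _] =
    \big[setI/setT]_(i < n) (fun x : 'cV[R]_n => x i ord0) @^-1` A i).
  apply: bigsetI_measurable => i _; rewrite -[X in measurable X]setTI.
  exact: measurable_coord.
rewrite -bigcap_seq; apply/seteqP; split=> x /= Ax i; first by move=> _; exact: Ax.
by apply: Ax => /=; rewrite mem_index_enum.
Qed.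

Lemma lebesgue_box n (A : 'I_n -> set R) : (forall i, measurable (A i)) ->
  lebesgue n [set x | forall i, A i (x i ord0)] =
  (\prod_(i < n) lebesgue_measure (A i))%E.
Proof.
elim: n A => [|n IH] A mA.
  by rewrite big_ord0 /= /dirac indicE mem_set// => -[].
rewrite big_ord_recl -IH// -product_measure1E; last 2 first.
- exact: mA.
- by apply: (@measurable_cvec_box _ (fun i => A (lift ord0 i))) => i.
apply: (congr1 (product_measure1 lebesgue_measure (lebesgue n))).
apply/seteqP; split=> p /=.
  by move=> Ap; split=> [|i]; rewrite -?vcons0 -?vconsS; exact: Ap.
by move=> [A0 A1] i; have [j ->|->] := unliftP ord0 i; rewrite ?vcons0 ?vconsS.
Qed.

End lebesgue_cvec.

Section fourier.
Context {R : realType} {d : nat}.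
Local Notation V := 'cV[R]_d.
Local Notation C := R[i].
Local Notation mu := (lebesgue R d).

Definition dotv (x y : V) : R := \sum_(i < d) x i ord0 * y i ord0.

Definition expi (t : R) : C := (cos t +i* sin t)%C.

Definition cmeasurable (D : set V) (g : V -> C) : Prop :=
  measurable_fun D (fun x => complex.Re (g x)) /\
  measurable_fun D (fun x => complex.Im (g x)).

Definition cintegrable (D : set V) (g : V -> C) : Prop :=
  mu.-integrable D (fun x => (complex.Re (g x))%:E) /\
  mu.-integrable D (fun x => (complex.Im (g x))%:E).

Definition cintegral (D : set V) (g : V -> C) : C :=
  (Rintegral mu D (fun x => complex.Re (g x)) +i*
   Rintegral mu D (fun x => complex.Im (g x)))%C.

Definition in_Lq (q : \bar R) (g : V -> C) : Prop :=
  cmeasurable setT g /\ ('N[mu]_q[EFin \o (fun x => normc (g x))] < +oo)%E.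

(* Support of a function defined up to null sets: the complement of the largest
   open set on which it vanishes almost everywhere. *)
Definition esupp (g : V -> C) : set V :=
  [set x | forall U : set V, open U -> U x ->
     ~ {ae mu, forall y, U y -> g y = 0}].

(* delta T^d, where T^d is identified with [-1/2, 1/2]^d. *)
Definition cube (delta : R) : set V :=
  [set x | forall i, `|x i ord0| <= delta / 2].

Definition partial (i : 'I_d) (g : V -> C) : V -> C := fun x =>
  ('D_(delta_mx i ord0) (fun y => complex.Re (g y)) x +i*
   'D_(delta_mx i ord0) (fun y => complex.Im (g y)) x)%C.

Definition partials (s : seq 'I_d) (g : V -> C) : V -> C := foldr partial g s.

Definition smooth (g : V -> C) : Prop := forall s : seq 'I_d,
  [/\ continuous (fun x => complex.Re (partials s g x)),
      continuous (fun x => complex.Im (partials s g x)) &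
      forall (i : 'I_d) (x : V),
        derivable (fun y => complex.Re (partials s g y)) x (delta_mx i ord0) /\
        derivable (fun y => complex.Im (partials s g y)) x (delta_mx i ord0)].

Definition schwartz_seminorm (N : nat) (s : seq 'I_d) (g : V -> C) : \bar R :=
  ereal_sup (range (fun x => ((1 + `|x|) ^+ N * normc (partials s g x))%:E)).

Definition schwartz (g : V -> C) : Prop :=
  smooth g /\ forall N s, (schwartz_seminorm N s g < +oo)%E.

Definition schwartz_cvg (u : nat -> V -> C) (g : V -> C) : Prop :=
  forall N s,
    (fun n => schwartz_seminorm N s (fun x => u n x - g x)) @ \oo --> 0%E.

(* A tempered distribution is encoded as a functional on all functions V -> C,
   of which only the values on Schwartz functions are meaningful.  The Schwartz
   space is metrizable, so that continuity is sequential continuity.  The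
   pairing <g, T> is T g, and is linear in g. *)
Definition tempered (T : (V -> C) -> C) : Prop :=
  (forall (a : C) (g h : V -> C), schwartz g -> schwartz h ->
     T (fun x => a * g x + h x) = a * T g + T h) /\
  (forall (u : nat -> V -> C) (g : V -> C), (forall n, schwartz (u n)) ->
     schwartz g -> schwartz_cvg u g ->
     (fun n => T (u n) : C^o) @ \oo --> (T g : C^o)).

Definition fourier (g : V -> C) : V -> C := fun xi =>
  cintegral setT (fun x => g x * expi (- (2 * pi * dotv x xi))).

(* That is the Fourier transform of T: <g^, T^> = <g, T> for Schwartz g. *)
Definition is_fourier (T That : (V -> C) -> C) : Prop :=
  forall g, schwartz g -> That (fourier g) = T g.

(* The distribution defined by a function, <g, f> = int g f^*. *)
Definition regular (f : V -> C) : (V -> C) -> C := fun g =>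
  cintegral setT (fun x => g x * conjc (f x)).

Definition tempered_fun (f : V -> C) : Prop :=
  [/\ cmeasurable setT f,
      forall g, schwartz g -> cintegrable setT (fun x => g x * conjc (f x)) &
      tempered (regular f)].

Definition fun_fourier (f fhat : V -> C) : Prop :=
  [/\ tempered_fun f, tempered_fun fhat &
      is_fourier (regular f) (regular fhat)].

(* The restriction of T to the open set U is the function psi. *)
Definition given_on (U : set V) (T : (V -> C) -> C) (psi : V -> C) : Prop :=
  forall h, schwartz h -> closure [set x | h x != 0] `<=` U ->
    T h = cintegral U (fun x => h x * conjc (psi x)).

Definition bounded_fun_on (D : set V) (psi : V -> C) : Prop :=
  cmeasurable D psi /\ exists B : R, forall x, D x -> normc (psi x) <= B.

Definition strictly_compatible (delta : R) (phihat psi : V -> C) : Prop :=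
  {ae mu, forall xi, cube delta xi -> conjc (phihat xi) * psi xi = 1}.

Definition ivec (k : 'cV[int]_d) : V := map_mx intr k.

Definition ivec_norm (k : 'cV[int]_d) : nat := (\max_(i < d) `|k i ord0|)%N.

Definition dilate (M : 'M[R]_d) (phi : V -> C) (k : 'cV[int]_d) : V -> C :=
  fun x => (Num.sqrt `|\det M|)%:C%C * phi (M *m x + ivec k).

(* The Fourier transform of the distribution dilate M T k, where psi is the
   Fourier transform of T. *)
Definition dilate_hat (M : 'M[R]_d) (psi : V -> C) (k : 'cV[int]_d) : V -> C :=
  fun xi => ((Num.sqrt `|\det M|)^-1)%:C%C * psi (invmx M^T *m xi) *
    expi (2 * pi * dotv (ivec k) (invmx M^T *m xi)).

Definition dilated_cube (M : 'M[R]_d) (delta : R) : set V :=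
  [set M^T *m y | y in cube delta].

Definition coefficient (M : 'M[R]_d) (delta : R) (fhat psi : V -> C)
    (k : 'cV[int]_d) : C :=
  cintegral (dilated_cube M delta)
    (fun xi => fhat xi * conjc (dilate_hat M psi k xi)).

End fourier.

(* Main.v *)
Require Import Defs.
From HB Require Import structures.
From mathcomp Require Import all_boot all_order all_algebra.
From mathcomp Require Import complex.
From mathcomp Require Import all_classical all_reals all_analysis.
From mathcomp Require Import measurable_realfun ess_sup_inf.
From mathcomp Require Import ring lra zify.
Set Implicit Arguments.
Unset Strict Implicit.
Unset Printing Implicit Defensive.
Import Order.TTheory GRing.Theory Num.Theory numFieldNormedType.Exports.
Import ComplexField.Normc.
Local Open Scope classical_set_scope.
Local Open Scope ring_scope.

(** Write [m] for |det M|, [Q] for the unit cube, [e_k] for the character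
e^(2 pi i (k, .)), and fix [x].  After the change of variables xi = M^T y, and
since [phi] is the inverse Fourier transform of [phihat], the two factors of
the k-th term become Fourier coefficients of functions of y on [Q]:
  <fhat, phit_1k^> phi_1k(x) = m * (int_Q G conj(e_k)) * (int_Q h e_k),
where G(y) = fhat(M^T y) conj(psi(y)) on delta T^d and 0 elsewhere, and
h(y) = phihat(y) e^(2 pi i (M x, y)).  The sum over |k| <= n is therefore
m * int_Q G S_n h, with S_n h the cubic partial sum of the Fourier series of
[h].  If S_n h tends to [h] weakly against [G], the limit is m * int_Q G h.
Strict compatibility says conj(psi) phihat = 1 on delta T^d, so that this limit
is m * int fhat(M^T y) e^(2 pi i (x, M^T y)) dy = int fhat(xi) e^(2 pi i (x, xi))
dxi, which is f(x) for almost every x.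

For the weak convergence, [h] is bounded and [G] belongs to L^q, q > 1; as [Q]
has finite measure, q may be lowered to an exponent r whose conjugate p is a
power of 2.  The operators S_n are bounded on L^p uniformly in n (M. Riesz):
this is lemma [tnorm_ccut_bound], where p is reached from 2 by repeated
doubling through the identity [cotlar] for the discrete Hilbert transform.
Trigonometric polynomials are dense among the bounded functions for the L^p
norm ([approx_bounded]), and S_n reproduces a trigonometric polynomial as soon
as n exceeds its degree; hence [psum_err_weak].

The pointwise identities f(x) = int fhat(xi) e^(2 pi i (x, xi)) dxi and its
analogue for [phi] hold almost everywhere because [fhat] and [phihat] are
integrable: they belong to a Lebesgue space and vanish almost everywhere off a
bounded set.  By Fubini, both sides have the same integral against every
Schwartz function, and explicit smooth bumps increasing to indicators of boxes
conclude ([du_bois_reymond], [fourier_inversion]).  The change of variables is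
[scales_mulmx], proved by block elimination and induction on the dimension.
*)

(** * Lebesgue measure under affine maps *)

Definition image_measure d d' (T1 : measurableType d) (T2 : measurableType d')
    (R : realType) (m : {measure set T1 -> \bar R}) (f : T1 -> T2)
    (mf : measurable_fun setT f) : {measure set T2 -> \bar R}.
Proof. refine (pushforward m f : measure _ _); exact: mf. Defined.

Section affine.
Context (R : realType).
Local Notation lam := (@lebesgue_measure R).

(** [T] multiplies volumes by [s].  Measuring preimages makes the notion stable
under composition and gives the change of variables formula directly. *)
Definition scales n (s : R) (T : 'cV[R]_n -> 'cV[R]_n) :=
  measurable_fun setT T /\ forall A, measurable A ->
    (s%:E * lebesgue R n (T @^-1` A) = lebesgue R n A)%E.

Lemma scales_comp n s s' (T T' : 'cV[R]_n -> 'cV[R]_n) :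
  scales s T -> scales s' T' -> scales (s * s') (T \o T').
Proof.
move=> [mT sT] [mT' sT']; split; first exact: measurableT_comp.
move=> A mA; rewrite comp_preimage EFinM -muleA sT'; first exact: sT.
by rewrite -[X in measurable X]setTI; exact: mT.
Qed.

(** Both sides are measures in [A] and agree on half-open intervals, which
determine the Lebesgue measure. *)
Lemma lebesgue_measure_affine (a b : R) (A : set R) : a != 0 -> measurable A ->
  (`|a|%:E * lam ((fun t => (a * t + b)%R) @^-1` A) = lam A)%E.
Proof.
move=> a0 mA.
have mf : measurable_fun [set: measurableTypeR R]
    ((fun t => a * t + b) : measurableTypeR R -> measurableTypeR R).
  by apply: measurable_funD => //; apply: measurable_funM.
have an : 0 <= `|a| by [].
pose m : {measure set measurableTypeR R -> \bar R} :=
  mscale (NngNum an) (image_measure lam mf).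
rewrite [RHS](@lebesgue_measure_unique R m)//.
move=> X [[c d] /= _ <-]; rewrite /m/= /mscale/= /pushforward.
have [cd|dc] := ltP c d; last first.
  rewrite set_itv_ge ?preimage_set0 ?measure0 ?mule0//.
  by rewrite bnd_simp -leNgt.
rewrite lebesgue_measure_itv /= lte_fin cd -EFinB.
have [a_gt0|a_lt0|a_eq0] := ltgtP 0 a; last by rewrite -a_eq0 eqxx in a0.
- rewrite [X in lebesgue_measure X](_ : _ = `](c - b) / a, (d - b) / a]%classic).
    rewrite lebesgue_measure_itv /= lte_fin ltr_pM2r ?invr_gt0// ltrD2r cd.
    rewrite -EFinB -EFinM gtr0_norm//; congr EFin.
    by field.
  apply/seteqP; split=> t; rewrite /= !in_itv/= ltr_pdivrMr// ler_pdivlMr//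
    ltrBlDr lerBrDr [t * a]mulrC//.
- rewrite [X in lebesgue_measure X](_ : _ = `[(d - b) / a, (c - b) / a[%classic).
    rewrite lebesgue_measure_itv /= lte_fin ltr_nM2r ?invr_lt0// ltrD2r cd.
    rewrite -EFinB -EFinM ltr0_norm//; congr EFin.
    by field.
  apply/seteqP; split=> t; rewrite /= !in_itv/= ltr_ndivlMr// ler_ndivrMr//
    ltrBlDr lerBrDr [t * a]mulrC andbC//.
Qed.

Lemma lebesgueS1 n A : lebesgue R n.+1 A =
  (\int[lam]_t lebesgue R n (xsection (@vcons R n @^-1` A) t))%E.
Proof. by []. Qed.

Lemma measurable_vcons_preimage n (A : set 'cV[R]_n.+1) : measurable A ->
  measurable ((@vcons R n : measurableTypeR R * 'cV[R]_n -> _) @^-1` A).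
Proof. by move=> mA; rewrite -[X in measurable X]setTI; exact: measurable_vcons. Qed.

(** Slicing along the last [n] coordinates: the product measure does not depend
on the order of integration. *)
Lemma lebesgueS2 n A : measurable A -> lebesgue R n.+1 A =
  (\int[lebesgue R n]_y lam (ysection (@vcons R n @^-1` A) y))%E.
Proof.
move=> mA; rewrite /= /cons_measure /pushforward.
rewrite (@product_measure_unique _ _ _ _ _ _ _ (lam \x^ lebesgue R n)%E)//.
  by move=> B C mB mC; exact: product_measure2E.
exact: measurable_vcons_preimage.
Qed.

Lemma lebesgue_integral_scale n s (T : 'cV[R]_n -> 'cV[R]_n) g :
  0 < s -> scales s T -> measurable_fun setT g -> (forall x, 0 <= g x)%E ->
  (s%:E * \int[lebesgue R n]_x g (T x) = \int[lebesgue R n]_x g x)%E.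
Proof.
move=> s0 [mT sT] mg g0.
have := @ge0_integral_pushforward _ _ _ _ R T mT (lebesgue R n) setT g measurableT mg
  (fun x _ => g0 x).
rewrite preimage_setT => <-.
have -> : (s%:E * \int[pushforward (lebesgue R n) T]_y g y =
    \int[mscale (NngNum (ltW s0)) (image_measure (lebesgue R n) mT)]_y g y)%E.
  by rewrite ge0_integral_mscale.
apply: eq_measure_integral => A mA _; exact: sT.
Qed.

(** For fixed y, the first coordinate undergoes an affine map of slope [a]; slicing
at constant y reduces the claim to the real line and to [S]. *)
Lemma scales_upper n a s (b : 'cV[R]_n -> R) (S : 'cV[R]_n -> 'cV[R]_n) :
  a != 0 -> 0 < s -> measurable_fun setT b -> scales s S ->
  @scales n.+1 (`|a| * s)
    (fun x => vcons (a * (vuncons x).1 + b (vuncons x).2, S (vuncons x).2)).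
Proof.
move=> a0 s0 mb sS; have [mS _] := sS; split.
  apply: (measurableT_comp (@measurable_vcons R n)).
  have mu1 : measurable_fun setT (fun x : 'cV[R]_n.+1 => (vuncons x).1).
    exact: measurableT_comp measurable_fst (@measurable_vuncons R n).
  have mu2 : measurable_fun setT (fun x : 'cV[R]_n.+1 => (vuncons x).2).
    exact: measurableT_comp measurable_snd (@measurable_vuncons R n).
  apply/measurable_fun_pairP; split => /=.
    apply: measurable_funD; first exact: measurable_funM.
    exact: (measurableT_comp mb).
  exact: (measurableT_comp mS).
move=> A mA; rewrite [RHS]lebesgueS2//.
have mB := measurable_vcons_preimage mA.
set B := _ @^-1` A in mB *.
pose g y := lam (ysection B y).
have mg : measurable_fun setT g by exact: measurable_fun_ysection.
have mC : measurable ((fun x : 'cV[R]_n.+1 =>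
   vcons (a * (vuncons x).1 + b (vuncons x).2, S (vuncons x).2)) @^-1` A).
  rewrite -[X in measurable X]setTI.
  have mu1 : measurable_fun setT (fun x : 'cV[R]_n.+1 => (vuncons x).1).
    exact: measurableT_comp measurable_fst (@measurable_vuncons R n).
  have mu2 : measurable_fun setT (fun x : 'cV[R]_n.+1 => (vuncons x).2).
    exact: measurableT_comp measurable_snd (@measurable_vuncons R n).
  apply: (measurableT_comp (@measurable_vcons R n)) => //.
  apply/measurable_fun_pairP; split => /=.
    apply: measurable_funD; first exact: measurable_funM.
    exact: (measurableT_comp mb).
  exact: (measurableT_comp mS).
rewrite lebesgueS2//.
rewrite -(lebesgue_integral_scale s0 sS mg).
  2: by move=> x; exact: measure_ge0.
rewrite [(_ * s)%R]mulrC EFinM -muleA.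
 congr (_ * _)%E.
rewrite -ge0_integralZl//.
- apply: eq_integral => y _; rewrite /g.
  rewrite -(@lebesgue_measure_affine a (b y) (ysection B (S y)))//; last first.
    exact: measurable_ysection.
  congr (_ * lam _)%E.
  apply/funext => t; rewrite /ysection /preimage /mkset.
  rewrite !inE.
  rewrite /B /preimage /mkset vconsK.
  by [].
- apply: (@measurable_fun_ysection _ _ _ _ R lam).
  exact: measurable_vcons_preimage.
Qed.

(** A shear: each slice at constant first coordinate is translated. *)
Lemma scales_lower n (g : R -> 'cV[R]_n) :
  measurable_fun [set: measurableTypeR R] (g : measurableTypeR R -> _) ->
  (forall v, scales 1 (fun y : 'cV[R]_n => y + v)) ->
  @scales n.+1 1
    (fun x => vcons ((vuncons x).1, (vuncons x).2 + g (vuncons x).1)).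
Proof.
move=> mg tr.
have mT : measurable_fun setT (fun x : 'cV[R]_n.+1 =>
    vcons ((vuncons x).1, (vuncons x).2 + g (vuncons x).1)).
  apply: (measurableT_comp (@measurable_vcons R n)).
  have mu1 : measurable_fun setT (fun x : 'cV[R]_n.+1 => (vuncons x).1).
    exact: measurableT_comp measurable_fst (@measurable_vuncons R n).
  have mu2 : measurable_fun setT (fun x : 'cV[R]_n.+1 => (vuncons x).2).
    exact: measurableT_comp measurable_snd (@measurable_vuncons R n).
  apply/measurable_fun_pairP; split => //=.
  apply: measurable_cvecP => i.
  under eq_fun do rewrite mxE.
  apply: measurable_funD.
    exact: (measurableT_comp (measurable_coord i)).
  exact: (measurableT_comp (measurable_coord i) (measurableT_comp mg mu1)).
split => // A mA; rewrite mul1e !lebesgueS1.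
have mB := measurable_vcons_preimage mA.
apply: eq_integral => t _.
have [_ /(_ (xsection (@vcons R n @^-1` A) t))] := tr (g t).
rewrite mul1e => <-; last exact: measurable_xsection.
congr (lebesgue R n _).
apply/funext => y; rewrite /xsection /preimage /mkset !inE.
by rewrite /preimage /mkset vconsK.
Qed.

Lemma eq_scales n s (T T' : 'cV[R]_n -> 'cV[R]_n) :
  T =1 T' -> scales s T -> scales s T'.
Proof. by move=> /funext <-. Qed.

Lemma vuncons_ind n (P : 'cV[R]_n.+1 -> Prop) :
  (forall t y, P (vcons (t, y))) -> forall x, P x.
Proof. by move=> H x; rewrite -(vunconsK x); case: (vuncons x). Qed.

Lemma scales_translation n (v : 'cV[R]_n) : scales 1 (fun x => x + v).
Proof.
elim: n v => [|n IH] v.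
  apply: (@eq_scales 0 1 id); first by move=> x; apply/matrixP => -[].
  by split=> // A mA; rewrite mul1e.
have := @scales_upper n 1 1 (cst (vuncons v).1) _ (oner_neq0 _) ltr01
  (measurable_cst _) (IH (vuncons v).2).
rewrite normr1 mulr1; apply: eq_scales.
elim/vuncons_ind: v => s w; elim/vuncons_ind => t y.
rewrite !vconsK /= mul1r /vcons/= raddfD/=.
by rewrite [RHS](@add_col_mx _ 1 n 1).
Qed.

Lemma mulmx_block_vcons n (a : 'M[R]_1) (b : 'M[R]_(1, n)) (c : 'M[R]_(n, 1))
    (D : 'M[R]_n) t y :
  (block_mx a b c D : 'M[R]_(1 + n)) *m (vcons (t, y) : 'cV[R]_(1 + n)) =
  vcons (a ord0 ord0 * t + (b *m y) ord0 ord0, D *m y + t *: c).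
Proof.
rewrite /vcons/= mul_block_col mul_mx_scalar mul_mx_scalar addrC.
congr (col_mx _ _); last by rewrite addrC.
apply/matrixP => i j; rewrite (ord1 i) (ord1 j) !mxE eqxx mulr1n addrC.
by rewrite [t * _]mulrC.
Qed.

Lemma measurable_row_mul n (b : 'M[R]_(1, n)) :
  measurable_fun setT (fun y : 'cV[R]_n => (b *m y) ord0 ord0).
Proof.
under eq_fun do rewrite mxE.
apply: measurable_sum => i; apply: measurable_funM => //.
exact: measurable_coord.
Qed.

Lemma scales_ublock n (a : 'M[R]_1) (b : 'M[R]_(1, n)) (D : 'M[R]_n) s :
  a ord0 ord0 != 0 -> 0 < s -> scales s (mulmx D) ->
  @scales n.+1 (`|a ord0 ord0| * s) (mulmx (block_mx a b 0 D : 'M[R]_(1 + n))).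
Proof.
move=> a0 s0 sD.
have := scales_upper a0 s0 (measurable_row_mul b) sD.
apply: eq_scales; elim/vuncons_ind => t y.
by rewrite mulmx_block_vcons !vconsK /= scaler0 addr0.
Qed.

Lemma scales_lblock n (c : 'M[R]_(n, 1)) :
  @scales n.+1 1 (mulmx (block_mx 1%:M 0 c 1%:M : 'M[R]_(1 + n))).
Proof.
have mg : measurable_fun [set: measurableTypeR R]
    ((fun t => t *: c) : measurableTypeR R -> 'cV[R]_n).
  apply: measurable_cvecP => i; under eq_fun do rewrite mxE.
  exact: measurable_funM.
have := scales_lower mg (@scales_translation n).
apply: eq_scales; elim/vuncons_ind => t y.
rewrite mulmx_block_vcons !vconsK /= mul0mx !mxE eqxx mulr1n mul1r addr0.
by rewrite mul1mx.
Qed.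

(** Induction on the dimension by block elimination: a matrix with a nonzero
corner factors as a shear times a block upper triangular matrix.  If the corner
vanishes, some entry below it does not, and adding that row to the first one
brings it there; this elementary operation has determinant 1. *)
Lemma scales_mulmx n (M : 'M[R]_n) : \det M != 0 -> scales `|\det M| (mulmx M).
Proof.
elim: n M => [|n IH] M dM.
  rewrite det_mx00 normr1; apply: (@eq_scales 0 1 id).
    by move=> x; apply/matrixP => -[].
  by split=> // A mA; rewrite mul1e.
have scale1 : scales 1 (mulmx (1%:M : 'M[R]_n)).
  have [] := IH 1%:M; first by rewrite det1 oner_eq0.
  by rewrite det1 normr1.
have pivot (N : 'M[R]_(1 + n)) : (ulsubmx N) ord0 ord0 != 0 -> \det N != 0 ->
    @scales n.+1 `|\det N| (mulmx N).
  set a := ulsubmx N => a0 dN.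
  have Ea : a = (a ord0 ord0)%:M.
    by apply/matrixP => i j; rewrite (ord1 i) (ord1 j) [RHS]mxE eqxx mulr1n.
  pose c := (a ord0 ord0)^-1 *: dlsubmx N.
  pose D := drsubmx N - c *m ursubmx N.
  have EN : N = block_mx 1%:M 0 c 1%:M *m block_mx a (ursubmx N) 0 D.
    rewrite mulmx_block !mul1mx !mul0mx !addr0 /D addrCA subrr addr0.
    have -> : c *m a = dlsubmx N.
      by rewrite Ea mul_mx_scalar scalerA mulfV// scale1r.
    by rewrite submxK.
  have dE : \det N = a ord0 ord0 * \det D.
    by rewrite {1}EN det_mulmx det_lblock !det1 !mul1r det_ublock {1}Ea det_scalar1.
  have dD : \det D != 0 by apply: contra dN => /eqP D0; rewrite dE D0 mulr0.
  rewrite dE normrM -[X in scales X _]mul1r.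
  apply: (@eq_scales _ _ (mulmx (block_mx 1%:M 0 c 1%:M : 'M[R]_(1 + n)) \o
     mulmx (block_mx a (ursubmx N) 0 D : 'M[R]_(1 + n)))).
    by move=> x /=; rewrite mulmxA -EN.
  apply: scales_comp; first exact: scales_lblock.
  by apply: scales_ublock => //; [rewrite normr_gt0|exact: IH].
have [|M00] := boolP ((ulsubmx (M : 'M[R]_(1 + n))) ord0 ord0 == 0); last exact: pivot.
move=> /eqP M00.
have [i Mi0] : exists i, (dlsubmx (M : 'M[R]_(1 + n))) i ord0 != 0.
  apply/existsP; apply: contraNT dM => /existsPn M0.
  rewrite -(@submxK _ 1 n 1 n M).
  have -> : ulsubmx (M : 'M[R]_(1 + n)) = 0.
    by apply/matrixP => i j; rewrite (ord1 i) (ord1 j) M00 mxE.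
  have -> : dlsubmx (M : 'M[R]_(1 + n)) = 0.
    apply/matrixP => i j; rewrite (ord1 j) [RHS]mxE.
    by have /negPn/eqP := M0 i.
  by rewrite [X in X == _](@det_ublock _ 1 n) det_mx11 mxE mul0r.
pose E (w : 'M[R]_(1, n)) : 'M[R]_(1 + n) := block_mx 1%:M w 0 1%:M.
have dE w : \det (E w) = 1 by rewrite det_ublock !det1 mul1r.
pose w : 'M[R]_(1, n) := delta_mx ord0 i.
have EE : M = E (- w) *m (E w *m M).
  rewrite mulmxA mulmx_block !mul1mx !mulmx1 !mul0mx !mulmx0 !addr0 add0r subrr.
  by rewrite -[block_mx _ _ _ _]scalar_mx_block mul1mx.
have -> : \det M = \det (E w *m M) by rewrite det_mulmx dE mul1r.
rewrite -[X in scales X _]mul1r.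
apply: (@eq_scales _ _ (mulmx (E (- w)) \o mulmx (E w *m M))).
  by move=> x /=; rewrite mulmxA -EE.
apply: scales_comp.
  have := @scales_ublock n 1%:M (- w) 1%:M 1.
  by rewrite !mxE eqxx mulr1n normr1 mulr1; apply => //; exact: oner_neq0.
apply: pivot; last by rewrite det_mulmx dE mul1r.
have -> : @ulsubmx _ 1 n 1 n (E w *m M) =
    @ulsubmx _ 1 n 1 n M + w *m @dlsubmx _ 1 n 1 n M.
  rewrite -{1}(@submxK _ 1 n 1 n M) /E (@mulmx_block _ 1 n 1 n 1 n).
  by rewrite block_mxKul mul1mx.
rewrite mxE M00 add0r -rowE.
by rewrite mxE.
Qed.

End affine.

(** * Boxes and almost everywhere vanishing functions *)

Section boxes.
Context (R : realType) (d : nat).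
Local Notation V := 'cV[R]_d.
Local Notation mu := (lebesgue R d).

Definition obox (a b : 'I_d -> R) : set V :=
  [set x | forall i, a i < x i ord0 < b i].

Let oboxE a b :
  obox a b = [set x | forall i, (fun j => `]a j, b j[%classic) i (x i ord0)].
Proof. by apply/seteqP; split => x xab i; have := xab i; rewrite /= in_itv. Qed.

Lemma measurable_obox a b : measurable (obox a b).
Proof.
rewrite oboxE; apply: (@measurable_cvec_box R d (fun j => `]a j, b j[%classic)).
by move=> i; exact: measurable_itv.
Qed.

Lemma lebesgue_obox a b : (forall i, a i <= b i) ->
  mu (obox a b) = (\prod_(i < d) (b i - a i))%:E.
Proof.
move=> ab; rewrite oboxE (@lebesgue_box R d (fun j => `]a j, b j[%classic))// -prodEFin; apply: eq_bigr => i _.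
rewrite lebesgue_measure_itv /= lte_fin; case: ltP => //.
by move=> ba; rewrite (@le_anti _ _ (a i) (b i)) ?subrr// ab ba.
Qed.

Lemma lebesgue_obox_lty a b : (mu (obox a b) < +oo)%E.
Proof.
rewrite (@le_lt_trans _ _ (mu (obox (fun i => Num.min (a i) (b i)) b)))//.
  apply: le_measure; rewrite ?inE; try exact: measurable_obox.
  move=> x xab i; have /andP[ax ->] := xab i; rewrite andbT.
  by rewrite (le_lt_trans _ ax)// ge_min lexx.
by rewrite lebesgue_obox ?ltry// => i; rewrite ge_min lexx orbT.
Qed.

Lemma setI_closed_obox :
  setI_closed [set A | exists a b, A = obox a b].
Proof.
move=> _ _ [a [b ->]] [a' [b' ->]].
exists (fun i => Num.max (a i) (a' i)), (fun i => Num.min (b i) (b' i)).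
apply/seteqP; split=> x.
  by move=> [xab xab'] i; rewrite gt_max lt_min; case/andP: (xab i) => -> ->;
    case/andP: (xab' i) => -> ->.
by move=> H; split=> i; have := H i; rewrite gt_max lt_min;
  case/andP=> /andP[h1 h2] /andP[h3 h4]; rewrite ?h1 ?h2 ?h3 ?h4.
Qed.

Definition cball (r : R) : set V := obox (fun=> - r) (fun=> r).

Lemma cball_cover (x : V) : exists n : nat, cball n%:R x.
Proof.
exists (Num.truncn (\sum_i `|x i ord0|)).+1 => i.
rewrite -ltr_norml; apply: le_lt_trans (truncnS_gt _).
by rewrite (bigD1 i)//= lerDl sumr_ge0.
Qed.

Lemma bigcup_cball : \bigcup_n cball n%:R = setT.
Proof. by apply/seteqP; split=> // x _; have [n xn] := cball_cover x; exists n. Qed.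

(** A coordinate half-space is a countable union of boxes. *)
Lemma measurable_g_obox :
  @measurable _ V = <<s [set A | exists a b, A = obox a b] >>.
Proof.
apply/seteqP; split; last first.
  apply: smallest_sub; first exact: sigma_algebra_measurable.
  by move=> _ [a [b ->]]; exact: measurable_obox.
apply: smallest_sub; first exact: smallest_sigma_algebra.
rewrite -bigcup_seq/=; apply: bigcup_sub => i _ _ [B mB <-].
pose G := [set A : set V | exists a b, A = obox a b].
have : measurable_fun setT ((fun x => x i ord0) : g_sigma_algebraType G -> R).
  apply: (measurability _ (RGenOInfty.measurableE R)) => _ [_ [r ->] <-].
  have -> : [set: g_sigma_algebraType G] `&`
      (fun x : g_sigma_algebraType G => x i ord0) @^-1` `]r, +oo[ =
      \bigcup_n obox (fun j => if j == i then r else - n%:R) (fun=> n%:R).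
    apply/seteqP; split => x.
      rewrite /= in_itv /= andbT => -[_ rx].
      have [n xn] := cball_cover x; exists n => // j.
      by have /andP[h1 ->] := xn j; case: eqVneq => [->|]; rewrite ?rx ?h1.
    move=> [n _ xn]; split => //=; rewrite in_itv /= andbT.
    by have := xn i; rewrite eqxx => /andP[].
  apply: bigcup_measurable => n _; apply: sub_sigma_algebra.
  by do 2 eexists; reflexivity.
by move=> /(_ measurableT B mB).
Qed.

(** The integral of [w] vanishes on every Borel subset of a box by Dynkin's
theorem, in particular on the sets where [w] has constant sign. *)
Lemma ae_eq0_of_obox_integral (w : V -> R) :
  (forall a b, mu.-integrable (obox a b) (EFin \o w)) ->
  (forall a b, \int[mu]_(x in obox a b) (w x)%:E = 0)%E ->
  {ae mu, forall x, w x = 0}.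
Proof.
move=> iw w0.
have mK n : measurable (cball n) by exact: measurable_obox.
have mw : measurable_fun setT w.
  rewrite -bigcup_cball; apply/measurable_fun_bigcup => n //.
  by apply/measurable_EFinP; apply: (measurable_int mu); exact: iw.
have iwS n A : measurable A -> A `<=` cball n -> mu.-integrable A (EFin \o w).
  by move=> mA An; apply: (integrableS _ mA An (iw _ _)); exact: mK.
have w0A n A : measurable A -> (\int[mu]_(x in A `&` cball n) (w x)%:E = 0)%E.
  move=> mA; move: (mA); rewrite measurable_g_obox.
  move: A {mA}; apply: dynkin_induction.
  - exact: measurable_g_obox.
  - exact: setI_closed_obox.
  - by rewrite setTI; exact: w0.
  - move=> _ [a [b ->]].
    have [a' [b' ->]] : [set A | exists a b, A = obox a b] (obox a b `&` cball n).
      by apply: setI_closed_obox; do 2 eexists; reflexivity.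
    exact: w0.
  - move=> S mS S0.
    have : (\int[mu]_(x in cball n) (w x)%:E = 0)%E by exact: w0.
    rewrite -{1}(setIT (cball n)) -(setUv S) setIUr integral_setU/=.
    + by rewrite setIC S0 add0e setIC.
    + exact: measurableI.
    + by apply: measurableI => //; exact: measurableC.
    + exact/measurable_EFinP/measurable_funTS.
    + by rewrite disj_set2E; apply/eqP; apply/seteqP; split=> // x [[_ ?] [_]].
  - move=> F mF tF F0; rewrite setI_bigcupl integral_bigcup.
    + by apply: eseries0 => i _ _; exact: F0.
    + by apply/trivIsetP => i j _ _ ij; move/trivIsetP: tF => /(_ i j Logic.I Logic.I ij) Fij;
        rewrite setIACA Fij set0I.
    + by move=> k; exact: measurableI.
    + rewrite -setI_bigcupl; apply: (iwS n) => //.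
      by apply: measurableI => //; exact: bigcup_measurable.
have wK n : {ae mu, forall x, cball n x -> w x = 0}.
  have : (\int[mu]_(x in cball n) `|(w x)%:E| = 0)%E.
    pose P := [set x | 0 <= w x].
    have mP : measurable P.
      by rewrite -[P]setTI; apply: measurable_fun_le => //; exact: measurable_cst.
    rewrite -{1}(setIT (cball n)) -(setUv P) setIUr integral_setU/=.
    + rewrite [X in (X + _)%E](_ : _ = 0)%E; last first.
        rewrite -(w0A n P mP) setIC; apply: eq_integral => x /set_mem[/= Px _].
        by rewrite ger0_norm.
      rewrite add0e.
      have iC : mu.-integrable (~` P `&` cball n) (EFin \o w).
        by apply: (iwS n) => //; apply: measurableI => //; exact: measurableC.
      rewrite setIC (eq_integral (fun x => - (w x)%:E)%E).
        rewrite integralN; last first.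
          apply: (integrable_add_def _ iC).
          by apply: measurableI => //; exact: measurableC.
        by rewrite (w0A n (~` P)) ?oppe0//; exact: measurableC.
      move=> x /set_mem[/= /negP]; rewrite -ltNge => Px _.
      by rewrite ltr0_norm.
    + exact: measurableI.
    + by apply: measurableI => //; exact: measurableC.
    + by apply/measurable_EFinP; apply: measurableT_comp => //; exact: measurable_funTS.
    + by rewrite disj_set2E; apply/eqP; apply/seteqP; split=> // x [[_ ?] [_]].
  move/(ae_eq_integral_abs mu (mK n) (f := EFin \o w)).
  move=> /(_ _)/[!(@measurable_EFinP)] H.
  have := H (measurable_funTS mw).
  by apply: filterS => x /= Hx /Hx [].
have := ae_foralln (fun n : nat => wK n%:R).
apply: filterS => x H; have [n xn] := cball_cover x; exact: H xn.
Qed.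

End boxes.

Section esupp.
Context (R : realType) (d : nat).
Local Notation V := 'cV[R]_d.
Local Notation mu := (lebesgue R d).

Definition qbox (q : {ffun 'I_d -> rat * rat}) : set V :=
  obox (fun i => ratr (q i).1) (fun i => ratr (q i).2).

Lemma open_qbox (U : set V) x : open U -> U x ->
  exists2 q, qbox q x & qbox q `<=` U.
Proof.
move=> oU Ux.
have /nbhs_ballP[e /= e0 eU] : nbhs x U by exact: open_nbhs_nbhs.
have ex i : exists p : rat * rat, [&& x i ord0 - e < ratr p.1, ratr p.1 < x i ord0,
    x i ord0 < ratr p.2 & ratr p.2 < x i ord0 + e].
  have [p1 /itvP p1P] := @rat_in_itvoo R (x i ord0 - e) (x i ord0) ltac:(lra).
  have [p2 /itvP p2P] := @rat_in_itvoo R (x i ord0) (x i ord0 + e) ltac:(lra).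
  by exists (p1, p2); rewrite !p1P !p2P.
exists [ffun i => sval (cid (ex i))].
  by move=> i; rewrite ffunE; case: cid => p /= /and4P[_ -> -> _].
move=> y qy; apply: eU; split=> // i j; rewrite (ord1 j) /= /ball/= ltr_norml.
have := qy i; rewrite ffunE; case: cid => p /= /and4P[p1 p2 p3 p4] /andP[q1 q2].
by apply/andP; split; lra.
Qed.

(** Countably many rational boxes form a base of the topology, so the largest
open set on which [g] vanishes almost everywhere is a countable union of boxes
with that property. *)
Lemma ae_eq0_off_esupp (g : V -> R[i]) : {ae mu, forall x, ~ esupp g x -> g x = 0}.
Proof.
pose P (q : {ffun 'I_d -> rat * rat}) := {ae mu, forall y, qbox q y -> g y = 0}.
have H : forall n : nat, {ae mu, forall x,
    forall q, unpickle n = Some q -> P q -> qbox q x -> g x = 0}.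
  move=> n; case: (unpickle n) => [q|]; last by apply: aeW.
  have [Pq|nPq] := pselect (P q); last by apply: aeW => x q' [<-].
  by apply: filterS Pq => x Hx q' [<-] _.
have := ae_foralln H; apply: filterS => x Hx /existsNP[U].
move=> /not_implyP[oU] /not_implyP[Ux] /contrapT gU.
have [q qx qU] := open_qbox oU Ux.
apply: (Hx (pickle q) q) => //; first exact: pickleK.
by apply: filterS gU => y Hy /qU /Hy.
Qed.

End esupp.

(** * Smooth bumps on boxes *)

Section bump1d.
Context (R : realType) (c : R) (c0 : 0 < c).

(** The powers of 1/t are part of the definition because the span of these
functions is stable under differentiation: see [is_derive_flat]. *)
Definition flat (n : nat) (t : R) : R :=
  if 0 < t then t^-1 ^+ n * expR (- (c / t)) else 0.

Lemma flatS n t : flat n t = flat n.+1 t * t.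
Proof.
rewrite /flat; case: ifPn => [t0|]; last by rewrite mul0r.
by rewrite [RHS]mulrC exprS !mulrA mulfV ?mul1r// gt_eqF.
Qed.

Lemma flat_ge0 n t : 0 <= flat n t.
Proof.
rewrite /flat; case: ifPn => // t0.
by rewrite mulr_ge0 ?expR_ge0// exprn_ge0// invr_ge0 ltW.
Qed.

(** The exponential series gives e^(c/t) >= (c/t)^n / n!. *)
Lemma flat_bounded n : exists K, forall t, flat n t <= K.
Proof.
exists (Num.max 1 (n`!%:R / c ^+ n)) => t; rewrite /flat.
case: ifPn => t0; last by rewrite le_max ler01.
case: n => [|n].
  rewrite expr0 mul1r le_max expRN invf_le1 ?expR_gt0//.
  by rewrite (le_trans _ (expR_ge1Dx _))// lerDl divr_ge0 ?ltW.
rewrite le_max; apply/orP; right.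
have ct : 0 <= c / t by rewrite divr_ge0 ?ltW.
have := expR_ge1Dxn n ct; rewrite expRN => H.
rewrite ler_pdivrMr ?expR_gt0// mulrC -ler_pdivrMr; last first.
  by rewrite divr_gt0 ?exprn_gt0// ltr0n fact_gt0.
apply: le_trans H; apply: ler_wpDl => //.
by rewrite invf_div exprMn mulrCA mulrA [X in X <= _]mulrC mulrC.
Qed.

Lemma is_derive_flat n (t : R) :
  is_derive t 1 (flat n) (c * flat n.+2 t - n%:R * flat n.+1 t).
Proof.
have [t0|t0|t0] := ltgtP 0 t.
- have : is_derive t 1 (fun t => t^-1 ^+ n * expR (- (c / t)))
      (c * flat n.+2 t - n%:R * flat n.+1 t).
    have tV : is_derive t 1 (fun t : R => t^-1) (- t ^- 2).
      by have := @is_deriveV R id t 1 1 _ _; rewrite gt_eqF// => /(_ isT);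
        rewrite scaler1 /GRing.inv/= ; apply.
    have tE : is_derive t 1 (expR \o (fun s : R => - (c *: s^-1)))
        (expR (- (c / t)) * - (c *: - t ^- 2)).
      exact: is_derive1_comp.
    have tX : is_derive t 1 (fun s : R => s^-1 ^+ n) (n%:R * t^-1 ^+ n.-1 * - t ^- 2).
      have := @is_deriveX _ _ (fun s : R => s^-1) n t 1 _ tV.
      by rewrite exprfctE.
    apply: (is_derive_eq (is_deriveM tX tE)); rewrite /flat t0 /=.
    rewrite /GRing.scale/= !exprVn.
    case: n {tX} => [|m] /=; rewrite ?exprS; field; rewrite ?gt_eqF ?exprn_gt0//.
  apply: near_eq_is_derive.
  near=> s; rewrite /flat ifT//; near: s; exact: lt_nbhsr.
- have := @is_derive_cst _ _ _ (0 : R) t 1.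
  rewrite /flat ltNge (ltW t0)/= !mulr0 subrr.
  apply: near_eq_is_derive.
  near=> s; rewrite /flat ifF//; apply/negbTE; rewrite -leNgt ltW//.
  near: s; exact: lt_nbhsl.
- rewrite -{}t0 [X in is_derive _ _ _ X](_ : _ = 0); last first.
    by rewrite /flat ltxx !mulr0 subrr.
  apply/is_derive1_caratheodory; exists (flat n.+1); split.
  (* At 0 the difference quotient of flat n is flat n.+1, which tends to 0. *)
  + by move=> z; rewrite [flat n 0]/flat ltxx !subr0 -flatS.
  + have [K HK] := flat_bounded n.+2.
    have f0 : flat n.+1 0 = 0 by rewrite /flat ltxx.
    rewrite /prop_for /continuous_at f0; apply/cvgr0Pnorm_lt => e e0 /=.
    have K0 : 0 <= K by apply: le_trans (HK 0); exact: flat_ge0.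
    have e1 : 0 < e / (K + 1) by rewrite divr_gt0// ltr_wpDl.
    exists (e / (K + 1)) => // s; rewrite /ball_ /= sub0r normrN => se.
    rewrite ger0_norm ?flat_ge0// flatS.
    have [s0|s0] := leP s 0.
      by rewrite (le_lt_trans _ e0)// mulr_ge0_le0 ?flat_ge0.
    apply: (@le_lt_trans _ _ ((K + 1) * s)).
      by rewrite ler_pM2r// (le_trans (HK s))// lerDl.
    by rewrite mulrC -ltr_pdivlMr ?ltr_wpDl// -(gtr0_norm s0).
  + by rewrite /flat ltxx.
Unshelve. all: by end_near. Qed.

End bump1d.

Section bump.
Context (R : realType) (d : nat) (c : R) (c0 : 0 < c).
Local Notation V := 'cV[R]_d.

(** An algebra of functions containing the bumps and closed under partial
derivatives: smoothness and boundedness of all derivatives follow by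
induction. *)
Inductive flat_algebra : (V -> R) -> Prop :=
| flat_algebra_coord n s a j :
    flat_algebra (fun x => flat c n (s * (x j ord0 - a)))
| flat_algebra_cst k : flat_algebra (fun=> k)
| flat_algebraD u v : flat_algebra u -> flat_algebra v ->
    flat_algebra (fun x => u x + v x)
| flat_algebraM u v : flat_algebra u -> flat_algebra v ->
    flat_algebra (fun x => u x * v x).

Lemma is_derive_coord (phi : R -> R) dphi (x : V) (i j : 'I_d) :
  is_derive (x j ord0) 1 phi dphi ->
  is_derive x (delta_mx i ord0 : V) (fun y : V => phi (y j ord0))
    ((i == j)%:R * dphi).
Proof.
move=> phiE; have [ij|ij] := eqVneq i j; last first.
  rewrite mul0r; have E : (fun h : R => h^-1 *: (phi ((h *: (delta_mx i ord0 : V) + x) j ord0)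
      - phi (x j ord0))) = cst 0.
    apply/funext => h; rewrite !mxE [j == i]eq_sym (negbTE ij) mulr0 add0r.
    by rewrite subrr scaler0.
  apply: DeriveDef.
    by rewrite /derivable E; exact: is_cvg_cst.
  by rewrite /derive E; exact: lim_cst.
subst j; rewrite mul1r.
have E : (fun h : R => h^-1 *: (phi ((h *: (delta_mx i ord0 : V) + x) i ord0)
    - phi (x i ord0))) =
    (fun h : R => h^-1 *: (phi (h *: 1 + x i ord0) - phi (x i ord0))).
  by apply/funext => h; rewrite !mxE !eqxx.
apply: DeriveDef.
  by rewrite /derivable E; exact: (@ex_derive _ _ _ _ _ _ _ phiE).
by rewrite /derive E; exact: (@derive_val _ _ _ _ _ _ _ phiE).
Qed.

Lemma flat_algebra_bounded u : flat_algebra u -> exists K, forall x, `|u x| <= K.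
Proof.
elim=> [n s a j|k|v w _ [K HK] _ [L HL]|v w _ [K HK] _ [L HL]].
- have [K HK] := flat_bounded c0 n; exists K => x.
  by rewrite ger0_norm ?flat_ge0.
- by exists `|k|.
- by exists (K + L) => x; rewrite (le_trans (ler_normD _ _))// lerD.
- by exists (K * L) => x; rewrite normrM ler_pM.
Qed.

Lemma flat_algebra_is_derive u (i : 'I_d) : flat_algebra u ->
  exists2 v, flat_algebra v & forall x, is_derive x (delta_mx i ord0 : V) u (v x).
Proof.
elim=> [n s a j|k|v w Av [v' Av' dv] Aw [w' Aw' dw]|v w Av [v' Av' dv] Aw [w' Aw' dw]].
- exists (fun x => ((i == j)%:R * s * c) * flat c n.+2 (s * (x j ord0 - a)) +
    (- (i == j)%:R * s * n%:R) * flat c n.+1 (s * (x j ord0 - a))).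
    by apply: flat_algebraD; apply: flat_algebraM;
      [exact: flat_algebra_cst|exact: flat_algebra_coord..|exact: flat_algebra_cst|exact: flat_algebra_coord].
  move=> x.
  have dl : is_derive (x j ord0) 1 (fun t => s * (t - a)) s.
    have : is_derive (x j ord0) (1 : R) (cst s * (id - cst a))
      (s *: (1 - 0 : R) + (x j ord0 - a) *: (0 : R)).
      by apply: is_deriveM.
    by move=> H; apply: (is_derive_eq H); rewrite subr0 scaler0 addr0 /GRing.scale/= mulr1.
  have df := is_derive_flat c0 n (s * (x j ord0 - a)).
  have dfl := @is_derive1_comp _ (flat c n) (fun t => s * (t - a)) (x j ord0) _ _ df dl.
  by apply: (is_derive_eq (@is_derive_coord _ _ x i j dfl)); ring.
- exists (fun=> 0); first exact: flat_algebra_cst.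
  by move=> x; exact: is_derive_cst.
- exists (fun x => v' x + w' x); first exact: flat_algebraD.
  by move=> x; exact: is_deriveD.
- exists (fun x => v x * w' x + w x * v' x).
    by apply: flat_algebraD; exact: flat_algebraM.
  by move=> x; exact: is_deriveM.
Qed.

Lemma flat_continuous n : continuous (flat c n).
Proof.
move=> t; apply: differentiable_continuous; apply/derivable1_diffP.
exact: (@ex_derive _ _ _ _ _ _ _ (is_derive_flat c0 n t)).
Qed.

Lemma flat_algebra_continuous u : flat_algebra u -> continuous u.
Proof.
elim=> [n s a j|k|v w _ cv _ cw|v w _ cv _ cw] x.
- have := @flat_continuous n (s * (x j ord0 - a)).
  apply: (@continuous_comp _ _ _ (fun x : V => s * (x j ord0 - a)) (flat c n)).
  apply: (@continuousM _ _ (cst s) (fun x1 : V => x1 j ord0 - a)).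
    exact: cst_continuous.
  apply: (@continuousB _ _ _ (fun x1 : V => x1 j ord0) (cst a)).
    exact: coord_continuous.
  exact: cst_continuous.
- exact: cst_continuous.
- by apply: continuousD; [exact: cv|exact: cw].
- by apply: continuousM; [exact: cv|exact: cw].
Qed.

Lemma partial_real (u v : V -> R) i :
  (forall x, is_derive x (delta_mx i ord0 : V) u (v x)) ->
  partial i (fun x => (u x)%:C%C) = (fun x => (v x)%:C%C).
Proof.
move=> uv; apply/funext => x; rewrite /partial /=; congr (_ +i* _)%C.
  exact: (@derive_val _ _ _ _ _ _ _ (uv x)).
exact: derive_cst.
Qed.

Lemma flat_algebra_partials s u : flat_algebra u ->
  exists2 v, flat_algebra v & partials s (fun x => (u x)%:C%C) = (fun x => (v x)%:C%C).
Proof.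
move=> Au; elim: s => [|i s [v Av vE]]; first by exists u.
have [w Aw wE] := flat_algebra_is_derive i Av.
by exists w => //=; rewrite vE; exact: partial_real.
Qed.

Lemma flat_algebra_smooth u : flat_algebra u -> smooth (fun x => (u x)%:C%C).
Proof.
move=> Au s; have [v Av ->] := flat_algebra_partials s Au; split => /=.
- exact: flat_algebra_continuous.
- exact: cst_continuous.
- move=> i x; have [w Aw wE] := flat_algebra_is_derive i Av; split.
    exact: (@ex_derive _ _ _ _ _ _ _ (wE x)).
  exact: derivable_cst.
Qed.

Definition cbox (a b : 'I_d -> R) : set V :=
  [set x | forall i, a i <= x i ord0 <= b i].

Lemma open_setC_cbox a b : open (~` cbox a b).
Proof.
rewrite openC (_ : cbox a b = \bigcap_i [set x | a i <= x i ord0 <= b i]); last first.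
  by apply/seteqP; split=> x H; [move=> i _; exact: H|move=> i; exact: H].
apply: closed_bigI => i _.
have cl : closed ((fun x : V => x i ord0) @^-1` `[a i, b i]%classic).
  apply: closed_comp; last exact: itv_closed.
  by move=> x _; exact: coord_continuous.
suff E : (fun x : V => x i ord0) @^-1` `[a i, b i]%classic =
    [set x : V | a i <= x i ord0 <= b i] by rewrite E in cl.
by apply/seteqP; split => x /=; rewrite in_itv.
Qed.

Lemma partials_support a b (g : V -> R[i]) s :
  (forall x, ~ cbox a b x -> g x = 0) ->
  forall x, ~ cbox a b x -> partials s g x = 0.
Proof.
move=> g0; elim: s => [|i s IH] //= x xab.
rewrite /partial.
have nx : nbhs x (~` cbox a b) by apply: open_nbhs_nbhs; split => //; exact: open_setC_cbox.
rewrite (@near_eq_derive _ _ _ _ (cst 0)); last first.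
  by apply: filterS nx => y /IH ->.
rewrite (@near_eq_derive _ _ _ (fun y => complex.Im _) (cst 0)); last first.
  by apply: filterS nx => y /IH ->.
by rewrite !derive_cst.
Qed.

Lemma mx_norm_cbox a b (x : V) : cbox a b x ->
  `|x| <= \sum_i (`|a i| + `|b i|).
Proof.
move=> xab; rewrite [`|x|](mx_normrE x); apply: bigmax_le.
  by apply: sumr_ge0 => i _; rewrite addr_ge0.
move=> [i j] _ /=; rewrite (bigD1 i)//= (ord1 j).
have := xab i => /andP[ax xb].
apply: (@le_trans _ _ (`|a i| + `|b i|)); last first.
  by rewrite lerDl sumr_ge0// => k _; rewrite addr_ge0.
have := ler_norm (b i); have := ler_norm (- a i); rewrite normrN.
have := normr_ge0 (a i); have := normr_ge0 (b i).
by case: (ger0P (x i ord0)); lra.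
Qed.

Lemma flat_algebra_schwartz u a b : flat_algebra u ->
  (forall x, ~ cbox a b x -> u x = 0) -> schwartz (fun x => (u x)%:C%C).
Proof.
move=> Au u0; split; first exact: flat_algebra_smooth.
move=> N s; have [v Av vE] := flat_algebra_partials s Au.
have [K HK] := flat_algebra_bounded Av.
rewrite /schwartz_seminorm vE.
have v0 x : ~ cbox a b x -> v x = 0.
  move=> xab; have := @partials_support a b (fun x => (u x)%:C%C) s _ x xab.
  rewrite vE => H; have /(congr1 (@complex.Re R))// : (v x)%:C%C = 0.
  by apply: H => y /u0 ->.
pose M := \sum_i (`|a i| + `|b i|).
have M0 : 0 <= M by apply: sumr_ge0 => i _; rewrite addr_ge0.
apply: (@le_lt_trans _ _ ((1 + M) ^+ N * K)%:E); last exact: ltry.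
apply: ge_ereal_sup => _ [x _ <-]; rewrite lee_fin.
rewrite /normc /= expr0n/= addr0 sqrtr_sqr.
have [xab|xab] := pselect (cbox a b x); last first.
  rewrite v0// normr0 mulr0 mulr_ge0 ?exprn_ge0 ?addr_ge0//.
  by rewrite (le_trans _ (HK 0)).
apply: ler_pM => //.
rewrite lerXn2r ?nnegrE ?addr_ge0// lerD2l.
exact: mx_norm_cbox.
Qed.

(** By [bump_obox], this is exp(- c * S) on the open box, with S >= 0 finite, so
that it tends to the indicator of the box when c tends to 0. *)
Definition bump (a b : 'I_d -> R) (x : V) : R :=
  \prod_i (flat c 0 (x i ord0 - a i) * flat c 0 (b i - x i ord0)).

Lemma flat_algebra_bump a b : flat_algebra (bump a b).
Proof.
rewrite /bump.
elim: (index_enum _) => [|i r IH].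
  rewrite (_ : (fun=> _) = fun=> 1); first exact: flat_algebra_cst.
  by apply/funext => x; rewrite big_nil.
under [X in flat_algebra X]eq_fun do rewrite big_cons.
apply: flat_algebraM => //; apply: flat_algebraM.
  rewrite (_ : (fun _ => _) = fun x : V => flat c 0 (1 * (x i ord0 - a i))).
    exact: flat_algebra_coord.
  by apply/funext => x; rewrite mul1r.
rewrite (_ : (fun _ => _) = fun x : V => flat c 0 (- 1 * (x i ord0 - b i))).
  exact: flat_algebra_coord.
by apply/funext => x; rewrite mulN1r opprB.
Qed.

Lemma bump_eq0 a b x : ~ obox a b x -> bump a b x = 0.
Proof.
move=> /existsNP[i /negP]; rewrite negb_and -!leNgt => xab.
rewrite /bump (bigD1 i)//= /flat !subr_gt0 !ltNge.
by case/orP: xab => -> /=; rewrite ?mulr0 ?mul0r.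
Qed.

Lemma schwartz_bump a b : schwartz (fun x => (bump a b x)%:C%C).
Proof.
apply: (@flat_algebra_schwartz _ a b); first exact: flat_algebra_bump.
move=> x xab; apply: bump_eq0; apply: contra_not xab => xab i.
by have /andP[/ltW -> /ltW ->] := xab i.
Qed.

Lemma bump_obox a b x : obox a b x ->
  bump a b x = expR (- (c * \sum_i ((x i ord0 - a i)^-1 + (b i - x i ord0)^-1))).
Proof.
move=> xab; rewrite mulr_sumr -sumrN expR_sum; apply: eq_bigr => i _.
rewrite /flat !subr_gt0; have /andP[-> ->] := xab i.
by rewrite !expr0 !mul1r -expRD mulrDr opprD.
Qed.

Lemma bump_ge0 a b x : 0 <= bump a b x.
Proof. by apply: prodr_ge0 => i _; rewrite mulr_ge0 ?flat_ge0. Qed.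

Lemma bump_le1 a b x : bump a b x <= 1.
Proof.
apply: prodr_ile1 => i _; rewrite mulr_ge0 ?flat_ge0//=.
have f1 t : flat c 0 t <= 1.
  rewrite /flat; case: ifPn => // t0; rewrite expr0 mul1r expRN invf_le1 ?expR_gt0//.
  by rewrite (le_trans _ (expR_ge1Dx _))// lerDl divr_ge0 ?ltW.
by rewrite mulr_ile1 ?flat_ge0.
Qed.

Lemma measurable_bump a b : measurable_fun [set: V] (bump a b).
Proof.
have mf : measurable_fun [set: R] (flat c 0).
  by apply: continuous_measurable_fun; exact: flat_continuous.
apply: measurable_prod => i _; apply: measurable_funM.
  apply: (measurableT_comp mf); apply: measurable_funB => //.
  exact: measurable_coord.
apply: (measurableT_comp mf); apply: measurable_funB => //.
exact: measurable_coord.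
Qed.

End bump.

(** * Integration of complex-valued functions *)

Section complex_numbers.
Context (R : realType).
Implicit Types z w : R[i].

Lemma ReM z w : complex.Re (z * w) =
  complex.Re z * complex.Re w - complex.Im z * complex.Im w.
Proof. by case: z w => a b [a' b']. Qed.

Lemma ImM z w : complex.Im (z * w) =
  complex.Re z * complex.Im w + complex.Im z * complex.Re w.
Proof. by case: z w => a b [a' b']. Qed.

Lemma ReD z w : complex.Re (z + w) = complex.Re z + complex.Re w.
Proof. by case: z w => a b [a' b']. Qed.

Lemma ImD z w : complex.Im (z + w) = complex.Im z + complex.Im w.
Proof. by case: z w => a b [a' b']. Qed.

Lemma ReN z : complex.Re (- z) = - complex.Re z. Proof. by case: z. Qed.
Lemma ImN z : complex.Im (- z) = - complex.Im z. Proof. by case: z. Qed.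
Lemma Re_conjc z : complex.Re (conjc z) = complex.Re z. Proof. by case: z. Qed.
Lemma Im_conjc z : complex.Im (conjc z) = - complex.Im z. Proof. by case: z. Qed.

Lemma complex_ext z w : complex.Re z = complex.Re w ->
  complex.Im z = complex.Im w -> z = w.
Proof. by case: z w => a b [a' b'] /= -> ->. Qed.

Lemma Re_le_normc z : `|complex.Re z| <= normc z.
Proof.
case: z => a b; rewrite /normc /= -sqrtr_sqr ler_sqrt ?addr_ge0 ?sqr_ge0//.
by rewrite lerDl sqr_ge0.
Qed.

Lemma Im_le_normc z : `|complex.Im z| <= normc z.
Proof.
case: z => a b; rewrite /normc /= -sqrtr_sqr ler_sqrt ?addr_ge0 ?sqr_ge0//.
by rewrite lerDr sqr_ge0.
Qed.

Lemma normc_ge0 z : 0 <= normc z. Proof. by case: z => a b; exact: sqrtr_ge0. Qed.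

Lemma sqr_normc_ReIm z : normc z ^+ 2 = complex.Re z ^+ 2 + complex.Im z ^+ 2.
Proof. by case: z => a b; rewrite /normc /= sqr_sqrtr ?addr_ge0 ?sqr_ge0. Qed.

Lemma normc_le_ReIm z : normc z <= `|complex.Re z| + `|complex.Im z|.
Proof.
rewrite -(ler_pXn2r (_ : (0 < 2)%N)) ?nnegrE ?addr_ge0 ?normc_ge0//.
rewrite sqr_normc_ReIm sqrrD !real_normK ?num_real//.
by rewrite lerD2r lerDl mulrn_wge0// mulr_ge0.
Qed.

Lemma normc_conjc z : normc (conjc z) = normc z.
Proof. by case: z => a b; rewrite /normc /= sqrrN. Qed.

Lemma normc_real (x : R) : normc x%:C%C = `|x|.
Proof. by rewrite /normc /= expr0n addr0 sqrtr_sqr. Qed.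

Lemma normc_expi t : normc (@expi R t) = 1.
Proof. by rewrite /normc /= cos2Dsin2 sqrtr1. Qed.

Lemma expiD s t : @expi R (s + t) = expi s * expi t.
Proof. by apply: complex_ext; rewrite ?ReM ?ImM /= ?cosD ?sinD// addrC mulrC [X in _ + X]mulrC addrC mulrC [X in _ + X]mulrC addrC. Qed.

Lemma expi0 : @expi R 0 = 1.
Proof. by apply: complex_ext; rewrite /= ?cos0 ?sin0. Qed.

Lemma expiN t : @expi R (- t) = conjc (expi t).
Proof. by apply: complex_ext; rewrite /= ?cosN ?sinN. Qed.

Lemma normcX z n : normc (z ^+ n) = normc z ^+ n.
Proof.
elim: n => [|n IH]; first by rewrite !expr0 normc1.
by rewrite !exprS normcM IH.
Qed.

End complex_numbers.

Section integrals.
Context (R : realType) (d : nat).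
Local Notation V := 'cV[R]_d.
Local Notation mu := (lebesgue R d).
Implicit Types (D : set V) (g h : V -> R) (F G : V -> R[i]).

(** Extension by zero, to reduce integrals over [D] to integrals over the whole
space. *)
Definition crestrict D F : V -> R[i] := fun x => if x \in D then F x else 0.

Lemma rintegrable_le D g h : measurable D -> measurable_fun D g ->
  mu.-integrable D (EFin \o h) -> (forall x, D x -> `|g x| <= h x) ->
  mu.-integrable D (EFin \o g).
Proof.
move=> mD mg ih gh; apply: (le_integrable mD _ _ ih).
  exact/measurable_EFinP.
move=> x Dx /=; rewrite lee_fin (le_trans (gh x Dx))//.
exact: ler_norm.
Qed.

Lemma rintegrable_bounded D g K : measurable D -> (mu D < +oo)%E ->
  measurable_fun D g -> (forall x, D x -> `|g x| <= K) ->
  mu.-integrable D (EFin \o g).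
Proof.
move=> mD fD mg gK; apply: measurable_bounded_integrable => //.
exists K; split; first exact: num_real.
by move=> M KM x Dx; exact: le_trans (gK x Dx) (ltW KM).
Qed.

Lemma rintegrable_norm D g : mu.-integrable D (EFin \o g) ->
  mu.-integrable D (EFin \o (fun x => `|g x|)).
Proof. by move=> ig; exact: (integrable_norm ig). Qed.

Lemma rintegrableD D g h : measurable D ->
  mu.-integrable D (EFin \o g) -> mu.-integrable D (EFin \o h) ->
  mu.-integrable D (EFin \o (fun x => g x + h x)).
Proof. by move=> mD ig ih; exact: (integrableD mD ig ih). Qed.

Lemma rintegrableB D g h : measurable D ->
  mu.-integrable D (EFin \o g) -> mu.-integrable D (EFin \o h) ->
  mu.-integrable D (EFin \o (fun x => g x - h x)).
Proof. by move=> mD ig ih; exact: (integrableB mD ig ih). Qed.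

Lemma rintegrableZ D k g : measurable D ->
  mu.-integrable D (EFin \o g) -> mu.-integrable D (EFin \o (fun x => k * g x)).
Proof. by move=> mD ig; exact: (integrableZl mD k ig). Qed.

Lemma rintegral_cvg D (u : nat -> V -> R) g h : measurable D ->
  (forall n, measurable_fun D (u n)) -> measurable_fun D g ->
  mu.-integrable D (EFin \o h) ->
  (forall n x, D x -> `|u n x| <= h x) ->
  {ae mu, forall x, D x -> (fun n => u n x) @ \oo --> g x} ->
  (fun n => Rintegral mu D (u n)) @ \oo --> Rintegral mu D g.
Proof.
move=> mD mu_ mg ih uh ug.
have [] := @dominated_convergence _ _ _ mu D mD (fun n => EFin \o u n)
   (EFin \o g) (EFin \o h).
- by move=> n; exact/measurable_EFinP.
- exact/measurable_EFinP.
- by apply: filterS ug => x ugx /ugx H; apply: cvg_EFin => //; exact: nearW.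
- exact: ih.
- by apply: aeW => x n Dx; rewrite /= lee_fin; exact: uh.
- move=> ig _ H; apply: fine_cvg; rewrite fineK//.
  exact: integrable_fin_num.
Qed.

Lemma Rintegral_ae_eq D g h : measurable D -> measurable_fun D g ->
  measurable_fun D h -> {ae mu, forall x, D x -> g x = h x} ->
  Rintegral mu D g = Rintegral mu D h.
Proof.
move=> mD mg mh gh; congr fine; apply: ae_eq_integral => //.
- exact/measurable_EFinP.
- exact/measurable_EFinP.
- by apply: filterS gh => x Hx /Hx /= ->.
Qed.

Lemma rintegral_scale s (T : V -> V) g : 0 < s -> scales s T ->
  mu.-integrable setT (EFin \o g) ->
  mu.-integrable setT (EFin \o (g \o T)) /\
  s * Rintegral mu setT (g \o T) = Rintegral mu setT g.
Proof.
move=> s0 sT ig; have [mT _] := sT.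
have mg : measurable_fun setT g by apply/measurable_EFinP; exact: (measurable_int mu).
have mgT : measurable_fun setT (g \o T) by exact: measurableT_comp.
have iT : mu.-integrable setT (EFin \o (g \o T)).
  apply/integrableP; split; first exact/measurable_EFinP.
  have /integrableP[_] := ig.
  rewrite -(@lebesgue_integral_scale R d s T (fun x => `|(g x)%:E|)%E s0 sT).
  - move=> H; rewrite ltNge leye_eq; apply/negP => /eqP E; move: H.
    by rewrite [X in (_ * X)%E]E gt0_muley// lte_fin.
  - by apply: measurableT_comp => //; exact/measurable_EFinP.
  - by [].
split => //.
have mpos : measurable_fun setT (EFin \o g)^\+%E.
  by apply: measurable_funepos; exact/measurable_EFinP.
have mneg : measurable_fun setT (EFin \o g)^\-%E.
  by apply: measurable_funeneg; exact/measurable_EFinP.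
have E : (s%:E * \int[mu]_x (EFin \o (g \o T)) x = \int[mu]_x (EFin \o g) x)%E.
  rewrite [in LHS]integralE [in RHS]integralE.
  rewrite muleBr//; last first.
    exact: (integrable_add_def _ iT).
  have Ep := lebesgue_integral_scale s0 sT mpos (fun x => funepos_ge0 _ x).
  have En := lebesgue_integral_scale s0 sT mneg (fun x => funeneg_ge0 _ x).
  rewrite -Ep -En; congr (_ * _ - _ * _)%E.
    by rewrite -[EFin \o (g \o T)]/((EFin \o g) \o T) funepos_comp.
  by rewrite -[EFin \o (g \o T)]/((EFin \o g) \o T) funeneg_comp.
rewrite /Rintegral -[in RHS]E fineM//.
exact: integrable_fin_num.
Qed.

Lemma cmeasurableD D F G : cmeasurable D F -> cmeasurable D G ->
  cmeasurable D (fun x => F x + G x).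
Proof.
move=> [F1 F2] [G1 G2]; split.
  under eq_fun do rewrite ReD; exact: measurable_funD.
under eq_fun do rewrite ImD; exact: measurable_funD.
Qed.

Lemma cmeasurableM D F G : cmeasurable D F -> cmeasurable D G ->
  cmeasurable D (fun x => F x * G x).
Proof.
move=> [F1 F2] [G1 G2]; split.
  by under eq_fun do rewrite ReM; apply: measurable_funB; exact: measurable_funM.
by under eq_fun do rewrite ImM; apply: measurable_funD; exact: measurable_funM.
Qed.

Lemma cmeasurable_cst D k : cmeasurable D (fun=> k).
Proof. by split; exact: measurable_cst. Qed.

Lemma cmeasurableN D F : cmeasurable D F -> cmeasurable D (fun x => - F x).
Proof.
move=> [F1 F2]; split.
  by under eq_fun do rewrite ReN; exact: measurable_funN.
by under eq_fun do rewrite ImN; exact: measurable_funN.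
Qed.

Lemma cmeasurableB D F G : cmeasurable D F -> cmeasurable D G ->
  cmeasurable D (fun x => F x - G x).
Proof. by move=> mF mG; apply: cmeasurableD => //; exact: cmeasurableN. Qed.

Lemma cmeasurable_conjc D F : cmeasurable D F -> cmeasurable D (fun x => conjc (F x)).
Proof.
move=> [F1 F2]; split; first by under eq_fun do rewrite Re_conjc.
by under eq_fun do rewrite Im_conjc; exact: measurable_funN.
Qed.

Lemma cmeasurable_real D g : measurable_fun D g ->
  cmeasurable D (fun x => (g x)%:C%C).
Proof. by move=> mg; split => //=; exact: measurable_cst. Qed.

Lemma cmeasurable_expi D g : measurable_fun D g -> cmeasurable D (fun x => expi (g x)).
Proof.
move=> mg; split => /=.
  by apply: measurableT_comp mg; apply: continuous_measurable_fun; exact: continuous_cos.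
by apply: measurableT_comp mg; apply: continuous_measurable_fun; exact: continuous_sin.
Qed.

Lemma cmeasurableS D E F : measurable E -> D `<=` E -> cmeasurable E F ->
  cmeasurable D F.
Proof. by move=> mE DE [F1 F2]; split; exact: measurable_funS DE _. Qed.

Lemma cmeasurable_restrict D F : measurable D -> cmeasurable D F ->
  cmeasurable setT (crestrict D F).
Proof.
move=> mD [F1 F2]; split.
  rewrite (_ : (fun _ => _) = (fun x => complex.Re (F x)) \_ D).
    by apply/(measurable_restrictT _ mD).
  by apply/funext => x; rewrite /crestrict !patchE; case: ifP.
rewrite (_ : (fun _ => _) = (fun x => complex.Im (F x)) \_ D).
  by apply/(measurable_restrictT _ mD).
by apply/funext => x; rewrite /crestrict !patchE; case: ifP.
Qed.

Lemma measurable_normc D F : cmeasurable D F -> measurable_fun D (fun x => normc (F x)).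
Proof.
move=> [F1 F2].
rewrite (_ : (fun _ => _) = (@Num.sqrt R) \o
   (fun x => complex.Re (F x) ^+ 2 + complex.Im (F x) ^+ 2)); last first.
  by apply/funext => x /=; case: (F x).
apply: measurableT_comp.
  by apply: continuous_measurable_fun; exact: sqrt_continuous.
by apply: measurable_funD; exact: measurable_funX.
Qed.

Lemma cintegrable_le D F h : measurable D -> cmeasurable D F ->
  mu.-integrable D (EFin \o h) -> (forall x, D x -> normc (F x) <= h x) ->
  cintegrable D F.
Proof.
move=> mD [F1 F2] ih Fh; split.
  apply: (rintegrable_le mD F1 ih) => x Dx.
  exact: le_trans (Re_le_normc _) (Fh _ Dx).
apply: (rintegrable_le mD F2 ih) => x Dx.
exact: le_trans (Im_le_normc _) (Fh _ Dx).
Qed.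

Lemma cintegrable_bounded D F K : measurable D -> (mu D < +oo)%E ->
  cmeasurable D F -> (forall x, D x -> normc (F x) <= K) -> cintegrable D F.
Proof.
move=> mD fD mF FK; apply: (@cintegrable_le _ _ (cst K)) => //.
exact: (@rintegrable_bounded _ _ `|K|).
Qed.

Lemma cintegrable_cmeasurable D F : cintegrable D F -> cmeasurable D F.
Proof. by move=> [/measurable_int/measurable_EFinP ? /measurable_int/measurable_EFinP ?]. Qed.

Lemma integrable_normc D F : measurable D -> cintegrable D F ->
  mu.-integrable D (EFin \o (fun x => normc (F x))).
Proof.
move=> mD iF; have mF := measurable_normc (cintegrable_cmeasurable iF).
case: iF => F1 F2.
apply: (@rintegrable_le _ _ (fun x => `|complex.Re (F x)| + `|complex.Im (F x)|)) => //.
  apply: (rintegrableD mD); apply: rintegrable_norm => //.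
by move=> x _; rewrite ger0_norm ?normc_ge0// normc_le_ReIm.
Qed.

Lemma cintegrableS D E F : measurable E -> measurable D -> D `<=` E ->
  cintegrable E F -> cintegrable D F.
Proof. by move=> mE mD DE [F1 F2]; split; exact: integrableS DE _. Qed.

Lemma cintegrableD D F G : measurable D -> cintegrable D F -> cintegrable D G ->
  cintegrable D (fun x => F x + G x).
Proof.
move=> mD [F1 F2] [G1 G2]; split.
  by under eq_fun do rewrite ReD; exact: rintegrableD.
by under eq_fun do rewrite ImD; exact: rintegrableD.
Qed.

Lemma cintegrableZ D k F : measurable D -> cintegrable D F ->
  cintegrable D (fun x => k * F x).
Proof.
move=> mD [F1 F2]; split.
  by under eq_fun do rewrite ReM; apply: rintegrableB => //; exact: rintegrableZ.
by under eq_fun do rewrite ImM; apply: rintegrableD => //; exact: rintegrableZ.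
Qed.

Lemma cintegralD D F G : measurable D -> cintegrable D F -> cintegrable D G ->
  cintegral D (fun x => F x + G x) = cintegral D F + cintegral D G.
Proof.
move=> mD [F1 F2] [G1 G2]; apply: complex_ext => /=.
  by under eq_Rintegral do rewrite ReD; rewrite RintegralD.
by under eq_Rintegral do rewrite ImD; rewrite RintegralD.
Qed.

Lemma cintegralZ D k F : measurable D -> cintegrable D F ->
  cintegral D (fun x => k * F x) = k * cintegral D F.
Proof.
move=> mD [F1 F2]; apply: complex_ext => /=.
  under eq_Rintegral do rewrite ReM.
  rewrite RintegralB//; [|exact: rintegrableZ..].
  by rewrite !RintegralZl// ReM.
under eq_Rintegral do rewrite ImM.
rewrite RintegralD//; [|exact: rintegrableZ..].
by rewrite !RintegralZl// ImM.
Qed.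

Lemma cintegral0 D : cintegral D (fun=> 0) = 0 :> R[i].
Proof. by apply: complex_ext; rewrite /= /Rintegral integral0. Qed.

Lemma cintegrable0 D : measurable D -> cintegrable D (fun=> 0 : R[i]).
Proof. by move=> mD; split; exact: integrable0. Qed.

Lemma cintegrable_sum I (s : seq I) (H : I -> V -> R[i]) D : measurable D ->
  (forall i, cintegrable D (H i)) -> cintegrable D (fun x => \sum_(i <- s) H i x).
Proof.
move=> mD iH; elim: s => [|i s IH].
  by under eq_fun do rewrite big_nil; exact: cintegrable0.
by under eq_fun do rewrite big_cons; exact: cintegrableD.
Qed.

Lemma cintegral_sum I (s : seq I) (H : I -> V -> R[i]) D : measurable D ->
  (forall i, cintegrable D (H i)) ->
  cintegral D (fun x => \sum_(i <- s) H i x) = \sum_(i <- s) cintegral D (H i).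
Proof.
move=> mD iH; elim: s => [|i s IH].
  by rewrite big_nil; under eq_fun do rewrite big_nil; exact: cintegral0.
under eq_fun do rewrite big_cons.
by rewrite big_cons cintegralD ?IH//; exact: cintegrable_sum.
Qed.

Lemma cintegralB D F G : measurable D -> cintegrable D F -> cintegrable D G ->
  cintegral D (fun x => F x - G x) = cintegral D F - cintegral D G.
Proof.
move=> mD iF iG; under eq_fun do rewrite -mulN1r.
rewrite cintegralD//; last exact: cintegrableZ.
by rewrite cintegralZ// mulN1r.
Qed.

(** The constant 2 comes from bounding the real and imaginary parts separately. *)
Lemma normc_cintegral_le D F : measurable D -> cintegrable D F ->
  normc (cintegral D F) <= 2 * Rintegral mu D (fun x => normc (F x)).
Proof.
move=> mD iF; have iN := integrable_normc mD iF; case: iF => F1 F2.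
apply: le_trans (normc_le_ReIm _) _; rewrite mulr_natl mulr2n /=; apply: lerD.
  apply: le_trans (le_normr_Rintegral mD F1) _; apply: le_Rintegral => //.
    exact: rintegrable_norm.
  by move=> x _; exact: Re_le_normc.
apply: le_trans (le_normr_Rintegral mD F2) _; apply: le_Rintegral => //.
  exact: rintegrable_norm.
by move=> x _; exact: Im_le_normc.
Qed.

Lemma cintegral_ae_eq D F G : measurable D -> cmeasurable D F -> cmeasurable D G ->
  {ae mu, forall x, D x -> F x = G x} -> cintegral D F = cintegral D G.
Proof.
move=> mD [F1 F2] [G1 G2] FG; congr (_ +i* _)%C; apply: Rintegral_ae_eq => //;
  by apply: filterS FG => x Hx /Hx ->.
Qed.

Lemma eq_cintegral D F G : (forall x, D x -> F x = G x) ->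
  cintegral D F = cintegral D G.
Proof.
by move=> FG; congr (_ +i* _)%C; apply: eq_Rintegral => x /set_mem/FG ->.
Qed.

Lemma cintegral_mkcond D F : cintegral D F = cintegral setT (crestrict D F).
Proof.
rewrite /cintegral Rintegral_mkcond [X in (_ +i* X)%C]Rintegral_mkcond.
by congr (_ +i* _)%C; apply: eq_Rintegral => x _; rewrite /crestrict !patchE; case: ifP.
Qed.

Lemma cintegrable_mkcond D F : measurable D ->
  cintegrable D F <-> cintegrable setT (crestrict D F).
Proof.
move=> mD; have E (p : R[i] -> R) : p 0 = 0 ->
    mu.-integrable D (fun x => (p (F x))%:E) <->
    mu.-integrable setT (fun x => (p (crestrict D F x))%:E).
  move=> p0; rewrite (integrable_mkcond _ mD).
  rewrite (_ : (fun x => (p (F x))%:E) \_ D = (fun x => (p (crestrict D F x))%:E))//.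
  by apply/funext => x; rewrite /crestrict !patchE; case: ifP => //; rewrite p0.
by split=> -[F1 F2]; split; apply/E.
Qed.

Lemma cintegral_scale s (T : V -> V) F : 0 < s -> scales s T ->
  cintegrable setT F -> cintegrable setT (F \o T) /\
  s%:C%C * cintegral setT (F \o T) = cintegral setT F.
Proof.
move=> s0 sT [F1 F2].
have [F1' E1] := rintegral_scale s0 sT F1.
have [F2' E2] := rintegral_scale s0 sT F2.
split; first by split.
by apply: complex_ext; rewrite ?ReM ?ImM /= mul0r ?subr0 ?addr0.
Qed.

Lemma negligible_scale s (T : V -> V) (P : V -> Prop) : 0 < s -> scales s T ->
  {ae mu, forall x, P x} -> {ae mu, forall x, P (T x)}.
Proof.
move=> s0 [mT sT] [N [mN N0 PN]].
have mTN : measurable (T @^-1` N) by rewrite -[X in measurable X]setTI; exact: mT.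
exists (T @^-1` N); split => //; last by move=> x /= Px; exact: PN.
have := sT _ mN; rewrite N0 => /eqP; rewrite mule_eq0 eqe gt_eqF//=.
by move/eqP.
Qed.

End integrals.

(** * Fourier inversion almost everywhere *)

Section du_bois_reymond.
Context (R : realType) (d : nat).
Local Notation V := 'cV[R]_d.
Local Notation mu := (lebesgue R d).

(** A bump on the box enlarged by 1 on each side is bounded below on the box, so
integrability against bumps gives local integrability. *)
Lemma bump_lower (a b : 'I_d -> R) (x : V) : obox a b x ->
  expR (- (\sum_(i < d) 2)) <= bump 1 (fun i => a i - 1) (fun i => b i + 1) x.
Proof.
move=> xab.
have xab' : obox (fun i => a i - 1) (fun i => b i + 1) x.
  by move=> i; have /andP[h1 h2] := xab i; apply/andP; split; lra.
rewrite bump_obox// mul1r ler_expR lerN2; apply: ler_sum => i _.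
have inv1 (t : R) : 1 <= t -> t^-1 <= 1.
  by move=> t1; rewrite invf_le1// (lt_le_trans ltr01).
have /andP[h1 h2] := xab i.
have -> : (2 : R) = 1 + 1 by [].
by apply: lerD; apply: inv1; lra.
Qed.

(** As c tends to 0 the bumps tend to the indicator of the box and remain below
1, so that dominated convergence makes every integral of [w] over a box vanish. *)
Lemma du_bois_reymond (w : V -> R) : measurable_fun setT w ->
  (forall a b, mu.-integrable setT (EFin \o (fun x => bump 1 a b x * w x))) ->
  (forall c a b, 0 < c -> Rintegral mu setT (fun x => bump c a b x * w x) = 0) ->
  {ae mu, forall x, w x = 0}.
Proof.
move=> mw iw w0.
have iwb a b : mu.-integrable (obox a b) (EFin \o w).
  have mab := measurable_obox a b.
  pose B := bump 1 (fun i => a i - 1) (fun i => b i + 1).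
  pose k : R := expR (- (\sum_(i < d) 2)).
  apply: (@rintegrable_le _ _ _ w (fun x => k^-1 * `|B x * w x|) mab).
  - exact: measurable_funTS.
  - apply: rintegrableZ => //; apply: (integrableS measurableT) => //.
    by apply: rintegrable_norm; exact: iw.
  - move=> x xab; rewrite normrM mulrA ler_peMl// mulrC.
    rewrite ler_pdivlMr ?expR_gt0// mul1r (le_trans (bump_lower xab))//.
    exact: ler_norm.
apply: ae_eq0_of_obox_integral => // a b.
have mab := measurable_obox a b.
suff : Rintegral mu (obox a b) w = 0.
  move=> w0'; rewrite -[LHS]fineK; last exact: integrable_fin_num.
  by congr EFin.
pose u n x := bump n.+1%:R^-1 a b x * w x.
have : (fun n => Rintegral mu (obox a b) (u n)) @ \oo --> Rintegral mu (obox a b) w.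
  apply: (@rintegral_cvg _ _ _ _ _ (fun x => `|w x|)) => //.
  - move=> n; apply: measurable_funM; last exact: measurable_funTS.
    by apply: measurable_funTS; apply: measurable_bump; rewrite invr_gt0.
  - exact: measurable_funTS.
  - exact: rintegrable_norm.
  - move=> n x _; rewrite /u normrM ler_piMl// ger0_norm ?bump_ge0//.
    by apply: bump_le1; rewrite ?invr_gt0.
  - apply: aeW => x xab.
    rewrite /u -[X in _ --> X]mul1r; apply: cvgM; last exact: cvg_cst.
    under eq_fun do rewrite bump_obox//.
    set S := \sum_i _.
    have : (fun n : nat => expR (- (n.+1%:R^-1 * S))) @ \oo --> expR (- (0 * S)).
      apply: continuous_cvg; first exact: continuous_expR.
      apply: cvgN; apply: cvgM; last exact: cvg_cst.
      exact: cvg_harmonic.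
    by rewrite mul0r oppr0 expR0.
have -> : (fun n => Rintegral mu (obox a b) (u n)) = fun=> 0.
  apply/funext => n; rewrite -(w0 n.+1%:R^-1 a b) ?invr_gt0//.
  rewrite Rintegral_mkcond; apply: eq_Rintegral => x _.
  rewrite patchE; case: ifPn => // /negP xab.
  by rewrite bump_eq0 ?mul0r// => /mem_set.
by move=> /cvg_lim H; rewrite -H//; apply: cvg_lim => //; exact: cvg_cst.
Qed.

End du_bois_reymond.

Section fourier_inversion.
Context (R : realType) (d : nat).
Local Notation V := 'cV[R]_d.
Local Notation mu := (lebesgue R d).

Lemma measurable_dotv : measurable_fun [set: V * V] (fun p => dotv p.1 p.2).
Proof.
apply: measurable_sum => i; apply: measurable_funM.
  exact: measurableT_comp (measurable_coord i) measurable_fst.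
exact: measurableT_comp (measurable_coord i) measurable_snd.
Qed.

Lemma measurable_dotvr (x : V) : measurable_fun setT (dotv x).
Proof.
by apply: measurable_sum => i; apply: measurable_funM => //; exact: measurable_coord.
Qed.

Lemma rintegrable_measurable D (g : V -> R) : mu.-integrable D (EFin \o g) ->
  measurable_fun D g.
Proof. by move=> /measurable_int/measurable_EFinP. Qed.

Lemma rintegrable_finite_indic (B : set V) : measurable B -> (mu B < +oo)%E ->
  mu.-integrable setT (EFin \o (\1_B : V -> R)).
Proof.
move=> mB fB; rewrite (_ : EFin \o _ = (EFin \o (cst 1 : V -> R)) \_ B); last first.
  by apply/funext => x; rewrite patchE /= indicE; case: ifP => // ->.
apply/(integrable_mkcond _ mB); apply: (@rintegrable_bounded _ _ _ _ 1) => //.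
by move=> x _; rewrite normr1.
Qed.

(** The real and imaginary parts of e^(2 pi i (x, y)) are both bounded measurable
kernels; the facts needed from Fubini's theorem are stated for such a kernel. *)
Section kernel.
Variable K : V * V -> R.
Hypotheses (mK : measurable_fun setT K) (K1 : forall p, `|K p| <= 1).

Lemma integrable_kernel a x : mu.-integrable setT (EFin \o a) ->
  mu.-integrable setT (EFin \o (fun y => a y * K (x, y))).
Proof.
move=> ia; apply: (@rintegrable_le _ _ _ _ (fun y => `|a y|)) => //.
- apply: measurable_funM; first exact: rintegrable_measurable.
  exact: (measurableT_comp mK (measurable_pair1 x)).
- exact: rintegrable_norm.
- by move=> y _; rewrite normrM ler_piMr.
Qed.

Lemma integrable_kernel_prod a g : mu.-integrable setT (EFin \o a) ->
  mu.-integrable setT (EFin \o g) ->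
  (mu \x mu)%E.-integrable setT (fun p => (g p.1 * (a p.2 * K p))%:E).
Proof.
move=> ia ig.
have ma : measurable_fun setT a by exact: rintegrable_measurable.
have mg : measurable_fun setT g by exact: rintegrable_measurable.
have mf : measurable_fun setT (fun p => (g p.1 * (a p.2 * K p))%:E).
  apply/measurable_EFinP; apply: measurable_funM; first exact: measurableT_comp mg measurable_fst.
  by apply: measurable_funM => //; exact: measurableT_comp ma measurable_snd.
apply/integrable12ltyP => //=.
apply: (@le_lt_trans _ _ (\int[mu]_x ((`|g x| * Rintegral mu setT (fun y => `|a y|))%:E))%E).
  apply: ge0_le_integral => //.
  - by move=> x _; exact: integral_ge0.
  - apply: (@measurable_fun_fubini_tonelli_F _ _ _ _ _ mu (fun p => `|(g p.1 * (a p.2 * K p))%:E|)%E) => //.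
    exact: measurableT_comp.
  - apply/measurable_EFinP; apply: measurable_funM => //.
    exact: measurableT_comp.
  - move=> x _.
    have iga : mu.-integrable setT (EFin \o (fun y => `|g x * (a y * K (x, y))|)).
      apply: rintegrable_norm.
      by apply: rintegrableZ => //; exact: integrable_kernel.
    rewrite -RintegralZl//; last exact: rintegrable_norm.
    rewrite /Rintegral fineK; last first.
      apply: integrable_fin_num => //; apply: rintegrableZ => //.
      exact: rintegrable_norm.
    apply: ge0_le_integral => //=.
    + exact: (measurable_int mu iga).
    + by apply/measurable_EFinP; apply: measurable_funM => //; exact: measurableT_comp.
    + by move=> y _; rewrite lee_fin !normrM ler_wpM2l// ler_piMr.
have /integrableP[_] : mu.-integrable setT (EFin \o (fun x => Rintegral mu setT (fun y => `|a y|) * `|g x|)).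
  by apply: rintegrableZ => //; exact: rintegrable_norm.
apply: le_lt_trans; apply: ge0_le_integral => //=.
- by move=> x _; rewrite lee_fin mulr_ge0// Rintegral_ge0.
- by apply/measurable_EFinP; apply: measurable_funM => //; exact: measurableT_comp.
- by apply/measurable_EFinP; apply: measurableT_comp => //; apply: measurable_funM => //; exact: measurableT_comp.
- by move=> x _; rewrite lee_fin mulrC ler_norm.
Qed.

(** Fubini requires integrability in both variables, hence the localization of x
to bounded boxes. *)
Lemma measurable_kernel_integral a : mu.-integrable setT (EFin \o a) ->
  measurable_fun setT (fun x => Rintegral mu setT (fun y => a y * K (x, y))).
Proof.
move=> ia; rewrite -[X in measurable_fun X _](bigcup_cball R d).
apply/measurable_fun_bigcup => n.
  exact: measurable_obox.
have mB : measurable (cball n%:R : set V) by exact: measurable_obox.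
pose g : V -> R := \1_(cball n%:R).
have ig : mu.-integrable setT (EFin \o g).
  apply: rintegrable_finite_indic => //.
  exact: lebesgue_obox_lty.
have := @measurable_fubini_F _ _ _ _ _ mu mu _ (integrable_kernel_prod ia ig).
move=> /(measurable_funTS (D := cball n%:R)) H.
have : measurable_fun (cball n%:R) (fine \o (fubini_F mu (fun p => (g p.1 * (a p.2 * K p))%:E))).
  exact: measurableT_comp H.
apply: eq_measurable_fun => x /set_mem xn /=.
congr fine; apply: eq_integral => y _ /=.
by rewrite /g indicE mem_set// mul1r.
Qed.

Lemma kernel_fubini a g : mu.-integrable setT (EFin \o a) ->
  mu.-integrable setT (EFin \o g) ->
  Rintegral mu setT (fun y => a y * Rintegral mu setT (fun x => g x * K (x, y))) =
  Rintegral mu setT (fun x => g x * Rintegral mu setT (fun y => a y * K (x, y))).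
Proof.
move=> ia ig.
have iP := integrable_kernel_prod ia ig.
have := Fubini iP => /(congr1 fine).
have iK2 y : mu.-integrable setT (EFin \o (fun x => g x * K (x, y))).
  apply: (@rintegrable_le _ _ _ _ (fun x => `|g x|)) => //.
  - apply: measurable_funM; first exact: rintegrable_measurable.
    exact: (measurableT_comp mK (measurable_pair2 y)).
  - exact: rintegrable_norm.
  - by move=> x _; rewrite normrM ler_piMr.
move=> E; transitivity (fine (\int[mu]_y \int[mu]_x (g x * (a y * K (x, y)))%:E)%E).
  congr fine; apply: eq_integral => y _.
  rewrite -[RHS]fineK.
    congr EFin; rewrite -RintegralZl//; apply: eq_Rintegral => x _ /=.
    by rewrite mulrCA.
  apply: integrable_fin_num => //.
  have : mu.-integrable setT (EFin \o (fun x => a y * (g x * K (x, y)))).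
    exact: rintegrableZ.
  by apply: eq_integrable => // x _ /=; rewrite mulrCA.
rewrite -[LHS]E; congr fine; apply: eq_integral => x _ /=.
rewrite -[LHS]fineK.
  congr EFin; rewrite -RintegralZl//; exact: integrable_kernel.
apply: integrable_fin_num => //; apply: rintegrableZ => //.
exact: integrable_kernel.
Qed.

Lemma kernel_integral_bounded a x : mu.-integrable setT (EFin \o a) ->
  `|Rintegral mu setT (fun y => a y * K (x, y))| <=
  Rintegral mu setT (fun y => `|a y|).
Proof.
move=> ia; have iaK := integrable_kernel x ia.
apply: le_trans (le_normr_Rintegral measurableT iaK) _.
apply: le_Rintegral => //.
- exact: rintegrable_norm.
- exact: rintegrable_norm.
- by move=> y _; rewrite normrM ler_piMr.
Qed.

Lemma integrable_mul_kernel a g : mu.-integrable setT (EFin \o a) ->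
  mu.-integrable setT (EFin \o g) ->
  mu.-integrable setT (EFin \o (fun x =>
    g x * Rintegral mu setT (fun y => a y * K (x, y)))).
Proof.
move=> ia ig; set I := Rintegral mu setT (fun y => `|a y|).
apply: (@rintegrable_le _ _ _ _ (fun x => I * `|g x|)) => //.
- apply: measurable_funM; first exact: rintegrable_measurable.
  exact: measurable_kernel_integral.
- by apply: rintegrableZ => //; exact: rintegrable_norm.
- by move=> x _; rewrite normrM mulrC ler_wpM2r// kernel_integral_bounded.
Qed.

End kernel.

Definition cos_kernel (p : V * V) : R := cos (2 * pi * dotv p.1 p.2).
Definition sin_kernel (p : V * V) : R := sin (2 * pi * dotv p.1 p.2).

Lemma measurable_cos_kernel : measurable_fun setT cos_kernel.
Proof.
apply: measurableT_comp.
  by apply: continuous_measurable_fun; exact: continuous_cos.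
by apply: measurable_funM => //; exact: measurable_dotv.
Qed.

Lemma measurable_sin_kernel : measurable_fun setT sin_kernel.
Proof.
apply: measurableT_comp.
  by apply: continuous_measurable_fun; exact: continuous_sin.
by apply: measurable_funM => //; exact: measurable_dotv.
Qed.

Lemma cos_kernel_le1 p : `|cos_kernel p| <= 1.
Proof. by rewrite ler_norml cos_geN1 cos_le1. Qed.

Lemma sin_kernel_le1 p : `|sin_kernel p| <= 1.
Proof. by rewrite ler_norml sin_geN1 sin_le1. Qed.

Lemma dotvC (x y : V) : dotv x y = dotv y x.
Proof. by apply: eq_bigr => i _; rewrite mulrC. Qed.

Definition inverse_fourier (F : V -> R[i]) (x : V) : R[i] :=
  cintegral setT (fun xi => F xi * expi (2 * pi * dotv x xi)).

Section inversion.
Variables (f F : V -> R[i]).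
Hypotheses (fF : fun_fourier f F) (iF : cintegrable setT F).
Let a xi := complex.Re (F xi).
Let b xi := complex.Im (F xi).
Let mC := measurable_cos_kernel.
Let mS := measurable_sin_kernel.
Let C1 := cos_kernel_le1.
Let S1 := sin_kernel_le1.
Let ia : mu.-integrable setT (EFin \o a) := proj1 iF.
Let ib : mu.-integrable setT (EFin \o b) := proj2 iF.

Let Re_inverse x : complex.Re (inverse_fourier F x) =
  Rintegral mu setT (fun y => a y * cos_kernel (x, y)) -
  Rintegral mu setT (fun y => b y * sin_kernel (x, y)).
Proof.
rewrite -RintegralB//; [|exact: integrable_kernel..].
by apply: eq_Rintegral => y _; rewrite ReM.
Qed.

Let Im_inverse x : complex.Im (inverse_fourier F x) =
  Rintegral mu setT (fun y => a y * sin_kernel (x, y)) +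
  Rintegral mu setT (fun y => b y * cos_kernel (x, y)).
Proof.
rewrite -RintegralD//; [|exact: integrable_kernel..].
by apply: eq_Rintegral => y _; rewrite ImM.
Qed.

Let cmeasurable_inverse : cmeasurable setT (inverse_fourier F).
Proof.
split.
  under eq_fun do rewrite Re_inverse.
  by apply: measurable_funB; exact: measurable_kernel_integral.
under eq_fun do rewrite Im_inverse.
by apply: measurable_funD; exact: measurable_kernel_integral.
Qed.

Section test_function.
Variable g : V -> R.
Hypotheses (ig : mu.-integrable setT (EFin \o g))
  (sg : schwartz (fun x => (g x)%:C%C)).

Let A y := Rintegral mu setT (fun x => g x * cos_kernel (x, y)).
Let B y := Rintegral mu setT (fun x => g x * sin_kernel (x, y)).

Let AE y : A y = Rintegral mu setT (fun x => g x * cos_kernel (y, x)).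
Proof. by apply: eq_Rintegral => x _; rewrite /cos_kernel /= dotvC. Qed.
Let BE y : B y = Rintegral mu setT (fun x => g x * sin_kernel (y, x)).
Proof. by apply: eq_Rintegral => x _; rewrite /sin_kernel /= dotvC. Qed.

Let fourierE y : fourier (fun x => (g x)%:C%C) y = (A y -i* B y)%C.
Proof.
congr (_ +i* _)%C.
  by apply: eq_Rintegral => x _; rewrite ReM /= mul0r subr0 cosN.
rewrite -mulN1r -RintegralZl//.
  by apply: eq_Rintegral => x _; rewrite ImM /= mul0r addr0 sinN mulN1r mulrN.
have := integrable_kernel mS S1 y ig; apply: eq_integrable => // x _ /=.
by rewrite /sin_kernel /= dotvC.
Qed.

Let pairing : cintegral setT (fun y => (A y -i* B y)%C * conjc (F y)) =
  cintegral setT (fun x => (g x)%:C%C * conjc (f x)).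
Proof.
have [_ _ H] := fF; rewrite -[RHS](H _ sg).
by apply: eq_cintegral => y _; rewrite fourierE.
Qed.

Let iAa (h : V -> R) : mu.-integrable setT (EFin \o h) ->
  mu.-integrable setT (EFin \o (fun y => h y * A y)).
Proof.
by move=> ih; under eq_fun do rewrite AE; exact: integrable_mul_kernel.
Qed.

Let iBb (h : V -> R) : mu.-integrable setT (EFin \o h) ->
  mu.-integrable setT (EFin \o (fun y => h y * B y)).
Proof.
by move=> ih; under eq_fun do rewrite BE; exact: integrable_mul_kernel.
Qed.

(** The definition of the Fourier transform of [f] moves the pairing with the test
function to the frequency side, where Fubini's theorem applies since [F] is
integrable. *)
Lemma test_Re : Rintegral mu setT (fun x => g x * complex.Re (f x)) =
  Rintegral mu setT (fun x => g x * complex.Re (inverse_fourier F x)).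
Proof.
transitivity (Rintegral mu setT (fun y => a y * A y - b y * B y)).
  have /(congr1 (@complex.Re R)) := pairing; rewrite /= => E.
  transitivity (Rintegral mu setT (fun x => complex.Re ((g x)%:C%C * conjc (f x)))).
    by apply: eq_Rintegral => x _; rewrite ReM Re_conjc /= mul0r subr0.
  rewrite -E; apply: eq_Rintegral => y _.
  by rewrite ReM Re_conjc Im_conjc /= -/(a y) -/(b y); ring.
rewrite RintegralB//; [|exact: iAa|exact: iBb].
rewrite (kernel_fubini mC C1 ia ig) (kernel_fubini mS S1 ib ig).
rewrite -RintegralB//; [|exact: integrable_mul_kernel..].
by apply: eq_Rintegral => x _; rewrite Re_inverse mulrBr.
Qed.

Lemma test_Im : Rintegral mu setT (fun x => g x * complex.Im (f x)) =
  Rintegral mu setT (fun x => g x * complex.Im (inverse_fourier F x)).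
Proof.
transitivity (Rintegral mu setT (fun y => a y * B y + b y * A y)).
  have /(congr1 (@complex.Im R)) := pairing; rewrite /= => E.
  have igf : mu.-integrable setT (EFin \o (fun x => g x * complex.Im (f x))).
    have [[_ /(_ _ sg)[_ H] _] _ _] := fF.
    have := @rintegrableZ _ _ _ (-1) _ measurableT H.
    by apply: eq_integrable => // x _ /=; rewrite ImM Im_conjc /= mul0r addr0 mulN1r mulrN opprK.
  transitivity (- Rintegral mu setT (fun x => complex.Im ((g x)%:C%C * conjc (f x)))).
    rewrite -mulN1r -RintegralZl//.
      by apply: eq_Rintegral => x _; rewrite ImM Im_conjc /= mul0r addr0 mulN1r mulrN opprK.
    by have [[_ /(_ _ sg)[_ H] _] _ _] := fF.
  rewrite -E -mulN1r -RintegralZl//.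
    apply: eq_Rintegral => y _.
    by rewrite ImM Re_conjc Im_conjc /= -/(a y) -/(b y); ring.
  have := @rintegrableZ _ _ _ (-1) _ measurableT (rintegrableD measurableT (iBb ia) (iAa ib)).
  apply: eq_integrable => // y _.
  rewrite /= ImM Re_conjc Im_conjc /= -/(a y) -/(b y); congr EFin; ring.
rewrite RintegralD//; [|exact: iBb|exact: iAa].
rewrite (kernel_fubini mS S1 ia ig) (kernel_fubini mC C1 ib ig).
rewrite -RintegralD//; [|exact: integrable_mul_kernel..].
by apply: eq_Rintegral => x _; rewrite Im_inverse mulrDr.
Qed.

Lemma test_integrable :
  mu.-integrable setT (EFin \o (fun x => g x * complex.Re (f x))) /\
  mu.-integrable setT (EFin \o (fun x => g x * complex.Im (f x))).
Proof.
have [[_ /(_ _ sg)[H1 H2] _] _ _] := fF; split.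
  by move: H1; apply: eq_integrable => // x _ /=; rewrite ReM Re_conjc /= mul0r subr0.
have := @rintegrableZ _ _ _ (-1) _ measurableT H2.
by apply: eq_integrable => // x _ /=; rewrite ImM Im_conjc /= mul0r addr0 mulN1r mulrN opprK.
Qed.

Lemma test_integrable_inverse :
  mu.-integrable setT (EFin \o (fun x => g x * complex.Re (inverse_fourier F x))) /\
  mu.-integrable setT (EFin \o (fun x => g x * complex.Im (inverse_fourier F x))).
Proof.
split.
  have := rintegrableB measurableT (integrable_mul_kernel mC C1 ia ig)
    (integrable_mul_kernel mS S1 ib ig).
  by apply: eq_integrable => // x _; rewrite /comp Re_inverse mulrBr.
have := rintegrableD measurableT (integrable_mul_kernel mS S1 ia ig)
    (integrable_mul_kernel mC C1 ib ig).
by apply: eq_integrable => // x _; rewrite /comp Im_inverse mulrDr.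
Qed.

End test_function.

Let ibump c p q : 0 < c -> mu.-integrable setT (EFin \o bump c p q).
Proof.
move=> c0; apply: (@rintegrable_le _ _ _ _ (\1_(obox p q))) => //.
- exact: measurable_bump.
- apply: rintegrable_finite_indic; [exact: measurable_obox|exact: lebesgue_obox_lty].
- move=> x _; rewrite indicE; have [|/negP] := boolP (x \in obox p q).
    by rewrite ger0_norm ?bump_ge0 ?bump_le1.
  by move=> xpq; rewrite bump_eq0 ?normr0// => /mem_set.
Qed.

(** [f] and the inverse transform of [F] have the same pairings with all bumps. *)
Lemma fourier_inversion : {ae mu, forall x, f x = inverse_fourier F x}.
Proof.
have [[[mf1 mf2] _ _] _ _] := fF.
have [mi1 mi2] := cmeasurable_inverse.
have H1 : {ae mu, forall x, complex.Re (f x) - complex.Re (inverse_fourier F x) = 0}.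
  apply: du_bois_reymond; first exact: measurable_funB.
    move=> p q; under eq_fun do rewrite mulrBr; apply: rintegrableB => //.
      by have [] := test_integrable (schwartz_bump ltr01 p q).
    by have [] := test_integrable_inverse (ibump p q ltr01).
  move=> c p q c0; under eq_Rintegral do rewrite mulrBr.
  rewrite RintegralB//.
  - by rewrite (test_Re (ibump p q c0) (schwartz_bump c0 p q)) subrr.
  - by have [] := test_integrable (schwartz_bump c0 p q).
  - by have [] := test_integrable_inverse (ibump p q c0).
have H2 : {ae mu, forall x, complex.Im (f x) - complex.Im (inverse_fourier F x) = 0}.
  apply: du_bois_reymond; first exact: measurable_funB.
    move=> p q; under eq_fun do rewrite mulrBr; apply: rintegrableB => //.
      by have [] := test_integrable (schwartz_bump ltr01 p q).
    by have [] := test_integrable_inverse (ibump p q ltr01).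
  move=> c p q c0; under eq_Rintegral do rewrite mulrBr.
  rewrite RintegralB//.
  - by rewrite (test_Im (ibump p q c0) (schwartz_bump c0 p q)) subrr.
  - by have [] := test_integrable (schwartz_bump c0 p q).
  - by have [] := test_integrable_inverse (ibump p q c0).
apply: filterS2 H1 H2 => x /eqP; rewrite subr_eq0 => /eqP h1 /eqP.
by rewrite subr_eq0 => /eqP h2; exact: complex_ext.
Qed.

End inversion.

End fourier_inversion.

(** * Characters of the torus *)

Definition qitv (R : realType) : set R := `](- 2^-1), 2^-1[%classic.
Arguments qitv : clear implicits.

Section trigonometric_integrals.
Context (R : realType).
Local Notation lam := (@lebesgue_measure R).

Lemma sin_int_pi (k : int) : sin (k%:~R * pi) = 0 :> R.
Proof.
have sin_nat (n : nat) : sin (n%:R * pi) = 0 :> R.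
  elim: n => [|n IH]; first by rewrite mul0r sin0.
  by rewrite -natr1 mulrDl mul1r sinDpi IH oppr0.
case: k => n; first exact: sin_nat.
by rewrite NegzE rmorphN /= mulNr sinN sin_nat oppr0.
Qed.

Lemma integral_cos_period (th : R) (k : int) : k != 0 ->
  (\int[lam]_(t in qitv R) (cos (th + 2 * pi * (k%:~R * t)))%:E = 0)%E.
Proof.
move=> k0.
pose w : R := 2 * pi * k%:~R.
have w0 : w != 0 by rewrite /w !mulf_neq0// ?intr_eq0// gt_eqF// pi_gt0.
pose F t := w^-1 * sin (th + 2 * pi * (k%:~R * t)).
have dl (t : R) : is_derive t 1 (fun t : R => th + 2 * pi * (k%:~R * t)) w.
  have -> : (fun t : R => th + 2 * pi * (k%:~R * t)) = cst th + (w \*: (id : R -> R)).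
    by apply/funext => s; rewrite /= /w mulrA.
  have H : is_derive t 1 (cst th + (w \*: (id : R -> R))) (0 + w *: 1).
    exact: is_deriveD.
  by apply: (is_derive_eq H); rewrite add0r /GRing.scale/= mulr1.
have dF (t : R) : is_derive t 1 F (cos (th + 2 * pi * (k%:~R * t))).
  have h := @is_derive1_comp _ sin _ t _ _ (is_derive_sin _) (dl t).
  apply: (is_derive_eq (is_deriveZ w^-1 h)).
  by rewrite /GRing.scale/= mulrCA mulVf// mulr1.
have cc : continuous (fun t : R => cos (th + 2 * pi * (k%:~R * t))).
  move=> t; apply: (@continuous_comp _ _ _ (fun t : R => th + 2 * pi * (k%:~R * t)) cos).
    apply: differentiable_continuous; apply/derivable1_diffP.
    exact: (@ex_derive _ _ _ _ _ _ _ (dl t)).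
  exact: continuous_cos.
have cF : continuous F.
  move=> t; apply: differentiable_continuous; apply/derivable1_diffP.
  exact: (@ex_derive _ _ _ _ _ _ _ (dF t)).
rewrite /qitv -(@integral_itv_bndoo _ (- 2^-1) 2^-1
  (fun t => (cos (th + 2 * pi * (k%:~R * t)))%:E) true false); last first.
  by apply: measurable_funTS; apply/measurable_EFinP; apply: continuous_measurable_fun.
rewrite (@continuous_FTC2 _ _ F).
- rewrite -EFinB; congr EFin; rewrite /F -mulrBr.
  have -> : th + 2 * pi * (k%:~R * 2^-1) = th + k%:~R * pi by field.
  have -> : th + 2 * pi * (k%:~R * - 2^-1) = th - k%:~R * pi by field.
  by rewrite sinD sinB sin_int_pi; ring.
- by rewrite -subr_gt0; lra.
- exact: continuous_subspaceT.
- split.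
  + by move=> t _; exact: (@ex_derive _ _ _ _ _ _ _ (dF t)).
  + by apply: cvg_at_right_filter; exact: cF.
  + by apply: cvg_at_left_filter; exact: cF.
- by move=> t _; rewrite derive1E; exact: (@derive_val _ _ _ _ _ _ _ (dF t)).
Qed.

End trigonometric_integrals.

(** The open cube as a fundamental domain: it is itself an open box. *)
Definition torus (R : realType) (d : nat) : set 'cV[R]_d :=
  obox (fun=> - 2^-1) (fun=> 2^-1).
Arguments torus : clear implicits.

Section torus.
Context (R : realType).

Lemma measurable_torus d : measurable (torus R d).
Proof. exact: measurable_obox. Qed.

Lemma lebesgue_torus d : lebesgue R d (torus R d) = 1%E.
Proof.
rewrite lebesgue_obox; last by move=> i; lra.
by congr EFin; apply: big1 => i _; lra.
Qed.

Lemma lebesgue_torus_lty d : (lebesgue R d (torus R d) < +oo)%E.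
Proof. by rewrite lebesgue_torus ltry. Qed.

Lemma torus_vcons d t (y : 'cV[R]_d) : torus R d.+1 (vcons (t, y)) <-> qitv R t /\ torus R d y.
Proof.
rewrite /torus /obox /qitv /= in_itv /=; split.
  move=> H; split=> [|i]; first by have := H ord0; rewrite vcons0.
  by have := H (lift ord0 i); rewrite vconsS.
by move=> [H0 H1] i; have [j ->|->] := unliftP ord0 i; rewrite ?vcons0 ?vconsS.
Qed.

Lemma dotv_vcons d s (x : 'cV[R]_d) t (y : 'cV[R]_d) :
  dotv (vcons (s, x)) (vcons (t, y)) = s * t + dotv x y.
Proof.
rewrite /dotv big_ord_recl !vcons0; congr (_ + _).
by apply: eq_bigr => i _; rewrite !vconsS.
Qed.

Lemma lebesgueS_fubini d (h : 'cV[R]_d.+1 -> R) :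
  (lebesgue R d.+1).-integrable setT (EFin \o h) ->
  (\int[lebesgue R d.+1]_x (h x)%:E =
     \int[lebesgue_measure]_t \int[lebesgue R d]_y (h (vcons (t, y)))%:E)%E /\
  (\int[lebesgue R d.+1]_x (h x)%:E =
     \int[lebesgue R d]_y \int[lebesgue_measure]_t (h (vcons (t, y)))%:E)%E.
Proof.
move=> ih.
have mh : measurable_fun setT (EFin \o h) by exact: (measurable_int _ ih).
have ihv : (@lebesgue_measure R \x lebesgue R d)%E.-integrable setT ((EFin \o h) \o @vcons R d).
  apply/integrableP; split.
    exact: measurableT_comp mh (@measurable_vcons R d).
  have /integrableP[_] := ih; apply: le_lt_trans.
  rewrite /= /cons_measure.
  rewrite (@ge0_integral_pushforward _ _ _ _ R _ (@measurable_vcons R d)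
    (@lebesgue_measure R \x lebesgue R d)%E setT (fun x => `|(h x)%:E|)%E)//.
  exact: measurableT_comp.
have E : (\int[lebesgue R d.+1]_x (h x)%:E =
    \int[@lebesgue_measure R \x lebesgue R d]_p (h (vcons p))%:E)%E.
  exact: (@integral_pushforward _ _ _ _ R _ (@measurable_vcons R d)
    (@lebesgue_measure R \x lebesgue R d)%E setT (EFin \o h) mh ihv measurableT).
split; rewrite E.
  by rewrite -(@integral12_prod_meas1 _ _ _ _ _ _ _ _ ihv).
by rewrite -(@integral21_prod_meas1 _ _ _ _ _ _ _ _ ihv).
Qed.

(** Some coordinate of [k] is nonzero.  If it is the first one, integrate in the
first variable first; otherwise the inner integral over the remaining variables
vanishes by induction.  The phase [th] absorbs the variables held fixed. *)
Lemma integral_cos_torus d (k : 'cV[int]_d) (th : R) : k != 0 ->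
  Rintegral (lebesgue R d) (torus R d)
    (fun x => cos (th + 2 * pi * dotv (ivec k) x)) = 0.
Proof.
elim: d k th => [|d IH] k th k0.
  by case/eqP: k0; apply/matrixP => -[].
rewrite Rintegral_mkcond.
set h := _ \_ _.
have mcos : measurable_fun setT (fun x => cos (th + 2 * pi * dotv (ivec k) x)).
  apply: measurableT_comp.
    by apply: continuous_measurable_fun; exact: continuous_cos.
  by apply: measurable_funD => //; apply: measurable_funM => //; exact: measurable_dotvr.
have ih : (lebesgue R d.+1).-integrable setT (EFin \o h).
  rewrite /h; rewrite -restrict_EFin; apply/(integrable_mkcond _ (@measurable_torus d.+1)).
  apply: (@rintegrable_bounded _ _ _ _ 1).
  - exact: measurable_torus.
  - exact: lebesgue_torus_lty.
  - exact: measurable_funTS.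
  - by move=> x _; rewrite ler_norml cos_geN1 cos_le1.
pose k1 : 'cV[int]_d := \col_i k (lift ord0 i) ord0.
have kE : (ivec k : 'cV[R]_d.+1) = vcons ((k ord0 ord0)%:~R, ivec k1).
  apply/matrixP => i j; rewrite (ord1 j); have [l ->|->] := unliftP ord0 i.
    by rewrite vconsS !mxE.
  by rewrite vcons0 !mxE.
have hE t y : h (vcons (t, y)) = (\1_(qitv R) t * (\1_(torus R d) y *
    cos (th + 2 * pi * ((k ord0 ord0)%:~R * t + dotv (ivec k1) y)))).
  rewrite /h patchE kE dotv_vcons !indicE.
  case: ifPn => [/set_mem/torus_vcons[H1 H2]|H].
    by rewrite !mem_set// !mul1r.
  have [tq|] := boolP (t \in qitv R); last by rewrite mul0r.
  have [yq|] := boolP (y \in torus R d); last by rewrite mul0r mulr0.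
  by move/negP: H => []; apply/mem_set/torus_vcons; split; exact: set_mem.
have [F1 F2] := lebesgueS_fubini ih.
have [k00|k00] := eqVneq (k ord0 ord0) 0.
  have k10 : k1 != 0.
    apply: contra k0 => /eqP k10; apply/eqP/matrixP => i j; rewrite (ord1 j) [RHS]mxE.
    have [l ->|->] := unliftP ord0 i; last exact: k00.
    by have /matrixP/(_ l ord0) := k10; rewrite !mxE.
  rewrite /Rintegral F1 integral0_eq// => t _.
  under eq_integral do rewrite hE k00 mul0r add0r.
  have i1 : (lebesgue R d).-integrable setT (EFin \o (fun y => \1_(torus R d) y *
       cos (th + 2 * pi * dotv (ivec k1) y))).
    apply: (@rintegrable_le _ _ _ _ (\1_(torus R d))) => //.
    - apply: measurable_funM; first by apply: measurable_indic; exact: measurable_torus.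
      apply: measurableT_comp.
        by apply: continuous_measurable_fun; exact: continuous_cos.
      by apply: measurable_funD => //; apply: measurable_funM => //; exact: measurable_dotvr.
    - apply: rintegrable_finite_indic; [exact: measurable_torus|exact: lebesgue_torus_lty].
    - move=> y _; rewrite normrM ger0_norm ?indicE// ler_piMr//.
      by rewrite ler_norml cos_geN1 cos_le1.
  under eq_integral do rewrite EFinM.
  rewrite integralZl//.
  rewrite (_ : (\int[_]_x _)%E = 0)%E ?mule0//.
  rewrite -[LHS]fineK; last exact: integrable_fin_num i1.
  congr EFin; rewrite -[RHS](IH k1 th k10) [in RHS]Rintegral_mkcond.
  apply: eq_Rintegral => y _; rewrite patchE indicE.
  by case: ifPn => // _; rewrite ?mul1r ?mul0r.
rewrite /Rintegral F2 integral0_eq// => y _.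
under eq_integral do rewrite hE.
rewrite -[RHS](mule0 (\1_(torus R d) y)%:E).
rewrite -(@integral_cos_period R (th + 2 * pi * dotv (ivec k1) y) _ k00).
rewrite [in RHS]integral_mkcond.
rewrite -integralZl//=.
  apply: eq_integral => t _; rewrite patchE indicE.
  have -> : th + 2 * pi * ((k ord0 ord0)%:~R * t + dotv (ivec k1) y) =
    th + 2 * pi * dotv (ivec k1) y + 2 * pi * ((k ord0 ord0)%:~R * t) by ring.
  by case: ifPn => _; rewrite ?mul1r ?mul0r ?mule0// -EFinM.
have mq : measurable (qitv R : set (measurableTypeR R)) by exact: measurable_itv.
have fq : (@lebesgue_measure R (qitv R) < +oo)%E.
  by rewrite /qitv lebesgue_measure_itv /=; case: ifP; rewrite -?EFinB ltry.
apply: (integrable_mkcond _ mq).1.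
apply: measurable_bounded_integrable.
- exact: measurable_itv.
- exact: fq.
- apply: measurable_funTS; apply: measurableT_comp.
    by apply: continuous_measurable_fun; exact: continuous_cos.
  by apply: measurable_funD => //; apply: measurable_funM => //; apply: measurable_funM.
- exists 1; split => // M M1 t _ /=.
  by rewrite (le_trans _ (ltW M1))// ler_norml cos_geN1 cos_le1.
Qed.

End torus.

Section trig_polynomials.
Context (R : realType) (d : nat).
Local Notation V := 'cV[R]_d.
Local Notation K := 'cV[int]_d.
Local Notation mu := (lebesgue R d).
Local Notation Q := (torus R d).
Local Notation C := R[i].

Definition chr (k : K) (x : V) : C := expi (2 * pi * dotv (ivec k) x).

Lemma dotv_ivecD (k l : K) (x : V) :
  dotv (ivec (k + l)) x = dotv (ivec k) x + dotv (ivec l) x.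
Proof.
rewrite /dotv -big_split; apply: eq_bigr => i _.
by rewrite !mxE rmorphD mulrDl.
Qed.

Lemma dotv_ivecN (k : K) (x : V) : dotv (ivec (- k)) x = - dotv (ivec k) x.
Proof.
rewrite /dotv -sumrN; apply: eq_bigr => i _.
by rewrite !mxE rmorphN mulNr.
Qed.

Lemma chrD k l x : chr (k + l) x = chr k x * chr l x.
Proof. by rewrite /chr dotv_ivecD mulrDr expiD. Qed.

Lemma chrN k x : chr (- k) x = conjc (chr k x).
Proof. by rewrite /chr dotv_ivecN mulrN expiN. Qed.

Lemma chr0 x : chr 0 x = 1.
Proof.
rewrite /chr /dotv big1 ?mulr0 ?expi0// => i _.
by rewrite !mxE mul0r.
Qed.

Lemma normc_chr k x : normc (chr k x) = 1.
Proof. exact: normc_expi. Qed.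

Lemma cmeasurable_chr k : cmeasurable setT (chr k).
Proof.
apply: cmeasurable_expi; apply: measurable_funM => //; exact: measurable_dotvr.
Qed.

(** A phase of - pi / 2 turns the cosine into a sine, for the imaginary part. *)
Lemma cintegral_chr k : cintegral Q (chr k) = (k == 0)%:R.
Proof.
have [->|k0] := eqVneq k 0.
  rewrite (@eq_cintegral _ _ _ _ (fun=> 1)); last by move=> x _; exact: chr0.
  have mQ := @measurable_torus R d.
  by apply: complex_ext; rewrite /= (Rintegral_cst _ mQ) [fine _](congr1 fine (@lebesgue_torus R d)) /= mulr1.
apply: complex_ext => /=.
  rewrite -[RHS](integral_cos_torus 0 k0).
  by apply: eq_Rintegral => x _; rewrite add0r.
rewrite -[RHS](integral_cos_torus (- (pi / 2)) k0).
by apply: eq_Rintegral => x _; rewrite addrC cosBpihalf.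
Qed.

(** * The theorem of M. Riesz for cubic partial sums *)

(** Trigonometric polynomials are kept as formal sums of characters, possibly with
repeated frequencies: products and Fourier multipliers are then operations on
lists, and no uniqueness of coefficients is ever required. *)
Definition tpoly := seq (C * K).

Definition tev (s : tpoly) (x : V) : C := \sum_(p <- s) p.1 * chr p.2 x.

Definition tmul (s t : tpoly) : tpoly :=
  [seq (p.1 * q.1, p.2 + q.2) | p <- s, q <- t].

Definition tmult (m : K -> C) (s : tpoly) : tpoly :=
  [seq (m p.2 * p.1, p.2) | p <- s].

Lemma tev_cat s t x : tev (s ++ t) x = tev s x + tev t x.
Proof. by rewrite /tev big_cat. Qed.

Lemma tev_tmult m s x : tev (tmult m s) x = \sum_(p <- s) m p.2 * p.1 * chr p.2 x.
Proof. by rewrite /tev big_map. Qed.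

Lemma tev_mul s t x : tev (tmul s t) x = tev s x * tev t x.
Proof.
rewrite /tev big_allpairs_dep mulr_suml; apply: eq_bigr => p _.
rewrite mulr_sumr; apply: eq_bigr => q _ /=.
by rewrite chrD; ring.
Qed.

Lemma tev_tmult_mul m s t x : tev (tmult m (tmul s t)) x =
  \sum_(p <- s) \sum_(q <- t) m (p.2 + q.2) * (p.1 * q.1) * (chr p.2 x * chr q.2 x).
Proof.
rewrite tev_tmult big_allpairs_dep; apply: eq_bigr => p _.
by apply: eq_bigr => q _; rewrite /= chrD.
Qed.

Lemma cmeasurable_tev s : cmeasurable setT (tev s).
Proof.
elim: s => [|p s IH].
  rewrite (_ : tev [::] = fun=> 0); first exact: cmeasurable_cst.
  by apply/funext => x; rewrite /tev big_nil.
rewrite (_ : tev (p :: s) = fun x => p.1 * chr p.2 x + tev s x); last first.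
  by apply/funext => x; rewrite /tev big_cons.
apply: cmeasurableD => //; apply: cmeasurableM; last exact: cmeasurable_chr.
exact: cmeasurable_cst.
Qed.

Lemma normc_tev_le s x : normc (tev s x) <= \sum_(p <- s) normc p.1.
Proof.
rewrite /tev; elim: s => [|p s IH]; first by rewrite !big_nil normc0.
rewrite !big_cons (le_trans (le_normcD _ _))// lerD//.
by rewrite normcM normc_chr mulr1.
Qed.

(** The p-th power of the L^p norm, which avoids roots. *)
Definition tnorm (p : nat) (s : tpoly) : R :=
  Rintegral mu Q (fun x => normc (tev s x) ^+ p).

Lemma integrable_tnorm p s :
  mu.-integrable Q (EFin \o (fun x => normc (tev s x) ^+ p)).
Proof.
apply: (@rintegrable_bounded _ _ _ _ ((\sum_(p <- s) normc p.1) ^+ p)).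
- exact: measurable_torus.
- exact: lebesgue_torus_lty.
- apply: measurable_funX; apply: measurable_normc.
  by apply: (@cmeasurableS _ _ _ setT) => //; exact: cmeasurable_tev.
- move=> x _; rewrite ger0_norm ?exprn_ge0 ?normc_ge0//.
  rewrite lerXn2r ?nnegrE ?normc_ge0 ?normc_tev_le//.
  by rewrite (le_trans _ (normc_tev_le s x))// normc_ge0.
Qed.

Lemma sqr_normc_conj (z : C) : (normc z ^+ 2)%:C%C = z * conjc z.
Proof.
rewrite sqr_normc_ReIm; apply: complex_ext; case: z => a b; rewrite ?ReM ?ImM /=; ring.
Qed.

(** Parseval: expand the square and use the orthogonality of characters. *)
Lemma tnorm2E s : (tnorm 2 s)%:C%C =
  \sum_(p <- s) \sum_(q <- s) p.1 * conjc q.1 * (p.2 == q.2)%:R.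
Proof.
have -> : (tnorm 2 s)%:C%C = cintegral Q (fun x => (normc (tev s x) ^+ 2)%:C%C).
  by apply: complex_ext => //=; rewrite Rintegral_cst ?mul0r//; exact: measurable_torus.
have ich k : cintegrable Q (chr k).
  apply: (@cintegrable_bounded _ _ _ _ 1).
  - exact: measurable_torus.
  - exact: lebesgue_torus_lty.
  - by apply: (@cmeasurableS _ _ _ setT) => //; exact: cmeasurable_chr.
  - by move=> x _; rewrite normc_chr.
have mQ := @measurable_torus R d.
rewrite (@eq_cintegral _ _ _ _ (fun x => \sum_(p <- s) \sum_(q <- s)
    p.1 * conjc q.1 * chr (p.2 - q.2) x)); last first.
  move=> x _; rewrite sqr_normc_conj /tev rmorph_sum mulr_suml.
  apply: eq_bigr => p _; rewrite mulr_sumr; apply: eq_bigr => q _.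
  by rewrite chrD chrN rmorphM; ring.
rewrite cintegral_sum//; last first.
  by move=> p; apply: cintegrable_sum => // q; exact: cintegrableZ.
apply: eq_bigr => p _; rewrite cintegral_sum//; last first.
  by move=> q; exact: cintegrableZ.
apply: eq_bigr => q _; rewrite cintegralZ// cintegral_chr.
by rewrite subr_eq0.
Qed.

Lemma exprD_le (p : nat) (a b : R) : 0 <= a -> 0 <= b ->
  (a + b) ^+ p <= 2 ^+ p * (a ^+ p + b ^+ p).
Proof.
move=> a0 b0.
wlog ab : a b a0 b0 / a <= b.
  move=> W; have [/W|/ltW/W] := leP a b; first exact.
  by rewrite [b + a]addrC [b ^+ p + _]addrC; exact.
apply: (@le_trans _ _ ((2 * b) ^+ p)).
  rewrite lerXn2r ?nnegrE ?addr_ge0 ?mulr_ge0//.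
  by rewrite mulr_natl mulr2n lerD2r.
by rewrite exprMn ler_wpM2l ?exprn_ge0// lerDr exprn_ge0.
Qed.

Lemma le_mul_sqr (k a b : R) : 0 < k -> 0 <= a -> 0 <= b ->
  a * b <= k * a ^+ 2 + k^-1 * b ^+ 2.
Proof.
move=> k0 a0 b0.
have : 0 <= k^-1 * (k * a - b) ^+ 2 + (k * a ^+ 2 + k^-1 * b ^+ 2) .
  have k0' := ltW k0; have ki : 0 <= k^-1 by rewrite invr_ge0.
  by rewrite !addr_ge0// mulr_ge0// sqr_ge0.
have -> : k^-1 * (k * a - b) ^+ 2 + (k * a ^+ 2 + k^-1 * b ^+ 2) =
  2 * (k * a ^+ 2 + k^-1 * b ^+ 2 - a * b) by field; rewrite gt_eqF.
by rewrite pmulr_rge0// subr_ge0.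
Qed.

Section sign_multiplier.
Variable i : 'I_d.

(** The multiplier of the discrete Hilbert transform in the i-th variable, with the
value 1 at 0; this convention makes [cotlar_sgnk] hold without exception. *)
Definition sgnk (c : int) (k : K) : C := if 0 <= k i ord0 + c then 1 else -1.

(** If the signs are equal, they are also the sign of k + l; if they are opposite,
their sum vanishes. *)
Lemma cotlar_sgnk (k l : K) :
  sgnk 0 k * sgnk 0 l = -1 + sgnk 0 (k + l) * (sgnk 0 k + sgnk 0 l).
Proof.
rewrite /sgnk !mxE !addr0.
case: (leP 0 (k i ord0)) => hk; case: (leP 0 (l i ord0)) => hl.
- by rewrite addr_ge0//; ring.
- by ring.
- by ring.
- have -> : (0 <= k i ord0 + l i ord0) = false by lia.
  by ring.
Qed.

Local Notation H := (tmult (sgnk 0)).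

(** Cotlar's identity (H s)^2 = - s^2 + 2 H (s H s), by summation of [cotlar_sgnk]. *)
Lemma cotlar s x :
  tev (H s) x ^+ 2 = - tev s x ^+ 2 + 2 * tev (H (tmul s (H s))) x.
Proof.
have E : tev (H (tmul s (H s))) x = \sum_(p <- s) \sum_(q <- s)
   sgnk 0 (p.2 + q.2) * sgnk 0 q.2 * (p.1 * q.1 * (chr p.2 x * chr q.2 x)).
  rewrite tev_tmult_mul; apply: eq_bigr => p _.
  by rewrite big_map; apply: eq_bigr => q _ /=; ring.
rewrite mulr_natl mulr2n {1}E.
have -> : tev (H (tmul s (H s))) x = \sum_(p <- s) \sum_(q <- s)
   sgnk 0 (p.2 + q.2) * sgnk 0 p.2 * (p.1 * q.1 * (chr p.2 x * chr q.2 x)).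
  rewrite E exchange_big; apply: eq_bigr => p _; apply: eq_bigr => q _ /=.
  by rewrite [q.2 + p.2]addrC; ring.
rewrite !expr2 /tev big_map !mulr_suml -sumrN -!big_split; apply: eq_bigr => p _ /=.
rewrite !mulr_sumr -sumrN -!big_split; apply: eq_bigr => q _ /=.
have := cotlar_sgnk p.2 q.2; set a := sgnk 0 _; set b := sgnk 0 _; set c := sgnk 0 _.
move=> abc; transitivity (a * b * (p.1 * q.1 * (chr p.2 x * chr q.2 x))); first by ring.
by rewrite abc; ring.
Qed.

Lemma tnorm2_sgn s : tnorm 2 (H s) = tnorm 2 s.
Proof.
apply: (@complexI R); rewrite !tnorm2E big_map; apply: eq_bigr => p _.
rewrite big_map; apply: eq_bigr => q _ /=.
rewrite rmorphM; have [->|_] := eqVneq p.2 q.2; last by rewrite !mulr0.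
have : sgnk 0 q.2 * conjc (sgnk 0 q.2) = 1.
  by rewrite /sgnk; case: ifP => _; rewrite ?rmorphN rmorph1 ?mulrNN mulr1.
move=> e; transitivity (sgnk 0 q.2 * conjc (sgnk 0 q.2) * (p.1 * conjc q.1)).
  by rewrite mulr1; ring.
by rewrite e mulr1 mul1r.
Qed.

(** Cotlar's identity controls |H s|^(2p) by |s|^(2p) and |H (s H s)|^p; the bound
for exponent p and Young's inequality absorb half of the left-hand side. *)
Lemma tnorm_sgn_double p A : 1 <= A -> (forall s, tnorm p (H s) <= A * tnorm p s) ->
  exists2 B, 1 <= B & forall s, tnorm p.*2 (H s) <= B * tnorm p.*2 s.
Proof.
move=> A1 HA.
have A0 : 0 < A by apply: lt_le_trans A1.
(* k is chosen so that the coefficient of Y on the right of step3 is 1/2. *)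
pose k : R := 2 * (2 ^+ p * 2 ^+ p * A).
have k0 : 0 < k by rewrite !mulr_gt0 ?exprn_gt0.
pose B : R := 2 * (2 ^+ p + 2 ^+ p * 2 ^+ p * A * k).
have p1 : 1 <= 2 ^+ p :> R by apply: exprn_ege1; rewrite ler1n.
exists B.
  have : 0 <= 2 ^+ p * 2 ^+ p * A * k by rewrite !mulr_ge0 ?exprn_ge0 ?ltW.
  by rewrite /B; lra.
move=> s.
set X := tnorm p.*2 s; set Y := tnorm p.*2 (H s).
have mQ := @measurable_torus R d.
have step1 : Y <= 2 ^+ p * (X + 2 ^+ p * tnorm p (H (tmul s (H s)))).
  rewrite /Y /X /tnorm -RintegralZl//; last exact: integrable_tnorm.
  rewrite -RintegralD//; [|exact: integrable_tnorm|]; last first.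
    by apply: rintegrableZ => //; exact: integrable_tnorm.
  rewrite -RintegralZl//; last first.
    apply: rintegrableD => //; first exact: integrable_tnorm.
    by apply: rintegrableZ => //; exact: integrable_tnorm.
  apply: le_Rintegral => //.
  - exact: integrable_tnorm.
  - apply: rintegrableZ => //; apply: rintegrableD => //; first exact: integrable_tnorm.
    by apply: rintegrableZ => //; exact: integrable_tnorm.
  move=> x _; rewrite -mul2n !exprM -!normcX cotlar !(normcX _ p).
  apply: (@le_trans _ _ ((normc (tev s x ^+ 2) + 2 * normc (tev (H (tmul s (H s))) x)) ^+ p)).
    rewrite lerXn2r ?nnegrE ?normc_ge0 ?addr_ge0 ?mulr_ge0 ?normc_ge0//.
    rewrite (le_trans (le_normcD _ _))// normcN lerD2l.
    have -> : (2 : C) = (2 : R)%:C%C by rewrite rmorph_nat.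
    by rewrite [X in X <= _]normcM normc_real ger0_norm.
  by rewrite (le_trans (exprD_le _ _ _)) ?mulr_ge0 ?normc_ge0// exprMn.
have step2 : tnorm p (tmul s (H s)) <= k * X + k^-1 * Y.
  rewrite /Y /X /tnorm -!RintegralZl//; try exact: integrable_tnorm.
  rewrite -RintegralD//; try by apply: rintegrableZ => //; exact: integrable_tnorm.
  apply: le_Rintegral => //.
  - exact: integrable_tnorm.
  - by apply: rintegrableD => //; apply: rintegrableZ => //; exact: integrable_tnorm.
  move=> x _; rewrite tev_mul normcM exprMn -muln2 !exprM.
  by apply: le_mul_sqr; rewrite ?exprn_ge0 ?normc_ge0.
have step3 : Y <= 2 ^+ p * X + 2 ^+ p * 2 ^+ p * A * (k * X + k^-1 * Y).
  apply: (le_trans step1); rewrite mulrDr lerD2l mulrA -[X in _ <= X]mulrA.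
  rewrite ler_wpM2l ?mulr_ge0 ?exprn_ge0//.
  by rewrite (le_trans (HA _))// ler_wpM2l// ltW.
have kE : 2 ^+ p * 2 ^+ p * A * k^-1 = 2^-1.
  by rewrite /k; field; rewrite !gt_eqF ?exprn_gt0.
have : Y <= 2 ^+ p * X + 2 ^+ p * 2 ^+ p * A * k * X + 2^-1 * Y.
  by rewrite -kE; move: step3; rewrite mulrDr !mulrA addrA.
by rewrite /B; lra.
Qed.

Lemma tnorm_sgn_bound j : exists2 A, 1 <= A &
  forall s, tnorm (2 ^ j.+1) (H s) <= A * tnorm (2 ^ j.+1) s.
Proof.
elim: j => [|j [A A1 HA]].
  by exists 1 => // s; rewrite expn1 mul1r tnorm2_sgn.
have [B B1 HB] := tnorm_sgn_double A1 HA.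
by exists B => //; rewrite expnS mul2n.
Qed.

Definition tshift (l : K) (s : tpoly) : tpoly := [seq (p.1, p.2 + l) | p <- s].

Lemma tev_shift l s x : tev (tshift l s) x = tev s x * chr l x.
Proof.
rewrite /tev big_map mulr_suml; apply: eq_bigr => p _ /=.
by rewrite chrD mulrA.
Qed.

Lemma tnorm_shift l s p : tnorm p (tshift l s) = tnorm p s.
Proof.
by apply: eq_Rintegral => x _; rewrite tev_shift normcM normc_chr mulr1.
Qed.

(** Shifting the threshold of the sign is conjugation by a modulation, which does
not change absolute values. *)
Lemma tnorm_sgn_shift c s p :
  tnorm p (tmult (sgnk c) s) = tnorm p (H (tshift (c *: delta_mx i ord0) s)).
Proof.
rewrite -(tnorm_shift (c *: delta_mx i ord0)).
apply: eq_Rintegral => x _; congr (normc _ ^+ p).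
rewrite /tev !big_map; apply: eq_bigr => q _ /=.
by rewrite /sgnk !mxE !eqxx mulr1 addr0.
Qed.

Definition cut (n : nat) (k : K) : C := (`|k i ord0| <= n)%N%:R.

(** The indicator of an interval of integers is half the difference of two shifted
signs. *)
Lemma cutE n k : cut n k = 2^-1 * (sgnk n%:Z k - sgnk (- n.+1%:Z) k).
Proof.
rewrite /cut /sgnk.
have [h1|h1] := leP 0 (k i ord0 + n%:Z); have [h2|h2] := leP 0 (k i ord0 - n.+1%:Z).
- have -> : (`|k i ord0| <= n)%N = false by apply/negbTE; lia.
  by rewrite subrr mulr0.
- have -> : (`|k i ord0| <= n)%N by lia.
  by rewrite opprK -[1 + 1]/(2%:R) mulVf// pnatr_eq0.
- lia.
- have -> : (`|k i ord0| <= n)%N = false by apply/negbTE; lia.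
  by rewrite subrr mulr0.
Qed.

Lemma tnorm_cut_bound j : exists2 A, 1 <= A & forall n s,
  tnorm (2 ^ j.+1) (tmult (cut n) s) <= A * tnorm (2 ^ j.+1) s.
Proof.
have [A A1 HA] := tnorm_sgn_bound j; set p := (2 ^ j.+1)%N.
have A0 : 0 < A by apply: lt_le_trans A1.
have p1 : 1 <= 2 ^+ p :> R by apply: exprn_ege1; rewrite ler1n.
exists (2 ^+ p * (2 * A)).
  by rewrite -[X in X <= _]mulr1; apply: ler_pM => //; lra.
move=> n s; have mQ := @measurable_torus R d.
have HA' c : tnorm p (tmult (sgnk c) s) <= A * tnorm p s.
  by rewrite tnorm_sgn_shift (le_trans (HA _))// tnorm_shift.
apply: (@le_trans _ _ (2 ^+ p * (tnorm p (tmult (sgnk n%:Z) s) +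
    tnorm p (tmult (sgnk (- n.+1%:Z)) s)))); last first.
  rewrite -mulrA ler_wpM2l ?exprn_ge0//.
  by rewrite (le_trans (lerD (HA' _) (HA' _)))//; lra.
rewrite /tnorm -RintegralD//; try exact: integrable_tnorm.
rewrite -RintegralZl//; last by apply: rintegrableD => //; exact: integrable_tnorm.
apply: le_Rintegral => //.
- exact: integrable_tnorm.
- by apply: rintegrableZ => //; apply: rintegrableD => //; exact: integrable_tnorm.
move=> x _; apply: le_trans (exprD_le _ (normc_ge0 _) (normc_ge0 _)).
rewrite lerXn2r ?nnegrE ?normc_ge0 ?addr_ge0 ?normc_ge0//.
have -> : tev (tmult (cut n) s) x = (2^-1 : R)%:C%C *
    (tev (tmult (sgnk n%:Z) s) x - tev (tmult (sgnk (- n.+1%:Z)) s) x).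
  rewrite /tev !big_map -sumrN -big_split mulr_sumr; apply: eq_bigr => q _ /=.
  have -> : (2^-1 : R)%:C%C = 2^-1 :> C by rewrite fmorphV rmorph_nat.
  by rewrite cutE; ring.
rewrite normcM normc_real ger0_norm ?invr_ge0//.
apply: (@le_trans _ _ (1 * normc (tev (tmult (sgnk n%:Z) s) x - tev (tmult (sgnk (- n.+1%:Z)) s) x))).
  by rewrite ler_wpM2r ?normc_ge0// invf_le1 ?ler1n.
by rewrite mul1r (le_trans (le_normcD _ _))// normcN.
Qed.

End sign_multiplier.

Definition ccut (n : nat) (k : K) : C := (ivec_norm k <= n)%N%:R.

Lemma ccutE n k : ccut n k = \prod_i cut i n k.
Proof.
rewrite /ccut /ivec_norm; have [/bigmax_leqP h|h] := leqP (\max_(i < d) `|k i ord0|) n.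
  by rewrite big1// => i _; rewrite /cut h.
have [i hi] : exists i, (n < `|k i ord0|)%N.
  apply/existsP; apply: contraTT h => /existsPn h; rewrite -leqNgt.
  by apply/bigmax_leqP => i _; rewrite leqNgt.
by rewrite (bigD1 i)//= /cut leqNgt hi mul0r.
Qed.

(** The cubic cut-off is the composition of the one-dimensional cut-offs in each
variable, and each of them is bounded uniformly in [n]. *)
Lemma tnorm_ccut_bound j : exists2 A, 1 <= A & forall n s,
  tnorm (2 ^ j.+1) (tmult (ccut n) s) <= A * tnorm (2 ^ j.+1) s.
Proof.
have tmultM (m m' : K -> C) s : tmult m (tmult m' s) = tmult (fun k => m k * m' k) s.
  by rewrite /tmult -map_comp; apply: eq_map => p /=; rewrite mulrA.
suff : forall r : seq 'I_d, exists2 A, 1 <= A & forall n s,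
    tnorm (2 ^ j.+1) (tmult (fun k => \prod_(i <- r) cut i n k) s) <= A * tnorm (2 ^ j.+1) s.
  move=> /(_ (index_enum _))[A A1 HA]; exists A => // n s.
  rewrite (_ : tmult (ccut n) s = tmult (fun k => \prod_i cut i n k) s)//.
  by apply: eq_map => p; rewrite ccutE.
elim=> [|i r [A A1 HA]].
  exists 1 => // n s; rewrite mul1r (_ : tmult _ s = s)//.
  rewrite -[RHS]map_id; apply: eq_map => -[a k] /=.
  by rewrite big_nil mul1r.
have [B B1 HB] := tnorm_cut_bound i j; exists (B * A).
  by rewrite -[X in X <= _]mulr1; apply: ler_pM.
move=> n s.
rewrite (_ : tmult _ s = tmult (cut i n) (tmult (fun k => \prod_(i <- r) cut i n k) s)).
  rewrite (le_trans (HB _ _))// -mulrA ler_wpM2l// (le_trans _ B1)//.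
by rewrite tmultM; apply: eq_map => p; rewrite big_cons.
Qed.

End trig_polynomials.

(** * Density of trigonometric polynomials *)

Section sign_iteration.
Context (R : realType).

(** Iterating s |-> (3 s - s^3) / 2, whose attracting fixed points on [-1, 1] are
-1 and 1, gives polynomials of v that tend to the sign of v. *)
Definition sgn_iter (n : nat) (v : R) : R := iter n (fun s => (3 * s - s ^+ 3) / 2) v.

Lemma sgn_iterS n v : sgn_iter n.+1 v = (3 * sgn_iter n v - sgn_iter n v ^+ 3) / 2.
Proof. by []. Qed.

Lemma sgn_iterN n v : sgn_iter n (- v) = - sgn_iter n v.
Proof. by elim: n => [//|n IH]; rewrite !sgn_iterS IH; field. Qed.

Lemma sgn_iter0 n : sgn_iter n 0 = 0.
Proof. by elim: n => [//|n IH]; rewrite sgn_iterS IH; field. Qed.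

Lemma sgn_iter_le1 n v : `|v| <= 1 -> `|sgn_iter n v| <= 1.
Proof.
move=> v1; elim: n => [//|n]; rewrite sgn_iterS; set s := sgn_iter n v.
rewrite !ler_norml => /andP[h1 h2]; apply/andP; split.
  have : 0 <= (s + 1) ^+ 2 * (2 - s) by rewrite mulr_ge0 ?sqr_ge0//; lra.
  have -> : (s + 1) ^+ 2 * (2 - s) = 3 * s - s ^+ 3 + 2 by ring.
  by lra.
have : 0 <= (1 - s) ^+ 2 * (2 + s) by rewrite mulr_ge0 ?sqr_ge0//; lra.
have -> : (1 - s) ^+ 2 * (2 + s) = 2 - (3 * s - s ^+ 3) by ring.
by lra.
Qed.

Lemma sgn_iter_pos n v : 0 < v -> v <= 1 ->
  v <= sgn_iter n v /\ 1 - sgn_iter n v <= (1 - v / 2) ^+ n.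
Proof.
move=> v0 v1.
have s1 m : sgn_iter m v <= 1.
  have : `|sgn_iter m v| <= 1 by apply: sgn_iter_le1; rewrite gtr0_norm.
  by rewrite ler_norml => /andP[].
elim: n => [|n [IH1 IH2]].
  by split => //=; rewrite expr0; lra.
have := s1 n; rewrite sgn_iterS; set s := sgn_iter n v in IH1 IH2 * => sle1.
have h : 1 - (3 * s - s ^+ 3) / 2 = (1 - s) * ((1 - s) * (1 + s / 2)) by field.
split.
  have : 0 <= s * (1 - s) * (1 + s) by rewrite !mulr_ge0//; lra.
  have -> : s * (1 - s) * (1 + s) = s - s ^+ 3 by ring.
  by lra.
rewrite h exprSr; apply: ler_pM => //; try by rewrite ?mulr_ge0; lra.
have : 0 <= s ^+ 2 by exact: sqr_ge0.
have -> : (1 - s) * (1 + s / 2) = 1 - s / 2 - s ^+ 2 / 2 by field.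
by lra.
Qed.

Lemma sgn_iter_cvg1 v : 0 < v -> v <= 1 -> (fun n => sgn_iter n v) @ \oo --> (1 : R).
Proof.
move=> v0 v1.
have : (fun n => 1 - (1 - v / 2) ^+ n) @ \oo --> (1 - 0 : R).
  apply: cvgB; first exact: cvg_cst.
  by apply: cvg_expr; rewrite ger0_norm; lra.
rewrite subr0 => H; apply: (squeeze_cvgr _ H (cvg_cst (1 : R))).
apply: nearW => n; have [_ h] := sgn_iter_pos n v0 v1.
have : `|sgn_iter n v| <= 1 by apply: sgn_iter_le1; rewrite gtr0_norm.
by rewrite ler_norml => /andP[_ ->]; rewrite andbT; lra.
Qed.

(** s (1 + s) / 2 sends the limits -1, 0, 1 of the iteration to 0, 0, 1: the limit
is the indicator of v > 0. *)
Definition step_iter (n : nat) (v : R) : R := sgn_iter n v * (1 + sgn_iter n v) / 2.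

Lemma step_iter_le1 n v : `|v| <= 1 -> `|step_iter n v| <= 1.
Proof.
move=> /(sgn_iter_le1 n); rewrite /step_iter !ler_norml; set s := sgn_iter n v.
move=> /andP[h1 h2].
have : 0 <= (1 - s) * (2 + s) by rewrite mulr_ge0; lra.
have -> : (1 - s) * (2 + s) = 2 - s * (1 + s) by ring.
have : 0 <= s ^+ 2 by exact: sqr_ge0.
have -> : s * (1 + s) = s + s ^+ 2 by ring.
by move=> h3 h4; apply/andP; split; lra.
Qed.

Lemma step_iter_cvg v : `|v| <= 1 ->
  (fun n => step_iter n v) @ \oo --> ((0 < v)%R%:R : R).
Proof.
rewrite ler_norml => /andP[v1 v2].
have H (l : R) : (fun n => sgn_iter n v) @ \oo --> l ->
    (fun n => step_iter n v) @ \oo --> l * (1 + l) / 2.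
  move=> sl; apply: cvgM; last exact: cvg_cst.
  by apply: cvgM => //; apply: cvgD => //; exact: cvg_cst.
have [v0|v0|v0] := ltgtP 0 v.
- have := H _ (sgn_iter_cvg1 v0 v2).
  by have -> : 1 * (1 + 1) / 2 = 1 :> R by field.
- have : (fun n => sgn_iter n v) @ \oo --> (-1 : R).
    have -> : (fun n => sgn_iter n v) = (fun n => - sgn_iter n (- v)).
      by apply/funext => n; rewrite sgn_iterN opprK.
    by apply: cvgN; apply: sgn_iter_cvg1; lra.
  by move=> /H; rewrite subrr mulr0 mul0r.
- have : (fun n => sgn_iter n v) @ \oo --> (0 : R).
    by rewrite -v0; under eq_fun do rewrite sgn_iter0; exact: cvg_cst.
  by move=> /H; rewrite !mul0r.
Qed.

Lemma cos_lt (x y : R) : 0 <= x -> x < y -> y <= pi -> cos y < cos x.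
Proof.
move=> x0 xy yp.
have pi0 := pi_gt0 R.
have h1 : 0 < sin ((x + y) / 2) by apply: sin_gt0_pi; lra.
have h2 : 0 < sin ((y - x) / 2) by apply: sin_gt0_pi; lra.
have : 0 < 2 * (sin ((x + y) / 2) * sin ((y - x) / 2)) by rewrite !mulr_gt0.
suff -> : 2 * (sin ((x + y) / 2) * sin ((y - x) / 2)) = cos x - cos y by rewrite subr_gt0.
have -> : cos x = cos ((x + y) / 2 - (y - x) / 2) by congr cos; field.
have -> : cos y = cos ((x + y) / 2 + (y - x) / 2) by congr cos; field.
by rewrite cosB cosD; ring.
Qed.

(** On the torus, an interval is a superlevel set of a cosine centred at its
midpoint. *)
Definition itv_level (a b t : R) : R :=
  (cos (2 * pi * (t - (a + b) / 2)) - cos (2 * pi * ((b - a) / 2))) / 2.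

Lemma itv_level_le1 a b t : `|itv_level a b t| <= 1.
Proof.
rewrite /itv_level ler_norml; set x := cos _; set y := cos _.
have : -1 <= x <= 1 by rewrite cos_geN1 cos_le1.
have : -1 <= y <= 1 by rewrite cos_geN1 cos_le1.
by move=> /andP[h1 h2] /andP[h3 h4]; apply/andP; split; lra.
Qed.

Lemma itv_level_gt0 a b t : - 2^-1 <= a -> a < b -> b <= 2^-1 ->
  - 2^-1 < t < 2^-1 -> (0 < itv_level a b t) = (a < t < b).
Proof.
move=> a0 ab b0 /andP[t0 t1].
have pi0 := pi_gt0 R.
set u := t - (a + b) / 2; set r := (b - a) / 2.
have cu : cos (2 * pi * u) = cos (2 * pi * `|u|).
  by have [//|_] := ger0P u; rewrite mulrN cosN.
have mono (x y : R) : x < y -> 2 * pi * x < 2 * pi * y.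
  by move=> xy; rewrite ltr_pM2l// mulr_gt0.
have monoe (x y : R) : x <= y -> 2 * pi * x <= 2 * pi * y.
  by move=> xy; rewrite ler_pM2l// mulr_gt0.
have p2 : 0 <= 2 * pi :> R by rewrite mulr_ge0// ltW.
have half (x : R) : x <= 2^-1 -> 2 * pi * x <= pi.
  by move=> /monoe; have -> : 2 * pi * 2^-1 = pi :> R by field.
have E : (a < t < b) = (`|u| < r).
  by rewrite ltr_norml /u /r; apply/andP/andP => -[h1 h2]; split; lra.
rewrite E /itv_level -/u -/r cu pmulr_lgt0 ?invr_gt0// subr_gt0.
have u1 : `|u| <= 1 - r.
  by rewrite ler_norml /u /r; apply/andP; split; lra.
have r0 : 0 < r by rewrite /r; lra.
have r1 : r <= 2^-1 by rewrite /r; lra.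
have [ur|ru] := ltP `|u| r.
  apply: cos_lt; [|exact: mono|].
    by rewrite mulr_ge0// mulr_ge0// ltW.
  exact: half.
apply/negbTE; rewrite -leNgt.
have [u2|u2] := leP `|u| 2^-1.
  move: ru; rewrite le_eqVlt => /predU1P[->//|ru]; apply/ltW/cos_lt.
  - by apply: (mulr_ge0 p2); rewrite ?normr_ge0 ?(ltW r0).
  - exact: mono.
  - exact: half.
have -> : cos (2 * pi * `|u|) = cos (2 * pi * (1 - `|u|)).
  have -> : 2 * pi * (1 - `|u|) = - (2 * pi * `|u|) + pi *+ 2 by ring.
  by rewrite cosD2pi cosN.
have : r <= 1 - `|u| by lra.
rewrite le_eqVlt => /predU1P[->//|ru']; apply/ltW/cos_lt.
- by apply: (mulr_ge0 p2); rewrite ?normr_ge0 ?(ltW r0).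
- exact: mono.
- by apply: half; lra.
Qed.

End sign_iteration.

Lemma cvg0_exists (R : realType) (u : nat -> R) e : u @ \oo --> (0 : R) -> 0 < e ->
  exists n, `|u n| < e.
Proof.
move=> /cvgrPdist_lt/[apply] -[n _ hn]; exists n.
by have := hn n (leqnn n); rewrite sub0r normrN.
Qed.

Section density.
Context (R : realType) (d : nat).
Local Notation V := 'cV[R]_d.
Local Notation K := 'cV[int]_d.
Local Notation mu := (lebesgue R d).
Local Notation Q := (torus R d).
Local Notation C := R[i].
Implicit Types g h : V -> C.

Let mQ : measurable Q := @measurable_torus R d.
Let fQ : (mu Q < +oo)%E := @lebesgue_torus_lty R d.

Lemma bounded_fun_onD g h : bounded_fun_on Q g -> bounded_fun_on Q h ->
  bounded_fun_on Q (fun x => g x + h x).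
Proof.
move=> [mg [B gB]] [mh [B' hB]]; split; first exact: cmeasurableD.
exists (B + B') => x Qx; rewrite (le_trans (le_normcD _ _))// lerD ?gB ?hB//.
Qed.

Lemma bounded_fun_onM g h : bounded_fun_on Q g -> bounded_fun_on Q h ->
  bounded_fun_on Q (fun x => g x * h x).
Proof.
move=> [mg [B gB]] [mh [B' hB]]; split; first exact: cmeasurableM.
by exists (B * B') => x Qx; rewrite normcM ler_pM ?normc_ge0 ?gB ?hB.
Qed.

Lemma bounded_fun_on_cst k : bounded_fun_on Q (fun=> k).
Proof. by split; [exact: cmeasurable_cst|exists (normc k)]. Qed.

Lemma bounded_fun_onN h : bounded_fun_on Q h -> bounded_fun_on Q (fun x => - h x).
Proof.
move=> [mh [B hB]]; split; first exact: cmeasurableN.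
by exists B => x Qx; rewrite normcN hB.
Qed.

Lemma bounded_fun_onB g h : bounded_fun_on Q g -> bounded_fun_on Q h ->
  bounded_fun_on Q (fun x => g x - h x).
Proof. by move=> bg bh; apply: bounded_fun_onD => //; exact: bounded_fun_onN. Qed.

Lemma bounded_fun_on_tev s : bounded_fun_on Q (tev s).
Proof.
split; first by apply: (@cmeasurableS _ _ _ setT) => //; exact: cmeasurable_tev.
by exists (\sum_(p <- s) normc p.1) => x _; exact: normc_tev_le.
Qed.

Lemma cintegrable_bounded_fun h : bounded_fun_on Q h -> cintegrable Q h.
Proof. by move=> [mh [B hB]]; exact: (@cintegrable_bounded _ _ _ _ B). Qed.

(** As for [tnorm], the p-th power of the norm. *)
Definition Lp (p : nat) h : R := Rintegral mu Q (fun x => normc (h x) ^+ p).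

Lemma Lp_integrable p h : bounded_fun_on Q h ->
  mu.-integrable Q (EFin \o (fun x => normc (h x) ^+ p)).
Proof.
move=> [mh [B hB]]; apply: (@rintegrable_bounded _ _ _ _ (B ^+ p)) => //.
  by apply: measurable_funX; exact: measurable_normc.
move=> x Qx; rewrite ger0_norm ?exprn_ge0 ?normc_ge0//.
by rewrite lerXn2r ?nnegrE ?normc_ge0 ?hB// (le_trans (normc_ge0 _) (hB _ Qx)).
Qed.

Lemma Lp_ge0 p h : 0 <= Lp p h.
Proof. by apply: Rintegral_ge0 => x _; rewrite exprn_ge0// normc_ge0. Qed.

Lemma eq_Lp p g h : (forall x, Q x -> g x = h x) -> Lp p g = Lp p h.
Proof. by move=> gh; apply: eq_Rintegral => x /set_mem/gh ->. Qed.

Lemma Lp_cst_le p h k : bounded_fun_on Q h ->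
  (forall x, Q x -> normc (h x) <= k) -> Lp p h <= k ^+ p.
Proof.
move=> bh hk.
have -> : k ^+ p = Rintegral mu Q (cst (k ^+ p)).
  by rewrite Rintegral_cst// [fine _](congr1 fine (@lebesgue_torus R d)) mulr1.
apply: le_Rintegral => //; first exact: Lp_integrable.
  exact: (@rintegrable_bounded _ _ _ _ `|k ^+ p|).
move=> x Qx; rewrite lerXn2r ?nnegrE ?normc_ge0 ?hk//.
exact: le_trans (normc_ge0 _) (hk _ Qx).
Qed.

Lemma LpD p g h : bounded_fun_on Q g -> bounded_fun_on Q h ->
  Lp p (fun x => g x + h x) <= 2 ^+ p * (Lp p g + Lp p h).
Proof.
move=> bg bh; rewrite /Lp -RintegralD//; try exact: Lp_integrable.
rewrite -RintegralZl//; last by apply: rintegrableD => //; exact: Lp_integrable.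
apply: le_Rintegral => //.
- by apply: Lp_integrable; exact: bounded_fun_onD.
- by apply: rintegrableZ => //; apply: rintegrableD => //; exact: Lp_integrable.
move=> x Qx; apply: le_trans (exprD_le _ (normc_ge0 _) (normc_ge0 _)).
by rewrite lerXn2r ?nnegrE ?normc_ge0 ?addr_ge0 ?normc_ge0 ?le_normcD.
Qed.

Variable p : nat.
Hypothesis p0 : (0 < p)%N.

(** The closure of the trigonometric polynomials in L^p, among the bounded
functions. *)
Definition approx h := bounded_fun_on Q h /\ forall e, 0 < e ->
  exists t : tpoly R d, Lp p (fun x => h x - tev t x) <= e.

Lemma approx_ext g h : (forall x, Q x -> g x = h x) -> approx g -> approx h.
Proof.
move=> gh [[[mg1 mg2] [B gB]] ag]; split.
  split; last by exists B => x Qx; rewrite -gh// gB.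
  by split; [move: mg1|move: mg2]; apply: eq_measurable_fun => x /set_mem/gh ->.
move=> e /ag[t ht]; exists t; apply: le_trans ht; rewrite le_eqVlt.
by rewrite (@eq_Lp _ _ (fun x => g x - tev t x)) ?eqxx// => x /gh ->.
Qed.

Lemma approx_tev s : approx (tev s).
Proof.
split; first exact: bounded_fun_on_tev.
move=> e e0; exists s; rewrite /Lp (@eq_Rintegral _ _ _ _ _ (cst 0)).
  by rewrite Rintegral_cst// mul0r ltW.
by move=> x _; rewrite subrr normc0 expr0n gtn_eqF.
Qed.

Lemma approx_closure h : bounded_fun_on Q h ->
  (forall e, 0 < e -> exists2 g, approx g & Lp p (fun x => h x - g x) <= e) ->
  approx h.
Proof.
move=> bh H; split => // e e0.
pose e' := e / 2 / 2 ^+ p.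
have e'0 : 0 < e' by rewrite !divr_gt0 ?exprn_gt0.
have [g [bg ag] hg] := H _ e'0; have [t gt] := ag _ e'0.
exists t; have bt := bounded_fun_on_tev t.
have -> : Lp p (fun x => h x - tev t x) = Lp p (fun x => (h x - g x) + (g x - tev t x)).
  by apply: eq_Lp => x _; rewrite addrA subrK.
rewrite (le_trans (LpD _ _ _))//; try exact: bounded_fun_onB.
rewrite mulrC -ler_pdivlMr ?exprn_gt0// (le_trans (lerD hg gt))//.
by rewrite /e' -mulrDl -splitr.
Qed.

Lemma approxD g h : approx g -> approx h -> approx (fun x => g x + h x).
Proof.
move=> [bg ag] [bh ah]; split; first exact: bounded_fun_onD.
move=> e e0; pose e' := e / 2 / 2 ^+ p.
have e'0 : 0 < e' by rewrite !divr_gt0 ?exprn_gt0.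
have [t gt] := ag _ e'0; have [s hs] := ah _ e'0; exists (t ++ s).
have bt := bounded_fun_on_tev t; have bs := bounded_fun_on_tev s.
have -> : Lp p (fun x => g x + h x - tev (t ++ s) x) =
    Lp p (fun x => (g x - tev t x) + (h x - tev s x)).
  by apply: eq_Lp => x _; rewrite tev_cat opprD addrACA.
rewrite (le_trans (LpD _ _ _))//; try exact: bounded_fun_onB.
rewrite mulrC -ler_pdivlMr ?exprn_gt0// (le_trans (lerD gt hs))//.
by rewrite /e' -mulrDl -splitr.
Qed.

Lemma approxZ k g : approx g -> approx (fun x => k * g x).
Proof.
move=> [bg ag]; split.
  by apply: bounded_fun_onM => //; exact: bounded_fun_on_cst.
move=> e e0; have K0 : 0 < normc k ^+ p + 1 by rewrite ltr_wpDl// exprn_ge0// normc_ge0.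
have [t gt] := ag _ (divr_gt0 e0 K0); exists (tmult (fun=> k) t).
have bt := bounded_fun_on_tev t.
have -> : Lp p (fun x => k * g x - tev (tmult (fun=> k) t) x) =
    normc k ^+ p * Lp p (fun x => g x - tev t x).
  rewrite -RintegralZl//; last by apply: Lp_integrable; exact: bounded_fun_onB.
  apply: eq_Rintegral => x _; rewrite -exprMn -normcM mulrBr.
  rewrite tev_tmult mulr_sumr; congr (normc (_ - _) ^+ p).
  by apply: eq_bigr => q _; rewrite mulrA.
apply: (@le_trans _ _ ((normc k ^+ p + 1) * Lp p (fun x => g x - tev t x))).
  by rewrite ler_wpM2r ?Lp_ge0// lerDl.
by rewrite mulrC -ler_pdivlMr.
Qed.

(** Dominated convergence. *)
Lemma approx_cvg (u : nat -> V -> C) h B : cmeasurable Q h ->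
  (forall n, approx (u n)) -> (forall n x, Q x -> normc (u n x) <= B) ->
  (forall x, Q x -> (fun n => normc (h x - u n x)) @ \oo --> (0 : R)) ->
  approx h.
Proof.
move=> mh au uB hu.
have hB x : Q x -> normc (h x) <= B + 1.
  move=> Qx; have [n] := cvg0_exists (hu x Qx) ltr01.
  rewrite ger0_norm ?normc_ge0// => h1.
  rewrite -[h x](subrK (u n x)) (le_trans (le_normcD _ _))// addrC.
  by apply: lerD; [exact: uB|exact: ltW].
have bh : bounded_fun_on Q h by split => //; exists (B + 1).
apply: approx_closure => // e e0.
have : (fun n => Lp p (fun x => h x - u n x)) @ \oo --> Lp p (fun=> 0).
  apply: (@rintegral_cvg _ _ _ _ _ (cst ((B + 1 + B) ^+ p))) => //.
  - move=> n; apply: measurable_funX; apply: measurable_normc.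
    by apply: cmeasurableB => //; have [[]] := au n.
  - exact: (@rintegrable_bounded _ _ _ _ `|(B + 1 + B) ^+ p|).
  - move=> n x Qx; rewrite ger0_norm ?exprn_ge0 ?normc_ge0//.
    have h1 : normc (h x - u n x) <= B + 1 + B.
      by rewrite (le_trans (le_normcD _ _))// normcN lerD ?hB ?uB.
    by rewrite lerXn2r ?nnegrE ?normc_ge0// (le_trans _ h1) ?normc_ge0.
  - apply: aeW => x Qx; rewrite [normc 0](@normc0 R).
    exact: (cvg_comp _ _ (hu x Qx) (@exprn_continuous R p 0)).
rewrite [X in _ --> X -> _](_ : Lp p (fun=> 0) = 0); last first.
  rewrite /Lp (@eq_Rintegral _ _ _ _ _ (cst 0)).
    by rewrite Rintegral_cst// mul0r.
  by move=> x _; rewrite normc0 expr0n gtn_eqF.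
move=> H; have [n hn] := cvg0_exists H e0.
by exists (u n) => //; exact: le_trans (ler_norm _) (ltW hn).
Qed.

Definition istrig (u : V -> R) := exists t : tpoly R d, forall x, (u x)%:C%C = tev t x.

Lemma istrigD u v : istrig u -> istrig v -> istrig (fun x => u x + v x).
Proof.
by move=> [s us] [t vt]; exists (s ++ t) => x; rewrite tev_cat -us -vt; exact: rmorphD.
Qed.

Lemma istrigM u v : istrig u -> istrig v -> istrig (fun x => u x * v x).
Proof.
by move=> [s us] [t vt]; exists (tmul s t) => x; rewrite tev_mul -us -vt; exact: rmorphM.
Qed.

Lemma istrig_cst k : istrig (fun=> k).
Proof.
exists [:: (k%:C%C, 0)] => x; rewrite /tev big_seq1 /= chr0 mulr1//.
Qed.

Lemma istrig_cos (i : 'I_d) c : istrig (fun x => cos (2 * pi * (x i ord0 - c))).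
Proof.
pose e : K := delta_mx i ord0.
pose z : C := expi (- (2 * pi * c)).
exists [:: (2^-1%:C%C * z, e); (2^-1%:C%C * conjc z, - e)] => x.
rewrite /tev big_cons big_seq1 /= chrN.
have dE : dotv (ivec e) x = x i ord0.
  rewrite /dotv (bigD1 i)//= !mxE !eqxx mul1r big1 ?addr0// => j ji.
  by rewrite !mxE (negbTE ji) mul0r.
have E : z * chr e x = expi (2 * pi * (x i ord0 - c)).
  by rewrite /z /chr dE -expiD; congr expi; ring.
have -> : 2^-1%:C%C * z * chr e x + 2^-1%:C%C * conjc z * conjc (chr e x) =
    2^-1%:C%C * (z * chr e x + conjc (z * chr e x)).
  by rewrite rmorphM; ring.
rewrite E; apply: complex_ext; rewrite ?ReM ?ImM ?ReD ?ImD ?Re_conjc ?Im_conjc /=.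
  by rewrite mul0r subr0; field.
by rewrite subrr mulr0 mul0r addr0.
Qed.

Lemma istrig_sgn_iter n u : istrig u -> istrig (fun x => sgn_iter n (u x)).
Proof.
move=> Tu; elim: n => [//|n IH].
rewrite (_ : (fun x => _) = fun x => 2^-1 * (3 * sgn_iter n (u x) +
    -1 * (sgn_iter n (u x) * (sgn_iter n (u x) * sgn_iter n (u x))))).
  apply: istrigM; first exact: istrig_cst.
  apply: istrigD; apply: istrigM => //; try exact: istrig_cst.
  by apply: istrigM => //; exact: istrigM.
by apply/funext => x; rewrite sgn_iterS; field.
Qed.

Lemma istrig_step_iter n u : istrig u -> istrig (fun x => step_iter n (u x)).
Proof.
move=> Tu; apply: istrigM; last exact: istrig_cst.
apply: istrigM; first exact: istrig_sgn_iter.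
by apply: istrigD; [exact: istrig_cst|exact: istrig_sgn_iter].
Qed.

Lemma istrig_itv_level a b (i : 'I_d) : istrig (fun x => itv_level a b (x i ord0)).
Proof.
apply: istrigM; last exact: istrig_cst.
by apply: istrigD; [exact: istrig_cos|exact: istrig_cst].
Qed.

Lemma istrig_prod I (r : seq I) (u : I -> V -> R) : (forall i, istrig (u i)) ->
  istrig (fun x => \prod_(i <- r) u i x).
Proof.
move=> Tu; elim: r => [|i r IH].
  by under eq_fun do rewrite big_nil; exact: istrig_cst.
by under eq_fun do rewrite big_cons; exact: istrigM.
Qed.

Lemma approx_istrig u : istrig u -> approx (fun x => (u x)%:C%C).
Proof. by move=> [t ut]; apply: (@approx_ext (tev t)) => [x _|]; [rewrite ut|exact: approx_tev]. Qed.

Lemma cvg_prod I (r : seq I) (u : I -> nat -> R) (l : I -> R) :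
  (forall i, u i @ \oo --> l i) ->
  (fun n => \prod_(i <- r) u i n) @ \oo --> \prod_(i <- r) l i.
Proof.
move=> ul; elim: r => [|i r IH].
  by rewrite big_nil; under eq_fun do rewrite big_nil; exact: cvg_cst.
by rewrite big_cons; under eq_fun do rewrite big_cons; exact: cvgM.
Qed.

(** The indicator of a box is a bounded pointwise limit of products, over the
coordinates, of [step_iter] applied to [itv_level]: all are trigonometric
polynomials. *)
Lemma approx_indic_sub (a b : 'I_d -> R) :
  (forall i, - 2^-1 <= a i) -> (forall i, b i <= 2^-1) ->
  approx (fun x => (\1_(obox a b) x)%:C%C).
Proof.
move=> a0 b0.
have [[i bai]|] := pselect (exists i, b i <= a i).
  apply: (@approx_ext (tev [::])); last exact: approx_tev.
  move=> x _; rewrite /tev big_nil indicE memNset// => xab.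
  by have /andP[h1 h2] := xab i; have := lt_trans h1 h2; rewrite ltNge bai.
move=> /forallNP ab'; have ab i : a i < b i by rewrite ltNge; exact/negP.
pose u n (x : V) := \prod_i step_iter n (itv_level (a i) (b i) (x i ord0)).
apply: (@approx_cvg (fun n x => (u n x)%:C%C) _ 1).
- apply: cmeasurable_real; apply: measurable_indic; exact: measurable_obox.
- move=> n; apply: approx_istrig; apply: istrig_prod => i.
  by apply: istrig_step_iter; exact: istrig_itv_level.
- move=> n x _; rewrite normc_real normr_prod; apply: prodr_ile1 => i _.
  by rewrite normr_ge0/=; apply: step_iter_le1; exact: itv_level_le1.
move=> x Qx.
under eq_fun do rewrite -rmorphB normc_real.
apply/norm_cvg0P; rewrite -[X in _ --> X](subrr (\1_(obox a b) x : R)).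
apply: cvgB; first exact: cvg_cst.
have -> : (\1_(obox a b) x : R) = \prod_i (a i < x i ord0 < b i)%R%:R.
  rewrite indicE; have [/set_mem xab|/negP xab] := boolP (x \in obox a b).
    by rewrite big1// => i _; rewrite xab.
  have /existsNP[i /negP xi] : ~ obox a b x by move=> ?; apply: xab; exact: mem_set.
  by rewrite (bigD1 i)//= (negbTE xi) mul0r.
apply: cvg_prod => i.
rewrite -(itv_level_gt0 (a0 i) (ab i) (b0 i) (Qx i)).
by apply: step_iter_cvg; exact: itv_level_le1.
Qed.

(** Dynkin's theorem extends the case of boxes to Borel sets. *)
Lemma approx_indic A : measurable A -> approx (fun x => (\1_A x)%:C%C).
Proof.
move=> mA; move: (mA); rewrite measurable_g_obox; move: A {mA}.
apply: dynkin_induction.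
- exact: measurable_g_obox.
- exact: setI_closed_obox.
- apply: (@approx_ext (tev [:: (1, 0)])); last exact: approx_tev.
  by move=> x _; rewrite /tev big_seq1 /= chr0 indicE in_setT mulr1.
- move=> _ [a [b ->]].
  apply: (@approx_ext (fun x => (\1_(obox (fun i => Num.max (a i) (- 2^-1))
    (fun i => Num.min (b i) 2^-1)) x)%:C%C)).
    move=> x Qx; congr (_%:C%C); rewrite !indicE; congr (_%:R); congr nat_of_bool.
    apply/idP/idP => /set_mem xab; apply/mem_set => i; have := xab i; have := Qx i.
      by rewrite gt_max lt_min => /andP[_ _] /andP[/andP[-> _] /andP[-> _]].
    by rewrite gt_max lt_min => /andP[-> ->] /andP[-> ->].
  by apply: approx_indic_sub => i; [rewrite le_max lexx orbT|rewrite ge_min lexx orbT].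
- move=> S mS aS.
  apply: (@approx_ext (fun x => tev [:: (1, 0)] x + (-1) * (\1_S x)%:C%C)).
    move=> x _; rewrite /tev big_seq1 /= chr0 !indicE in_setC.
    by case: (x \in S) => /=; rewrite ?mulr1 ?mulr0 ?subrr ?addr0.
  by apply: approxD; [exact: approx_tev|exact: approxZ].
- move=> F mF tF aF.
  pose u n x : C := \sum_(0 <= k < n) (\1_(F k) x)%:C%C.
  have uE n x : u n x = (\1_(\bigcup_(k in `I_n) F k) x)%:C%C.
    elim: n => [|n IH]; first by rewrite /u big_geq// II0 bigcup_set0 indic0.
    rewrite /u big_nat_recr//= -/(u n x) IH -rmorphD; congr (_%:C%C).
    rewrite IIS bigcup_setU bigcup_set1 !indicE in_setU.
    have [/set_mem xn|] := boolP (x \in F n); last by rewrite addr0 orbF.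
    have [/set_mem[m /= mn xm]|] := boolP (x \in \bigcup_(k in `I_n) F k); last by rewrite add0r.
    by have := tF m n Logic.I Logic.I (ex_intro _ x (conj xm xn)) => E; rewrite E ltnn in mn.
  apply: (@approx_cvg u _ 1).
  + by apply: cmeasurable_real; apply: measurable_indic; exact: bigcup_measurable.
  + elim=> [|n IH].
      apply: (@approx_ext (tev [::])); last exact: approx_tev.
      by move=> x _; rewrite /tev /u big_nil big_geq.
    apply: (@approx_ext (fun x => u n x + (\1_(F n) x)%:C%C)); last exact: approxD.
    by move=> x _; rewrite /u big_nat_recr.
  + by move=> n x _; rewrite uE normc_real indicE; case: (_ \in _); rewrite ?normr1 ?normr0.
  + move=> x Qx; have [[n _ xn]|nx] := pselect ((\bigcup_k F k) x).
      apply: cvg_near_cst; exists n.+1 => // m /= nm.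
      rewrite uE !indicE !mem_set ?subrr ?normc0//; first by exists n.
      by exists n.
    apply: cvg_near_cst; apply: nearW => m.
    rewrite uE !indicE !memNset ?subrr ?normc0// => -[k _ xk]; apply: nx; by exists k.
Qed.

(** Binary expansion: subtracting c / 2 where [u] is at least c / 2 halves the range. *)
Lemma approx_simple (c : R) (u : V -> R) (m : nat) : measurable_fun setT u ->
  (forall x, 0 <= u x <= c) ->
  exists2 s : V -> R, approx (fun x => (s x)%:C%C) &
    forall x, `|u x - s x| <= c / 2 ^+ m.
Proof.
elim: m c u => [|m IH] c u mu_ uc.
  exists (fun=> 0).
    by apply: approx_istrig; exact: istrig_cst.
  move=> x; have /andP[u0 uc'] := uc x.
  by rewrite subr0 expr0 divr1 ger0_norm.
pose A := [set x | c / 2 <= u x].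
have mA : measurable A.
  by rewrite -[A]setTI; apply: measurable_fun_le => //; exact: measurable_cst.
have [s as_ us] : exists2 s : V -> R, approx (fun x => (s x)%:C%C) &
    forall x, `|(u x - (c / 2) * \1_A x) - s x| <= c / 2 / 2 ^+ m.
  apply: IH.
    by apply: measurable_funB => //; apply: measurable_funM.
  move=> x; have /andP[u0 uc'] := uc x; rewrite indicE.
  have [/set_mem xA|/negP xA] := boolP (x \in A).
    by rewrite mulr1 /A /= in xA *; apply/andP; split; lra.
  rewrite mulr0 subr0 u0/= leNgt; apply/negP => h; apply: xA; apply/mem_set.
  exact: ltW.
exists (fun x => c / 2 * \1_A x + s x).
  apply: (@approx_ext (fun x => (c / 2)%:C%C * (\1_A x)%:C%C + (s x)%:C%C)).
    by move=> x _; rewrite -rmorphM -rmorphD.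
  by apply: approxD => //; apply: approxZ; exact: approx_indic.
move=> x; rewrite opprD addrA (le_trans (us x))// exprS invfM mulrA//.
Qed.

Lemma approx_real_ge0 (c : R) (u : V -> R) : measurable_fun setT u ->
  (forall x, 0 <= u x <= c) -> approx (fun x => (u x)%:C%C).
Proof.
move=> mu_ uc.
have /choice[s sP] : forall m, exists s : V -> R, approx (fun x => (s x)%:C%C) /\
    forall x, `|u x - s x| <= c / 2 ^+ m.
  by move=> m; have [s h1 h2] := approx_simple m mu_ uc; exists s.
apply: (@approx_cvg (fun m x => (s m x)%:C%C) _ (c + c)).
- by apply: cmeasurable_real; exact: measurable_funTS.
- by move=> n; have [] := sP n.
- move=> n x _; have [_ /(_ x) h] := sP n; have /andP[h1 h2] := uc x.
  have c0 : 0 <= c by exact: le_trans h2.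
  rewrite normc_real -[s n x]opprK normrN -[- s n x](addKr (u x)) addrC.
  rewrite (le_trans (ler_normD _ _))// [X in X <= _]addrC normrN lerD//.
    by rewrite ger0_norm.
  rewrite (le_trans h)// ler_piMr// invf_le1 ?exprn_gt0//.
  by apply: exprn_ege1; rewrite ler1n.
- move=> x _; under eq_fun do rewrite -rmorphB normc_real.
  have : (fun n => c * (2^-1) ^+ n) @ \oo --> c * 0.
    apply: cvgM; first exact: cvg_cst.
    by apply: cvg_expr; rewrite ger0_norm ?invr_ge0//; lra.
  rewrite mulr0 => H; apply: (squeeze_cvgr _ (cvg_cst (0 : R)) H).
  by apply: nearW => n; rewrite normr_ge0/= exprVn; have [_ /(_ x)] := sP n.
Qed.

Lemma approx_real (B : R) (u : V -> R) : measurable_fun setT u ->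
  (forall x, `|u x| <= B) -> approx (fun x => (u x)%:C%C).
Proof.
move=> mu_ uB; apply: (@approx_ext (fun x => (u x + B)%:C%C + (- B)%:C%C)).
  by move=> x _; rewrite -rmorphD addrK.
apply: approxD; last by apply: approx_istrig; exact: istrig_cst.
apply: (@approx_real_ge0 (B + B)); first exact: measurable_funD.
by move=> x; have := uB x; rewrite ler_norml => /andP[h1 h2]; apply/andP; split; lra.
Qed.

(** Bounded functions are uniform limits of combinations of indicators of Borel
sets. *)
Lemma approx_bounded h : bounded_fun_on Q h -> approx h.
Proof.
move=> [mh [B hB]].
have [m1 m2] := cmeasurable_restrict mQ mh.
have hB' x : normc (crestrict Q h x) <= `|B|.
  rewrite /crestrict; case: ifPn => [/set_mem/hB H|_]; last by rewrite normc0.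
  exact: le_trans H (ler_norm _).
apply: (@approx_ext (fun x => (complex.Re (crestrict Q h x))%:C%C +
    (0 +i* 1)%C * (complex.Im (crestrict Q h x))%:C%C)).
  move=> x Qx; rewrite /crestrict mem_set//; apply: complex_ext.
    by rewrite ReD ReM /=; ring.
  by rewrite ImD ImM /=; ring.
apply: approxD; last apply: approxZ.
  by apply: (@approx_real `|B|) => // x; exact: le_trans (Re_le_normc _) (hB' x).
by apply: (@approx_real `|B|) => // x; exact: le_trans (Im_le_normc _) (hB' x).
Qed.

End density.

(** * Weak convergence of cubic partial sums *)

Section partial_sums.
Context (R : realType) (d : nat).
Local Notation V := 'cV[R]_d.
Local Notation K := 'cV[int]_d.
Local Notation mu := (lebesgue R d).
Local Notation Q := (torus R d).
Local Notation C := R[i].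
Implicit Types g h G : V -> C.

Let mQ : measurable Q := @measurable_torus R d.
Let fQ : (mu Q < +oo)%E := @lebesgue_torus_lty R d.

Definition freq (n : nat) : set K := [set k | (ivec_norm k <= n)%N].

Lemma finite_freq n : finite_set (freq n).
Proof.
pose phi (f : {ffun 'I_d -> 'I_(n.*2.+1)}) : K := \col_i ((f i)%:Z - n%:Z).
apply: (@sub_finite_set _ _ (phi @` setT)).
  move=> k /bigmax_leqP kn.
  exists [ffun i => inord (absz (k i ord0 + n%:Z))] => //.
  apply/matrixP => i j; have -> : k i j = k i ord0 by rewrite (ord1 j).
  rewrite mxE ffunE inordK.
    by have := kn i isT; lia.
  by have := kn i isT; rewrite ltnS -addnn; lia.
by apply: finite_image; exact: finite_finset.
Qed.

Definition freqs (n : nat) : seq K := finmap.enum_fset (fset_set (freq n)).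

Lemma mem_freqs n k : (k \in freqs n) = (ivec_norm k <= n)%N.
Proof.
apply: (etrans (in_fset_set (finite_freq n) k)).
by apply/idP/idP => [/set_mem|]; [|exact: mem_set].
Qed.

Lemma uniq_freqs n : uniq (freqs n).
Proof. exact: finmap.fset_uniq. Qed.

Lemma ivec_normN (k : K) : ivec_norm (- k) = ivec_norm k.
Proof. by apply: eq_bigr => i _; rewrite mxE abszN. Qed.

(** The sign convention follows the synthesis functions: [coef h k] is the Fourier
coefficient of [h] at frequency - k. *)
Definition coef h (k : K) : C := cintegral Q (fun y => h y * chr k y).

Definition psum h (n : nat) (x : V) : C :=
  \sum_(k <- freqs n) coef h k * chr (- k) x.

Lemma psum_tev h n : psum h n =1 tev [seq (coef h k, - k) | k <- freqs n].
Proof. by move=> x; rewrite /tev big_map. Qed.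

Lemma bounded_fun_on_chr k : bounded_fun_on Q (chr k : V -> C).
Proof.
split; first by apply: (@cmeasurableS _ _ _ setT) => //; exact: cmeasurable_chr.
by exists 1 => x _; rewrite normc_chr.
Qed.

Lemma bounded_fun_on_psum h n : bounded_fun_on Q (psum h n).
Proof.
rewrite (_ : psum h n = tev [seq (coef h k, - k) | k <- freqs n]).
  exact: bounded_fun_on_tev.
by apply/funext; exact: psum_tev.
Qed.

Lemma cintegrable_mul_bounded G h : cintegrable Q G -> bounded_fun_on Q h ->
  cintegrable Q (fun x => G x * h x).
Proof.
move=> iG [mh [B hB]].
apply: (@cintegrable_le _ _ _ _ (fun x => B * normc (G x))) => //.
- by apply: cmeasurableM => //; exact: cintegrable_cmeasurable.
- by apply: rintegrableZ => //; exact: integrable_normc.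
- by move=> x Qx; rewrite normcM mulrC ler_wpM2r ?normc_ge0 ?hB.
Qed.

Lemma cintegral_mul_chr t (k : K) :
  coef (tev t) k = \sum_(q <- t) q.1 * (q.2 == - k)%:R.
Proof.
rewrite /coef (@eq_cintegral _ _ _ _ (fun x => \sum_(q <- t) q.1 * chr (q.2 + k) x)).
  rewrite cintegral_sum//; last first.
    move=> q; apply: cintegrableZ => //; apply: cintegrable_bounded_fun.
    exact: bounded_fun_on_chr.
  apply: eq_bigr => q _; rewrite cintegralZ ?cintegral_chr ?addr_eq0//.
  by apply: cintegrable_bounded_fun; exact: bounded_fun_on_chr.
by move=> x _; rewrite mulr_suml; apply: eq_bigr => q _; rewrite chrD mulrA.
Qed.

Lemma psum_tpoly t n x : psum (tev t) n x = tev (tmult (@ccut R d n) t) x.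
Proof.
rewrite tev_tmult /psum.
under eq_bigr do rewrite cintegral_mul_chr mulr_suml.
rewrite exchange_big; apply: eq_bigr => q _.
rewrite /ccut -(ivec_normN q.2) -mem_freqs.
have [qn|qn] := boolP (- q.2 \in freqs n).
  rewrite (bigD1_seq (- q.2))//= ?uniq_freqs// opprK eqxx mulr1 mul1r.
  rewrite big1 ?addr0// => k /negbTE kq.
  by rewrite -eqr_oppLR eq_sym kq mulr0 mul0r.
rewrite !mul0r big_seq big1// => k kn.
rewrite -eqr_oppLR; case: eqP => [E|_]; last by rewrite mulr0 mul0r.
by rewrite E kn in qn.
Qed.

Lemma coefB g h k : cintegrable Q g -> cintegrable Q h ->
  coef (fun x => g x - h x) k = coef g k - coef h k.
Proof.
move=> ig ih; rewrite /coef -cintegralB//.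
- by apply: eq_cintegral => x _; rewrite mulrBl.
- by apply: cintegrable_mul_bounded => //; exact: bounded_fun_on_chr.
- by apply: cintegrable_mul_bounded => //; exact: bounded_fun_on_chr.
Qed.

Lemma psumB g h n x : cintegrable Q g -> cintegrable Q h ->
  psum (fun x => g x - h x) n x = psum g n x - psum h n x.
Proof.
move=> ig ih; rewrite /psum -sumrB; apply: eq_bigr => k _.
by rewrite coefB// mulrBl.
Qed.

Lemma psum_le h n x : cintegrable Q h ->
  normc (psum h n x) <=
  (size (freqs n))%:R * (2 * Rintegral mu Q (fun y => normc (h y))).
Proof.
move=> ih; set I := Rintegral _ _ _.
have step k : normc (coef h k * chr (- k) x) <= 2 * I.
  rewrite normcM normc_chr mulr1.
  have ihk : cintegrable Q (fun y => h y * chr k y).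
    by apply: cintegrable_mul_bounded => //; exact: bounded_fun_on_chr.
  rewrite (le_trans (normc_cintegral_le mQ ihk))//.
  by under eq_Rintegral do rewrite normcM normc_chr mulr1.
rewrite /psum; elim: (freqs n) => [|k r IH].
  by rewrite big_nil normc0 mul0r.
rewrite big_cons (le_trans (le_normcD _ _))//.
have -> : (size (k :: r))%:R * (2 * I) = 2 * I + (size r)%:R * (2 * I) :> R.
  by rewrite /= -natr1; ring.
exact: lerD.
Qed.

(** Where |h| exceeds e, it is at most |h|^(p+1) / e^p. *)
Lemma L1_le_Lp (p : nat) h (e : R) : bounded_fun_on Q h -> 0 < e ->
  Lp p.+1 h <= e ^+ p.+1 -> Rintegral mu Q (fun x => normc (h x)) <= 2 * e.
Proof.
move=> bh e0 he.
have ih := Lp_integrable p.+1 bh.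
have ep : 0 < e ^+ p by rewrite exprn_gt0.
apply: (@le_trans _ _ (Rintegral mu Q (fun x => e + (e ^+ p)^-1 * normc (h x) ^+ p.+1))).
  apply: le_Rintegral => //.
  - by apply: integrable_normc => //; exact: cintegrable_bounded_fun.
  - apply: rintegrableD => //; last exact: rintegrableZ.
    exact: (@rintegrable_bounded _ _ _ _ `|e|).
  move=> x Qx; have [he'|he'] := leP (normc (h x)) e.
    by rewrite (le_trans he')// lerDl mulr_ge0 ?invr_ge0 ?exprn_ge0 ?normc_ge0 ?(ltW e0).
  rewrite (@le_trans _ _ ((e ^+ p)^-1 * normc (h x) ^+ p.+1))//; last by rewrite lerDr ltW.
  rewrite mulrC ler_pdivlMr// exprS ler_wpM2l ?normc_ge0//.
  by rewrite lerXn2r ?nnegrE ?normc_ge0 ?(ltW e0) ?(ltW he').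
rewrite RintegralD//; last 2 first.
- exact: (@rintegrable_bounded _ _ _ _ `|e|).
- exact: rintegrableZ.
rewrite RintegralZl// Rintegral_cst// [fine _](congr1 fine (@lebesgue_torus R d)) mulr1.
rewrite mulr_natl mulr2n lerD2l mulrC ler_pdivrMr// -exprS.
exact: he.
Qed.

(** The bound on trigonometric polynomials passes to [h] by approximation.  For each
[n] the approximation is chosen so close that the n-th partial sums differ
pointwise by at most 1. *)
Lemma psum_bounded j h : bounded_fun_on Q h ->
  exists2 B, 0 < B & forall n, Lp (2 ^ j.+1) (psum h n) <= B.
Proof.
move=> bh; have [A A1 HA] := @tnorm_ccut_bound R d j.
set p := (2 ^ j.+1)%N in HA *.
have pE : p = p.-1.+1 by rewrite prednK// expn_gt0.
have p0 : (0 < p)%N by rewrite pE.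
have [_ ah] := @approx_bounded R d p p0 h bh.
have ih := cintegrable_bounded_fun bh.
have A0 : 0 < A by exact: lt_le_trans A1.
exists (2 ^+ p * (A * (2 ^+ p * (Lp p h + 1)) + 1)).
  by rewrite mulr_gt0 ?exprn_gt0// ltr_wpDl// !mulr_ge0 ?exprn_ge0 ?addr_ge0 ?Lp_ge0// ltW.
move=> n; pose N : R := (size (freqs n))%:R.
(* N frequencies, each coefficient of the difference being at most 2 * (2 * e) *)
pose e : R := (4 * N + 1)^-1.
have N0 : 0 <= N by [].
have N1 : 0 < 4 * N + 1 by lra.
have e0 : 0 < e by rewrite invr_gt0.
have e1 : e <= 1 by rewrite invf_le1//; lra.
have [t ht] := ah _ (exprn_gt0 p e0).
have bt := bounded_fun_on_tev t.
have it := cintegrable_bounded_fun bt.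
have bht := bounded_fun_onB bh bt.
have d1 x : normc (psum h n x - psum (tev t) n x) <= 1.
  rewrite -psumB// (le_trans (psum_le _ _ (cintegrable_bounded_fun bht)))//.
  have : Rintegral mu Q (fun x => normc (h x - tev t x)) <= 2 * e.
    by rewrite pE in ht; exact: L1_le_Lp ht.
  move=> /(ler_wpM2l (ler0n R 2))/(ler_wpM2l N0) H; apply: (le_trans H).
  have -> : N * (2 * (2 * e)) = 4 * N * e by ring.
  by rewrite /e ler_pdivrMr// mul1r lerDl.
have bp := bounded_fun_on_psum h n; have bpt := bounded_fun_on_psum (tev t) n.
have -> : Lp p (psum h n) = Lp p (fun x => psum (tev t) n x + (psum h n x - psum (tev t) n x)).
  by apply: eq_Lp => x _; rewrite addrC subrK.
rewrite (le_trans (LpD _ bpt (bounded_fun_onB bp bpt)))//.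
rewrite ler_wpM2l ?exprn_ge0// lerD//; last first.
  by rewrite -[X in _ <= X](expr1n _ p); apply: Lp_cst_le => //; exact: bounded_fun_onB.
have -> : Lp p (psum (tev t) n) = tnorm p (tmult (@ccut R d n) t).
  by apply: eq_Lp => x _; rewrite psum_tpoly.
rewrite (le_trans (HA _ _))// ler_wpM2l ?(ltW A0)//.
have -> : tnorm p t = Lp p (fun x => h x + - (h x - tev t x)).
  by apply: eq_Lp => x _; rewrite opprB addrC subrK.
rewrite (le_trans (LpD _ bh (bounded_fun_onN bht)))//.
rewrite ler_wpM2l ?exprn_ge0// lerD2l.
have -> : Lp p (fun x => - (h x - tev t x)) = Lp p (fun x => h x - tev t x).
  by apply: eq_Rintegral => x _; rewrite normcN.
by rewrite (le_trans ht)// exprn_ile1// ltW.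
Qed.

Definition psum_err h n (x : V) : C := psum h n x - h x.

Lemma bounded_fun_on_psum_err h n : bounded_fun_on Q h ->
  bounded_fun_on Q (psum_err h n).
Proof. by move=> bh; apply: bounded_fun_onB => //; exact: bounded_fun_on_psum. Qed.

Lemma psum_err_bounded j h : bounded_fun_on Q h ->
  exists2 B, 0 < B & forall n, Lp (2 ^ j.+1) (psum_err h n) <= B.
Proof.
move=> bh; have [B B0 HB] := psum_bounded j bh; set p := (2 ^ j.+1)%N in HB *.
exists (2 ^+ p * (B + Lp p h)).
  by rewrite mulr_gt0 ?exprn_gt0// ltr_wpDr// Lp_ge0.
move=> n; rewrite (le_trans (LpD _ (bounded_fun_on_psum h n) (bounded_fun_onN bh)))//.
rewrite ler_wpM2l ?exprn_ge0// lerD//.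
by rewrite le_eqVlt; apply/orP; left; apply/eqP; apply: eq_Rintegral => x _; rewrite normcN.
Qed.

(** The error of the partial sum has no frequencies in the cube of size [n]. *)
Lemma psum_err_chr h n l : bounded_fun_on Q h -> (ivec_norm l <= n)%N ->
  cintegral Q (fun x => chr l x * psum_err h n x) = 0.
Proof.
move=> bh ln; have bl := bounded_fun_on_chr l; have bp := bounded_fun_on_psum h n.
rewrite (@eq_cintegral _ _ _ _ (fun x => chr l x * psum h n x - chr l x * h x)); last first.
  by move=> x _; rewrite mulrBr.
rewrite cintegralB//; last 2 first.
- by apply: cintegrable_mul_bounded => //; exact: cintegrable_bounded_fun.
- by apply: cintegrable_mul_bounded => //; exact: cintegrable_bounded_fun.
have -> : cintegral Q (fun x => chr l x * h x) = coef h l.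
  by apply: eq_cintegral => x _; rewrite mulrC.
apply/eqP; rewrite subr_eq0; apply/eqP.
rewrite (@eq_cintegral _ _ _ _ (fun x => \sum_(k <- freqs n) coef h k * chr (l - k) x)); last first.
  by move=> x _; rewrite mulr_sumr; apply: eq_bigr => k _; rewrite chrD mulrCA.
rewrite cintegral_sum//; last first.
  move=> k; apply: cintegrableZ => //; apply: cintegrable_bounded_fun.
  exact: bounded_fun_on_chr.
rewrite (bigD1_seq l) ?mem_freqs ?uniq_freqs//= big1 ?addr0; last first.
  move=> k kl; rewrite cintegralZ ?cintegral_chr//; last first.
    by apply: cintegrable_bounded_fun; exact: bounded_fun_on_chr.
  by rewrite subr_eq0 eq_sym (negbTE kl) mulr0.
rewrite cintegralZ ?cintegral_chr ?subrr ?eqxx ?mulr1//.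
by apply: cintegrable_bounded_fun; exact: bounded_fun_on_chr.
Qed.

Lemma psum_err_tev h t : bounded_fun_on Q h -> exists N, forall n, (N <= n)%N ->
  cintegral Q (fun x => tev t x * psum_err h n x) = 0.
Proof.
move=> bh; exists (\max_(q <- t) ivec_norm q.2)%N => n nN.
have ic q : cintegrable Q (fun x => chr q x * psum_err h n x).
  apply: cintegrable_mul_bounded; last exact: bounded_fun_on_psum_err.
  by apply: cintegrable_bounded_fun; exact: bounded_fun_on_chr.
rewrite (@eq_cintegral _ _ _ _ (fun x => \sum_(q <- t) q.1 * (chr q.2 x * psum_err h n x))); last first.
  by move=> x _; rewrite /tev mulr_suml; apply: eq_bigr => q _; rewrite mulrA.
rewrite cintegral_sum//; last by move=> q; exact: cintegrableZ.
rewrite big_seq big1// => q qt; rewrite cintegralZ// psum_err_chr ?mulr0//.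
by move/bigmax_leqP_seq: nN => /(_ q qt isT).
Qed.

(** Approximate [G] by a trigonometric polynomial in L^2: the error is bounded in
L^2 and eventually orthogonal to that polynomial. *)
Lemma psum_err_weak_bounded h G (e : R) : bounded_fun_on Q h -> bounded_fun_on Q G -> 0 < e ->
  exists N, forall n, (N <= n)%N ->
  normc (cintegral Q (fun x => G x * psum_err h n x)) <= e.
Proof.
move=> bh bG e0; have [B B0 HB] := psum_err_bounded 0 bh.
rewrite expn1 in HB.
pose k : R := 4 * B / e.
have k0 : 0 < k by rewrite divr_gt0 ?mulr_gt0.
have [_ /(_ (e / (4 * k)))[]] := @approx_bounded R d 2 isT G bG.
  by rewrite divr_gt0// mulr_gt0.
move=> t ht; have [N HN] := psum_err_tev t bh; exists N => n nN.
have bt := bounded_fun_on_tev t; have bD := bounded_fun_on_psum_err n bh.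
have bGt := bounded_fun_onB bG bt.
rewrite (@eq_cintegral _ _ _ _ (fun x => (G x - tev t x) * psum_err h n x +
  tev t x * psum_err h n x)); last by move=> x _; rewrite mulrBl subrK.
have i1 : cintegrable Q (fun x => (G x - tev t x) * psum_err h n x).
  by apply: cintegrable_mul_bounded => //; exact: cintegrable_bounded_fun.
rewrite cintegralD//; last first.
  by apply: cintegrable_mul_bounded => //; exact: cintegrable_bounded_fun.
rewrite HN// addr0 (le_trans (normc_cintegral_le mQ i1))//.
apply: (@le_trans _ _ (2 * (k * Lp 2 (fun x => G x - tev t x) + k^-1 * Lp 2 (psum_err h n)))).
  rewrite ler_wpM2l//.
  have iG := Lp_integrable 2 bGt; have iD := Lp_integrable 2 bD.
  rewrite /Lp -!RintegralZl// -RintegralD//; try exact: rintegrableZ.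
  apply: le_Rintegral => //.
  - exact: integrable_normc.
  - by apply: rintegrableD => //; exact: rintegrableZ.
  by move=> x _; rewrite normcM; apply: le_mul_sqr; rewrite ?normc_ge0.
have h1 : k * Lp 2 (fun x => G x - tev t x) <= e / 4.
  rewrite (le_trans (ler_wpM2l (ltW k0) ht))// le_eqVlt; apply/orP; left; apply/eqP.
  by field; rewrite gt_eqF.
have h2 : k^-1 * Lp 2 (psum_err h n) <= e / 4.
  have ki : 0 <= k^-1 by rewrite invr_ge0 ltW.
  rewrite (le_trans (ler_wpM2l ki (HB n)))// le_eqVlt; apply/orP; left; apply/eqP.
  by rewrite /k; field; rewrite !gt_eqF.
by lra.
Qed.

(** Truncate [G] at height N: the bounded part is [psum_err_weak_bounded], and the
remainder is small in L^r while the error is bounded in L^p, so that Young's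
inequality with a scale [s] bounds their pairing. *)
Lemma psum_err_weak j (r : R) h G (e : R) : bounded_fun_on Q h ->
  0 < r -> ((2 ^ j.+1)%N%:R)^-1 + r^-1 = 1 ->
  cmeasurable Q G -> cintegrable Q G ->
  mu.-integrable Q (EFin \o (fun x => normc (G x) `^ r)) -> 0 < e ->
  exists N, forall n, (N <= n)%N ->
  normc (cintegral Q (fun x => G x * psum_err h n x)) <= e.
Proof.
move=> bh r0 pr mG iG iGr e0.
set p := (2 ^ j.+1)%N in pr.
have p0 : 0 < p%:R :> R by rewrite ltr0n expn_gt0.
have [B B0 HB] := psum_err_bounded j bh; rewrite -/p in HB.
(* The scale s makes the L^p contribution of the error at most e / 8; then N is
   chosen for the L^r contribution of the remainder. *)
pose s : R := 8 * B / e + 1.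
have s1 : 1 <= s by rewrite lerDr divr_ge0 ?mulr_ge0 ?ltW.
have s0 : 0 < s by exact: lt_le_trans s1.
have hB : s ^- p * B <= e / 8.
  rewrite mulrC ler_pdivrMr ?exprn_gt0//.
  apply: (@le_trans _ _ (e / 8 * s)).
    have -> : e / 8 * s = B + e / 8 by rewrite /s; field; rewrite gt_eqF.
    by rewrite lerDl divr_ge0 ?ltW.
  apply: ler_wpM2l; first by rewrite divr_ge0// ltW.
  by apply: ler_eXnr => //; rewrite expn_gt0.
pose a (N : nat) x : R := if normc (G x) <= N%:R then 0 else normc (G x).
have mn : measurable_fun Q (fun x => normc (G x)) by exact: measurable_normc.
have ma N : measurable_fun Q (a N).
  apply: measurable_fun_if => //.
  - by apply: measurable_fun_ler => //; exact: measurable_cst.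
  - by apply: measurable_funS mn => // x [].
have a0 N x : 0 <= a N x by rewrite /a; case: ifP => // _; exact: normc_ge0.
have aG N x : a N x <= normc (G x).
  by rewrite /a; case: ifP => // _; exact: normc_ge0.
have mpow (f : V -> R) : measurable_fun Q f -> measurable_fun Q (fun x => f x `^ r).
  by move=> mf; exact: (measurableT_comp (@measurable_powR R r) mf).
have iar N : mu.-integrable Q (EFin \o (fun x => a N x `^ r)).
  apply: (@rintegrable_le _ _ _ _ (fun x => normc (G x) `^ r)) => //.
    exact: mpow.
  move=> x Qx; rewrite ger0_norm ?powR_ge0//.
  by apply: ge0_ler_powR; rewrite ?nnegrE ?normc_ge0 ?a0 ?aG ?(ltW r0).
have sr0 : 0 < s `^ r by rewrite powR_gt0.
have [N HN] : exists N, s `^ r * Rintegral mu Q (fun x => a N x `^ r) <= e / 8.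
  have : (fun N => Rintegral mu Q (fun x => a N x `^ r)) @ \oo --> Rintegral mu Q (fun=> 0).
    apply: (@rintegral_cvg _ _ _ _ _ (fun x => normc (G x) `^ r)) => //.
    - by move=> N; exact: mpow.
    - move=> N x Qx; rewrite ger0_norm ?powR_ge0//.
      by apply: ge0_ler_powR; rewrite ?nnegrE ?normc_ge0 ?a0 ?aG ?(ltW r0).
    - apply: aeW => x Qx; apply: cvg_near_cst.
      exists (Num.truncn (normc (G x))).+1 => // N /= nN.
      rewrite /a ifT ?powR0 ?gt_eqF//.
      by rewrite (le_trans (ltW (truncnS_gt _)))// ler_nat.
  rewrite [X in _ --> X -> _](_ : Rintegral mu Q (fun=> 0) = 0); last first.
    by rewrite Rintegral_cst// mul0r.
  move=> H; have e8 : 0 < e / 8 / s `^ r by rewrite !divr_gt0.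
  have [N hN] := cvg0_exists H e8; exists N.
  rewrite mulrC -ler_pdivlMr//; exact: le_trans (ler_norm _) (ltW hN).
pose G1 x : C := if normc (G x) <= N%:R then G x else 0.
pose G2 x : C := if normc (G x) <= N%:R then 0 else G x.
have GE x : G x = G1 x + G2 x by rewrite /G1 /G2; case: ifP; rewrite ?addr0 ?add0r.
have nG2 x : normc (G2 x) = a N x by rewrite /G2 /a; case: ifP; rewrite ?normc0.
have mG2 : cmeasurable Q G2.
  have mle : measurable_fun Q (fun x => normc (G x) <= N%:R).
    by apply: measurable_fun_ler => //; exact: measurable_cst.
  split.
    rewrite (_ : (fun x => _) = fun x => if normc (G x) <= N%:R then 0 else complex.Re (G x)).
      apply: measurable_fun_if => //.
      by apply: measurable_funS (proj1 mG) => // x [].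
    by apply/funext => x; rewrite /G2; case: ifP.
  rewrite (_ : (fun x => _) = fun x => if normc (G x) <= N%:R then 0 else complex.Im (G x)).
    apply: measurable_fun_if => //.
    by apply: measurable_funS (proj2 mG) => // x [].
  by apply/funext => x; rewrite /G2; case: ifP.
have bG1 : bounded_fun_on Q G1.
  split.
    rewrite (_ : G1 = fun x => G x - G2 x); first exact: cmeasurableB.
    by apply/funext => x; rewrite {1}GE addrK.
  exists N%:R => x _; rewrite /G1; case: ifP => // _; rewrite normc0//.
have [M HM] := psum_err_weak_bounded bh bG1 (divr_gt0 e0 (ltr0n R 2)).
exists M => n nM.
have bD := bounded_fun_on_psum_err n bh.
have iG2 : cintegrable Q G2.
  apply: (@cintegrable_le _ _ _ _ (fun x => normc (G x))) => //.
    exact: integrable_normc.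
  by move=> x _; rewrite nG2.
have i2 : cintegrable Q (fun x => G2 x * psum_err h n x) by exact: cintegrable_mul_bounded.
rewrite (@eq_cintegral _ _ _ _ (fun x => G1 x * psum_err h n x + G2 x * psum_err h n x)); last first.
  by move=> x _; rewrite {1}GE mulrDl.
rewrite cintegralD//; last first.
  by apply: cintegrable_mul_bounded => //; exact: cintegrable_bounded_fun.
rewrite (le_trans (le_normcD _ _))//.
have h2 : normc (cintegral Q (fun x => G2 x * psum_err h n x)) <= e / 2.
  rewrite (le_trans (normc_cintegral_le mQ i2))//.
  have iD := Lp_integrable p bD.
  apply: (@le_trans _ _ (2 * (s `^ r * Rintegral mu Q (fun x => a N x `^ r) +
     s ^- p * Lp p (psum_err h n)))).
    rewrite ler_wpM2l// /Lp -!RintegralZl// -RintegralD//; try exact: rintegrableZ.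
    apply: le_Rintegral => //.
    - exact: integrable_normc.
    - by apply: rintegrableD => //; exact: rintegrableZ.
    move=> x Qx; rewrite normcM nG2; set b := normc (psum_err h n x).
    have b0 : 0 <= b by exact: normc_ge0.
    have -> : a N x * b = (b / s) * (s * a N x) by field; rewrite gt_eqF.
    have bs0 : 0 <= b / s by rewrite divr_ge0 ?(ltW s0).
    have sa0 : 0 <= s * a N x by rewrite mulr_ge0 ?(ltW s0).
    rewrite (le_trans (conjugate_powR bs0 sa0 p0 r0 pr))// addrC lerD//.
      rewrite powRM ?a0 ?(ltW s0)// ler_piMr ?mulr_ge0 ?powR_ge0//.
      by rewrite -[X in _ <= X]pr lerDr invr_ge0 ltW.
    rewrite powR_mulrn// exprMn exprVn [X in _ <= X]mulrC ler_piMr//.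
      by rewrite mulr_ge0 ?exprn_ge0 ?invr_ge0 ?exprn_ge0 ?(ltW s0).
    by rewrite -[X in _ <= X]pr lerDl invr_ge0 ltW.
  have h3 : s ^- p * Lp p (psum_err h n) <= e / 8.
    by apply: le_trans hB; rewrite ler_wpM2l// invr_ge0 exprn_ge0// ltW.
  by lra.
by rewrite [X in _ <= X]splitr lerD// HM.
Qed.

End partial_sums.

(** * Spectra in Lebesgue spaces *)

Section lebesgue_spaces.
Context (R : realType) (d : nat).
Local Notation V := 'cV[R]_d.
Local Notation mu := (lebesgue R d).
Local Notation Q := (torus R d).
Local Notation C := R[i].

Lemma ess_bounded (F : V -> C) : in_Lq +oo%E F ->
  exists B, {ae mu, forall x, normc (F x) <= B}.
Proof.
move=> [_]; rewrite unlock.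
have -> : (0 < mu setT)%E.
  rewrite (@lt_le_trans _ _ (mu Q))//; first by rewrite lebesgue_torus.
  by apply: le_measure; rewrite ?inE//; exact: measurable_torus.
set g := EFin \o _.
have := @ess_sup_ge _ _ _ mu (abse \o g).
case: (ess_sup mu (abse \o g)) => [B| |] // H _.
  exists B; apply: filterS H => x /=.
  by rewrite lee_fin ger0_norm// normc_ge0.
by exists 0; apply: filterS H => x /=; rewrite leeNy_eq.
Qed.

(** For finite q, |F|^r <= 1 + |F|^q when r <= q; for q = +oo an essential bound
suffices. *)
Lemma Lq_power_integrable (q : \bar R) (F : V -> C) : (1 < q)%E -> in_Lq q F ->
  exists2 r0 : R, 1 < r0 & forall r A, 1 <= r -> r <= r0 -> measurable A ->
    (mu A < +oo)%E -> mu.-integrable A (EFin \o (fun x => normc (F x) `^ r)).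
Proof.
case: q => [q| |]//.
- rewrite lte_fin => q1 [mF]; rewrite unlock => Fq.
  have q0 : 0 < q by exact: lt_trans q1.
  have mn : measurable_fun setT (fun x => normc (F x)) by exact: measurable_normc.
  have mpow r : measurable_fun setT (fun x => normc (F x) `^ r).
    exact: (measurableT_comp (@measurable_powR R r) mn).
  exists q => // r A r1 rq mA fA.
  have iq : mu.-integrable setT (EFin \o (fun x => normc (F x) `^ q)).
    apply/integrableP; split; first exact/measurable_EFinP.
    rewrite ltey; apply: contraTneq Fq => E.
    rewrite (_ : integral _ _ _ = +oo%E) ?poweRyr ?gt_eqF ?invr_gt0//.
    rewrite -[RHS]E; apply: eq_integral => x _ /=.
    by rewrite !ger0_norm ?normc_ge0 ?powR_ge0.
  have iqA : mu.-integrable A (EFin \o (fun x => normc (F x) `^ q)).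
    exact: integrableS iq.
  apply: (@rintegrable_le _ _ _ _ (fun x => 1 + normc (F x) `^ q)) => //.
  - exact: measurable_funS (mpow r).
  - apply: rintegrableD => //.
    exact: (@rintegrable_bounded _ _ _ _ `|1|).
  - move=> x _; rewrite ger0_norm ?powR_ge0//.
    have [n1|n1] := leP (normc (F x)) 1.
      rewrite (@le_trans _ _ 1) ?lerDl ?powR_ge0//.
      rewrite -[X in _ <= X](congr1 (fun k => k r) (powR1 R)); apply: ge0_ler_powR; rewrite ?nnegrE ?normc_ge0//.
      by rewrite (le_trans _ r1).
    by rewrite (@le_trans _ _ (normc (F x) `^ q)) ?lerDr// ler_powR// ltW.
- move=> _ FLoo; have [B HB] := ess_bounded FLoo.
  exists 2; first by rewrite ltr1n.
  move=> r A r1 _ mA fA; have mF := FLoo.1.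
  have mn : measurable_fun setT (fun x => normc (F x)) by exact: measurable_normc.
  have mpow : measurable_fun A (fun x => normc (F x) `^ r).
    apply: (@measurable_funS _ _ _ _ setT) => //.
    exact: (measurableT_comp (@measurable_powR R r) mn).
  have iB : mu.-integrable A (EFin \o (fun x => Num.min (normc (F x) `^ r) (`|B| `^ r))).
    apply: (@rintegrable_bounded _ _ _ _ (`|B| `^ r)) => //.
      exact: measurable_minr.
    move=> x _; rewrite ger0_norm ?le_min ?powR_ge0//.
    by rewrite ge_min lexx orbT.
  apply/integrableP; split; first exact/measurable_EFinP.
  move/integrableP : iB => [_]; apply: le_lt_trans.
  apply: ae_ge0_le_integral => //.
  - by apply: measurableT_comp => //; exact/measurable_EFinP.
  - apply: measurableT_comp => //; apply/measurable_EFinP; exact: measurable_minr.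
  apply: filterS HB => x xB _ /=.
  have B0 : 0 <= B := le_trans (normc_ge0 _) xB.
  rewrite lee_fin (ger0_norm B0) !ger0_norm ?le_min ?powR_ge0//.
  rewrite lexx /=; apply: ge0_ler_powR; rewrite ?nnegrE ?normc_ge0//.
  exact: le_trans r1.
Qed.

(** The conjugate p / (p - 1) of p tends to 1 as p grows along powers of 2. *)
Lemma dyadic_conjugate (r0 : R) : 1 < r0 -> exists j, exists2 r : R,
  1 < r <= r0 & ((2 ^ j.+1)%N%:R)^-1 + r^-1 = 1.
Proof.
move=> r01; have r00 : 0 < r0 by exact: lt_trans r01.
have r1 : 0 < r0 - 1 by rewrite subr_gt0.
pose j := Num.truncn (r0 / (r0 - 1)).
pose p : R := (2 ^ j.+1)%N%:R.
have jp : r0 / (r0 - 1) <= p.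
  rewrite (le_trans (ltW (truncnS_gt _)))// ler_nat.
  by apply: ltnW; exact: ltn_expl.
have p1 : 1 < p by rewrite /p ltr1n -[X in (X < _)%N](expn0 2) ltn_exp2l.
have p0 : 0 < p by exact: lt_trans p1.
have pm : 0 < p - 1 by rewrite subr_gt0.
exists j, (p / (p - 1)); last first.
  by rewrite -/p invf_div; field; rewrite gt_eqF.
apply/andP; split; first by rewrite ltr_pdivlMr// mul1r ltrBlDr ltrDl.
rewrite ler_pdivrMr//; move: jp; rewrite ler_pdivrMr//.
by lra.
Qed.

End lebesgue_spaces.

(** * The cubes and the torus *)

Section cubes.
Context (R : realType) (d : nat).
Local Notation V := 'cV[R]_d.
Local Notation mu := (lebesgue R d).
Local Notation Q := (torus R d).

Lemma cubeE (delta : R) : cube delta =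
  [set x : V | forall i, `[- (delta / 2), delta / 2]%classic (x i ord0)].
Proof. by apply/seteqP; split=> x /= H i; move: (H i); rewrite in_itv /= ler_norml. Qed.

Lemma measurable_cube (delta : R) : measurable (cube delta : set V).
Proof.
rewrite cubeE.
by apply: (@measurable_cvec_box R d (fun=> `[- (delta / 2), delta / 2]%classic)).
Qed.

Lemma lebesgue_cube (delta : R) : 0 <= delta ->
  mu (cube delta) = (delta ^+ d)%:E.
Proof.
move=> d0; rewrite cubeE.
rewrite (@lebesgue_box R d (fun=> `[- (delta / 2), delta / 2]%classic))//.
rewrite (eq_bigr (fun=> delta%:E)) => [|i _].
  by rewrite prodEFin prodr_const card_ord.
rewrite lebesgue_measure_itv /= lte_fin; case: ltP => h.
  by rewrite -EFinB; congr EFin; lra.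
by congr EFin; lra.
Qed.

Lemma torus_cube : Q `<=` cube 1.
Proof. by move=> x Qx i; rewrite ler_norml; have /andP[] := Qx i; lra. Qed.

Lemma cube_torus_ae : {ae mu, forall x, cube 1 x -> Q x}.
Proof.
exists (cube 1 `\` Q); split.
- by apply: measurableD; [exact: measurable_cube|exact: measurable_torus].
- rewrite measureD; last 3 first.
  + exact: measurable_cube.
  + exact: measurable_torus.
  + by rewrite [X in (X < _)%E](lebesgue_cube ler01) ltry.
  rewrite setIidr; last exact: torus_cube.
  rewrite [X in (X - _)%E](lebesgue_cube ler01) [X in (_ - X)%E](@lebesgue_torus R d).
  by rewrite expr1n subee.
- by move=> x /= /not_implyP.
Qed.

Lemma le_cube (delta delta' : R) : delta <= delta' -> cube delta `<=` (cube delta' : set V).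
Proof. by move=> dd x H i; rewrite (le_trans (H i))// ler_pM2r. Qed.

Lemma dotv_mulmx (M : 'M[R]_d) (x y : V) : dotv (M *m x) y = dotv x (M^T *m y).
Proof.
rewrite /dotv; under eq_bigr do rewrite mxE mulr_suml.
rewrite exchange_big; apply: eq_bigr => i _; rewrite mxE mulr_sumr.
by apply: eq_bigr => j _; rewrite !mxE mulrCA mulrA.
Qed.

Lemma dotvDl (x y z : V) : dotv (x + y) z = dotv x z + dotv y z.
Proof.
by rewrite /dotv -big_split; apply: eq_bigr => i _; rewrite mxE mulrDl.
Qed.

End cubes.

Section integrals_over_torus.
Context (R : realType) (d : nat).
Local Notation V := 'cV[R]_d.
Local Notation mu := (lebesgue R d).
Local Notation Q := (torus R d).

Lemma cintegral_torus (F : V -> R[i]) : cmeasurable setT F ->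
  {ae mu, forall x, ~ cube 1 x -> F x = 0} -> cintegral setT F = cintegral Q F.
Proof.
move=> mF F0; rewrite [RHS]cintegral_mkcond.
have mQ := @measurable_torus R d.
apply: cintegral_ae_eq => //.
  by apply: cmeasurable_restrict => //; exact: cmeasurableS mF.
apply: filterS2 F0 (@cube_torus_ae R d) => x x0 xQ _.
rewrite /crestrict; case: ifPn => // /negP nQ; apply: x0 => /xQ Qx.
by apply: nQ; exact: mem_set.
Qed.

(** Membership in L^oo bounds [F] off a null set only; setting it to 0 there
provides the everywhere bounded function that the convergence theorem needs. *)
Lemma bounded_representative (F : V -> R[i]) :
  in_Lq +oo%E F -> esupp F `<=` cube 1 ->
  exists F', [/\ bounded_fun_on setT F', (forall x, ~ cube 1 x -> F' x = 0) &
    {ae mu, forall x, F x = F' x}].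
Proof.
move=> FLoo supp; have [B HB] := ess_bounded FLoo.
pose D := cube 1 `&` [set x | normc (F x) <= B].
have mn : measurable_fun setT (fun x => normc (F x)).
  exact: measurable_normc FLoo.1.
have mD : measurable D.
  apply: measurableI; first exact: measurable_cube.
  rewrite -[X in measurable X]setTI (_ : [set x | _] =
    (fun x => normc (F x)) @^-1` `]-oo, B]%classic).
    by apply: mn => //; exact: measurable_itv.
  by apply/seteqP; split=> x /=; rewrite in_itv.
exists (crestrict D F); split.
- split; first by apply: cmeasurable_restrict => //; exact: cmeasurableS FLoo.1.
  exists `|B| => x _; rewrite /crestrict; case: ifP => [/set_mem[_ /= h]|_].
    exact: le_trans (ler_norm _).
  by rewrite normc0.
- by move=> x nx; rewrite /crestrict memNset// => -[].
apply: filterS2 HB (ae_eq0_off_esupp F) => x xB x0.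
rewrite /crestrict; case: ifPn => // /negP nD; apply: x0 => /supp cx.
by apply: nD; apply: mem_set.
Qed.

End integrals_over_torus.

(** * The expansion as a pairing on the torus *)

Section sampling.
Context (R : realType) (d : nat) (M : 'M[R]_d) (hM : \det M != 0).
Local Notation V := 'cV[R]_d.
Local Notation mu := (lebesgue R d).
Local Notation Q := (torus R d).
Local Notation m := `|\det M|.
Local Notation T := (mulmx M^T).
Local Notation T' := (mulmx (invmx M^T)).

Let m0 : 0 < m. Proof. by rewrite normr_gt0. Qed.
Let unitM : M^T \in unitmx. Proof. by rewrite unitmxE det_tr unitfE. Qed.
Let TK (x : V) : T (T' x) = x. Proof. exact: mulKVmx. Qed.
Let T'K (x : V) : T' (T x) = x. Proof. exact: mulKmx. Qed.

Lemma scales_trmx : scales m (T : V -> V).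
Proof. by rewrite -(det_tr M); apply: scales_mulmx; rewrite det_tr. Qed.

Lemma scales_invtrmx : scales m^-1 (T' : V -> V).
Proof.
rewrite -normfV -(det_tr M) -det_inv.
by apply: scales_mulmx; rewrite det_inv det_tr invr_eq0.
Qed.

Lemma dilated_cubeE delta (x : V) : dilated_cube M delta x <-> cube delta (T' x).
Proof.
split=> [[y hy <-]|h]; first by rewrite T'K.
by exists (T' x).
Qed.

Lemma measurable_dilated_cube delta : measurable (dilated_cube M delta).
Proof.
have [mT' _] := scales_invtrmx.
rewrite (_ : dilated_cube M delta = setT `&` T' @^-1` cube delta).
  by apply: mT' => //; exact: measurable_cube.
by rewrite setTI; apply/seteqP; split=> x /dilated_cubeE.
Qed.

Lemma lebesgue_dilated_cube delta : 0 <= delta -> (mu (dilated_cube M delta) < +oo)%E.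
Proof.
move=> d0; have [_ sT] := scales_invtrmx.
rewrite ltey; apply/eqP => E.
have := sT _ (@measurable_cube R d delta).
rewrite (_ : T' @^-1` cube delta = dilated_cube M delta); last first.
  by apply/seteqP; split=> x /dilated_cubeE.
by rewrite E gt0_muley ?lte_fin ?invr_gt0// lebesgue_cube.
Qed.

(** The function whose Fourier coefficients on the torus are, up to a constant, the
coefficients of the expansion: see [coefficientE]. *)
Definition sampled_spectrum delta (fhat psi : V -> R[i]) (y : V) : R[i] :=
  fhat (M^T *m y) * crestrict (cube delta) (fun x => conjc (psi x)) y.

Lemma cintegrable_sampled_spectrum delta fhat psi :
  cintegrable setT fhat -> bounded_fun_on (cube delta) psi ->
  cintegrable setT (sampled_spectrum delta fhat psi).
Proof.
move=> ifh [mpsi [B HB]].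
have [ifT _] := cintegral_scale m0 scales_trmx ifh.
apply: (@cintegrable_le _ _ _ _ (fun x => `|B| * normc (fhat (T x)))) => //.
- apply: cmeasurableM; first exact: cintegrable_cmeasurable ifT.
  apply: cmeasurable_restrict; first exact: measurable_cube.
  exact: cmeasurable_conjc.
- by apply: rintegrableZ => //; exact: integrable_normc.
move=> x _; rewrite normcM mulrC ler_wpM2r ?normc_ge0//.
rewrite /crestrict; case: ifP => [/set_mem cx|_]; last by rewrite normc0.
by rewrite normc_conjc (le_trans (HB _ cx))// ler_norm.
Qed.

(** The change of variables xi = M^T y carries [dilated_cube] onto [cube], and the
factor m of the volume combines with the m^(-1/2) of [dilate_hat]. *)
Lemma coefficientE delta fhat psi k : delta <= 1 ->
  cintegrable setT fhat -> bounded_fun_on (cube delta) psi ->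
  coefficient M delta fhat psi k = (Num.sqrt m)%:C%C *
    cintegral Q (fun y => sampled_spectrum delta fhat psi y * chr (- k) y).
Proof.
move=> d1 ifh bpsi; have iG := cintegrable_sampled_spectrum ifh bpsi.
set G := sampled_spectrum _ _ _ in iG *.
pose H y := ((Num.sqrt m)^-1)%:C%C * (G y * chr (- k) y).
have iGk : cintegrable setT (fun y => G y * chr (- k) y).
  apply: (@cintegrable_le _ _ _ _ (fun x => normc (G x))) => //.
  - by apply: cmeasurableM; [exact: cintegrable_cmeasurable|exact: cmeasurable_chr].
  - exact: integrable_normc.
  - by move=> x _; rewrite normcM normc_chr mulr1.
have iH : cintegrable setT H by exact: cintegrableZ.
have mV0 : 0 < m^-1 by rewrite invr_gt0.
have [_ E] := cintegral_scale mV0 scales_invtrmx iH.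
rewrite /coefficient cintegral_mkcond.
have -> : crestrict (dilated_cube M delta)
    (fun xi => fhat xi * conjc (dilate_hat M psi k xi)) = H \o T'.
  apply/funext => x; rewrite /comp /H /G /sampled_spectrum /crestrict TK.
  have [/set_mem/dilated_cubeE cx|/negP nx] := boolP (x \in dilated_cube M delta).
    have conj_real (r : R) : conjc r%:C%C = r%:C%C by rewrite /conjc /= oppr0.
    have conjM (z w : R[i]) : conjc (z * w) = conjc z * conjc w by exact: rmorphM.
    by rewrite mem_set// /dilate_hat !conjM conj_real chrN /chr; ring.
  rewrite memNset ?mulr0 ?mul0r ?mulr0// => /dilated_cubeE cx.
  by apply: nx; exact: mem_set.
have mC : m%:C%C != 0 :> R[i] by rewrite (inj_eq (@complexI R)) gt_eqF.
rewrite (_ : cintegral setT (H \o T') = m%:C%C * cintegral setT H); last first.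
  by rewrite -E mulrA -rmorphM mulfV ?gt_eqF// mul1r.
rewrite /H cintegralZ// mulrA -rmorphM -[X in X / _](@sqr_sqrtr _ m)//.
rewrite expr2 mulfK ?gt_eqF ?sqrtr_gt0//.
congr (_ * _); apply: cintegral_torus.
  exact: cintegrable_cmeasurable.
apply: aeW => x nx; rewrite /G /sampled_spectrum /crestrict memNset ?mulr0 ?mul0r//.
by move=> /(le_cube d1).
Qed.

(** Translation by the integer vector [k] appears on the frequency side as the
character of frequency [k]. *)
Lemma dilateE phi F F' k (x : V) : cintegrable setT F' ->
  (forall y, ~ cube 1 y -> F' y = 0) -> cmeasurable setT F ->
  {ae mu, forall y, F y = F' y} ->
  phi (M *m x + ivec k) = inverse_fourier F (M *m x + ivec k) ->
  dilate M phi k x = (Num.sqrt m)%:C%C *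
    coef (fun y => F' y * expi (2 * pi * dotv (M *m x) y)) k.
Proof.
move=> iF' F'0 mF FF' E; rewrite /dilate E; congr (_ * _).
have me z : cmeasurable setT (fun y : V => expi (2 * pi * dotv z y)).
  by apply: cmeasurable_expi; apply: measurable_funM => //; exact: measurable_dotvr.
have mF' := cintegrable_cmeasurable iF'.
transitivity (inverse_fourier F' (M *m x + ivec k)).
  apply: cintegral_ae_eq => //.
  - exact: cmeasurableM.
  - exact: cmeasurableM.
  - by apply: filterS FF' => y ->.
rewrite /inverse_fourier cintegral_torus.
- rewrite /coef; apply: eq_cintegral => y _.
  by rewrite /chr dotvDl mulrDr expiD mulrA.
- exact: cmeasurableM.
- by apply: aeW => y /F'0 ->; rewrite mul0r.
Qed.

(** By strict compatibility, the product of [sampled_spectrum] and of the symbol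
of the synthesis function is fhat(M^T y); undoing the change of variables gives
the inverse Fourier transform of [fhat]. *)
Lemma sampled_spectrum_inversion delta fhat psi F F' x : delta <= 1 ->
  cintegrable setT fhat -> esupp fhat `<=` dilated_cube M delta ->
  bounded_fun_on (cube delta) psi -> strictly_compatible delta F psi ->
  bounded_fun_on setT F' -> {ae mu, forall y, F y = F' y} ->
  m%:C%C * cintegral Q (fun y => sampled_spectrum delta fhat psi y *
    (F' y * expi (2 * pi * dotv (M *m x) y))) = inverse_fourier fhat x.
Proof.
move=> d1 ifh supp bpsi compat [mF' _] FF'.
have me z : cmeasurable setT (fun y : V => expi (2 * pi * dotv z y)).
  by apply: cmeasurable_expi; apply: measurable_funM => //; exact: measurable_dotvr.
have iG := cintegrable_sampled_spectrum ifh bpsi.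
have ife : cintegrable setT (fun y => fhat y * expi (2 * pi * dotv x y)).
  apply: (@cintegrable_le _ _ _ _ (fun y => normc (fhat y))) => //.
  - by apply: cmeasurableM => //; exact: cintegrable_cmeasurable.
  - exact: integrable_normc.
  - by move=> y _; rewrite normcM normc_expi mulr1.
have [ifeT E] := cintegral_scale m0 scales_trmx ife.
rewrite /inverse_fourier -E; congr (_ * _).
rewrite -cintegral_torus; last 2 first.
- apply: cmeasurableM; first exact: cintegrable_cmeasurable iG.
  exact: cmeasurableM.
- apply: aeW => y ny; rewrite /sampled_spectrum /crestrict memNset ?mulr0 ?mul0r//.
  by move=> /(le_cube d1).
apply: cintegral_ae_eq => //.
- apply: cmeasurableM; first exact: cintegrable_cmeasurable iG.
  exact: cmeasurableM.
- exact: cintegrable_cmeasurable ifeT.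
have fh0 := negligible_scale m0 scales_trmx (ae_eq0_off_esupp fhat).
near=> y => _.
have F'y : F y = F' y by near: y.
have cy : cube delta y -> conjc (F y) * psi y = 1 by near: y; exact: compat.
have f0 : ~ esupp fhat (T y) -> fhat (T y) = 0 by near: y; exact: fh0.
rewrite /sampled_spectrum /crestrict /comp dotv_mulmx -F'y.
have [/set_mem hy|/negP hy] := boolP (y \in cube delta).
  have /(congr1 (@conjc R)) : conjc (F y) * psi y = 1 by exact: cy.
  have -> : conjc (conjc (F y) * psi y) = F y * conjc (psi y).
    rewrite (rmorphM (@conjc R)) /=; congr (_ * _).
    by case: (F y) => a b /=; rewrite opprK.
  rewrite (rmorph1 (@conjc R)) => cy1.
  by rewrite -[RHS]mul1r -cy1; ring.
rewrite f0 ?mul0r//; apply: contra_not hy => /supp/dilated_cubeE.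
by rewrite T'K => /mem_set.
Unshelve. all: by end_near.
Qed.

Lemma sampled_spectrum_power delta fhat psi (r : R) : 0 <= delta -> 0 < r ->
  cintegrable setT fhat ->
  bounded_fun_on (cube delta) psi ->
  mu.-integrable (dilated_cube M delta) (EFin \o (fun x => normc (fhat x) `^ r)) ->
  mu.-integrable setT
    (EFin \o (fun x => normc (sampled_spectrum delta fhat psi x) `^ r)).
Proof.
move=> d0 r0 ifh bpsi ifr.
have iG := cintegrable_sampled_spectrum ifh bpsi.
have mG := cintegrable_cmeasurable iG.
have [_ [B HB]] := bpsi.
pose g := (fun x => normc (fhat x) `^ r) \_ (dilated_cube M delta).
have ig : mu.-integrable setT (EFin \o g).
  have := (integrable_mkcond _ (measurable_dilated_cube delta)).1 ifr.
  apply: eq_integrable => // x _; rewrite /g /comp !patchE.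
  by case: ifP.
have [igT _] := rintegral_scale m0 scales_trmx ig.
apply: (@rintegrable_le _ _ _ _ (fun x => `|B| `^ r * (g \o T) x)) => //.
- by apply: (measurableT_comp (@measurable_powR R r)); exact: measurable_normc.
- exact: rintegrableZ.
move=> x _; rewrite ger0_norm ?powR_ge0// /g /comp patchE.
rewrite /sampled_spectrum /crestrict.
have [/set_mem cx|cx] := boolP (x \in cube delta); last first.
  rewrite mulr0 normc0 powR0 ?gt_eqF//; case: ifP => _; last by rewrite mulr0.
  by rewrite mulr_ge0 ?powR_ge0.
rewrite mem_set; last by apply/dilated_cubeE; rewrite T'K.
rewrite -powRM ?normc_ge0//; apply: ge0_ler_powR; rewrite ?nnegrE ?normc_ge0 ?(ltW r0)//.
  by rewrite mulr_ge0 ?normc_ge0.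
rewrite normcM mulrC ler_wpM2r ?normc_ge0// normc_conjc.
exact: le_trans (HB _ cx) (ler_norm _).
Qed.

End sampling.

(** * Convergence *)

Section convergence.
Context (R : realType) (d : nat).
Local Notation V := 'cV[R]_d.
Local Notation mu := (lebesgue R d).
Local Notation Q := (torus R d).

Lemma cintegrable_esupp (F : V -> R[i]) A : measurable A -> cmeasurable setT F ->
  esupp F `<=` A -> cintegrable A F -> cintegrable setT F.
Proof.
move=> mA [m1 m2] supp iF; have [i1 i2] := (cintegrable_mkcond F mA).1 iF.
have off : {ae mu, forall x, F x = crestrict A F x}.
  apply: filterS (ae_eq0_off_esupp F) => x x0; rewrite /crestrict.
  by case: ifPn => // /negP nA; apply: x0 => /supp/mem_set.
have main (p : R[i] -> R) : measurable_fun setT (fun x => p (F x)) ->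
    mu.-integrable setT (fun x => (p (crestrict A F x))%:E) ->
    mu.-integrable setT (fun x => (p (F x))%:E).
  move=> mp /integrableP[mc ic]; apply/integrableP; split.
    exact/measurable_EFinP.
  apply: le_lt_trans ic; apply: ae_ge0_le_integral => //.
  - by apply: measurableT_comp => //; exact/measurable_EFinP.
  - exact: measurableT_comp.
  - by apply: filterS off => x ->.
by split; [exact: main|exact: main].
Qed.

Lemma Lq_cintegrable (q : \bar R) (F : V -> R[i]) A : (1 < q)%E -> in_Lq q F ->
  measurable A -> (mu A < +oo)%E -> esupp F `<=` A -> cintegrable setT F.
Proof.
move=> q1 Fq mA fA supp; have mF := Fq.1.
apply: (cintegrable_esupp mA) => //.
have [r0 r01 /(_ 1 A (lexx _) (ltW r01) mA fA) H] := Lq_power_integrable q1 Fq.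
apply: (cintegrable_le mA _ H); first exact: cmeasurableS mF.
by move=> x _; rewrite powRr1 ?normc_ge0.
Qed.

Lemma cvg_normc (u : nat -> R[i]^o) (l : R[i]^o) :
  (forall e : R, 0 < e -> exists N, forall n, (N <= n)%N -> normc (u n - l) <= e) ->
  u @ \oo --> l.
Proof.
move=> H; apply/cvgrPdist_le => e e0.
have [e1 e2] : complex.Im e = 0 /\ 0 < complex.Re e.
  by move: e0; rewrite ltcE /= => /andP[/eqP -> ->].
have [N HN] := H _ e2; exists N => // n /= nN.
rewrite distrC (_ : `|u n - l| = (normc (u n - l))%:C%C)//.
by rewrite lecE /= e1 eqxx HN.
Qed.

Lemma cintegral_psum (G h : V -> R[i]) n : cintegrable Q G ->
  cintegral Q (fun y => G y * psum h n y) =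
  \sum_(k <- freqs d n) cintegral Q (fun y => G y * chr (- k) y) * coef h k.
Proof.
move=> iG; have mQ := @measurable_torus R d.
rewrite (@eq_cintegral _ _ _ _ (fun y =>
    \sum_(k <- freqs d n) coef h k * (G y * chr (- k) y))); last first.
  by move=> y _; rewrite mulr_sumr; apply: eq_bigr => k _; rewrite mulrCA.
have ik k : cintegrable Q (fun y => G y * chr (- k) y).
  by apply: cintegrable_mul_bounded => //; exact: bounded_fun_on_chr.
rewrite cintegral_sum//; last by move=> k; exact: cintegrableZ.
by apply: eq_bigr => k _; rewrite cintegralZ// mulrC.
Qed.

(** Affine bijections preserve null sets, and there are countably many [k]. *)
Lemma sampling_points_ae (M : 'M[R]_d) (P : V -> Prop) : \det M != 0 ->
  {ae mu, forall x, P x} ->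
  {ae mu, forall x, forall k : 'cV[int]_d, P (M *m x + ivec k)}.
Proof.
move=> hM HP.
have Hk (k : 'cV[int]_d) : {ae mu, forall x, P (M *m x + ivec k)}.
  have s0 : 0 < 1 * `|\det M| by rewrite mul1r normr_gt0.
  have sT := scales_comp (scales_translation (ivec k)) (scales_mulmx hM).
  exact: (negligible_scale s0 sT HP).
have H : forall n : nat, {ae mu, forall x, forall k : 'cV[int]_d,
    unpickle n = Some k -> P (M *m x + ivec k)}.
  move=> n; case: (unpickle n) => [k|]; last by exact: aeW.
  by apply: filterS (Hk k) => x Px _ [<-].
apply: filterS (ae_foralln H) => x Hx k.
by apply: (Hx (pickle k)); rewrite pickleK.
Qed.

End convergence.

Theorem theorem28 (R : realType) (d : nat) (hd : (0 < d)%N)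
  (M : 'M[R]_d) (hM : \det M != 0)
  (delta : R) (hdelta0 : 0 < delta) (hdelta1 : delta <= 1)
  (phi phihat : 'cV[R]_d -> R[i]) (hphi : fun_fourier phi phihat)
  (hphi_supp : esupp phihat `<=` cube 1) (hphi_Loo : in_Lq +oo%E phihat)
  (phit phithat : ('cV[R]_d -> R[i]) -> R[i])
  (hphit : tempered phit) (hphithat : tempered phithat)
  (hphit_fourier : is_fourier phit phithat)
  (psi : 'cV[R]_d -> R[i]) (hpsi : given_on (cube delta)° phithat psi)
  (hpsi_bounded : bounded_fun_on (cube delta) psi)
  (hcompatible : strictly_compatible delta phihat psi)
  (f fhat : 'cV[R]_d -> R[i]) (hf : fun_fourier f fhat)
  (hf_supp : esupp fhat `<=` dilated_cube M delta)
  (q : \bar R) (hq : (1 < q)%E) (hf_Lq : in_Lq q fhat) :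
  {ae lebesgue R d, forall x : 'cV[R]_d,
    (fun n : nat => \sum_(k \in [set k : 'cV[int]_d | (ivec_norm k <= n)%N])
       coefficient M delta fhat psi k * dilate M phi k x : R[i]^o)
      @ \oo --> (f x : R[i]^o)}.
Proof.
set m := `|\det M|; have m0 : 0 < m by rewrite normr_gt0.
have mQ := @measurable_torus R d.
have mD := measurable_dilated_cube hM delta.
have fD := lebesgue_dilated_cube hM (ltW hdelta0).
have ifh : cintegrable setT fhat by exact: (Lq_cintegrable hq hf_Lq mD fD hf_supp).
have mC : measurable (cube 1 : set 'cV[R]_d) by exact: measurable_cube.
have fC : (lebesgue R d (cube 1) < +oo)%E by rewrite lebesgue_cube// ltry.
have iph : cintegrable setT phihat.
  by apply: (Lq_cintegrable _ hphi_Loo mC fC) => //; exact: ltry.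
have [F' [bF' F'0 FF']] := bounded_representative hphi_Loo hphi_supp.
have iF' : cintegrable setT F'.
  have [mF' [B HB]] := bF'.
  have -> : F' = crestrict (cube 1) F'.
    apply/funext => y; rewrite /crestrict; case: ifPn => // /negP ny.
    by apply: F'0 => cy; apply: ny; exact: mem_set.
  apply: (cintegrable_mkcond F' mC).1.
  apply: (@cintegrable_bounded _ _ _ _ B) => //; first exact: cmeasurableS mF'.
  by move=> y _; exact: HB.
pose G := sampled_spectrum M delta fhat psi.
have iG : cintegrable setT G by exact: cintegrable_sampled_spectrum.
have iGQ : cintegrable (torus R d) G by exact: cintegrableS iG.
have [r0 r01 Hr0] := Lq_power_integrable hq hf_Lq.
have [j [r /andP[r1 rr0] jr]] := dyadic_conjugate r01.
have rp : 0 < r by exact: lt_trans r1.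
have iGr : (lebesgue R d).-integrable (torus R d) (EFin \o (fun x => normc (G x) `^ r)).
  apply: (@integrableS _ _ _ _ setT) => //.
  apply: sampled_spectrum_power => //; first exact: ltW.
  by apply: Hr0 => //; exact: ltW.
have Hphi := sampling_points_ae hM (fourier_inversion hphi iph).
apply: filterS2 Hphi (fourier_inversion hf ifh) => x phix ->.
(* The synthesis symbol at the point x, bounded because F' is. *)
pose h y := F' y * expi (2 * pi * dotv (M *m x) y).
have bh : bounded_fun_on (torus R d) h.
  apply: bounded_fun_onM.
    have [mF' [B HB]] := bF'; split; first exact: cmeasurableS mF'.
    by exists B => y _; exact: HB.
  split; last by exists 1 => y _; rewrite normc_expi.
  apply: cmeasurable_expi; apply: measurable_funM => //.
  by apply: (@measurable_funS _ _ _ _ setT) => //; exact: measurable_dotvr.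
have sumE n : \sum_(k \in [set k : 'cV[int]_d | (ivec_norm k <= n)%N])
       coefficient M delta fhat psi k * dilate M phi k x =
    m%:C%C * cintegral (torus R d) (fun y => G y * psum h n y).
  rewrite fsbig_finite; last exact: finite_freq.
  rewrite cintegral_psum// mulr_sumr; apply: eq_bigr => k _.
  rewrite coefficientE// (dilateE iF' F'0 hphi_Loo.1 FF' (phix k)).
  rewrite mulrACA -rmorphM -expr2 sqr_sqrtr; last exact: ltW.
  by [].
apply: cvg_normc => e e0.
have [N HN] := psum_err_weak bh rp jr (cintegrable_cmeasurable iGQ) iGQ iGr
  (divr_gt0 e0 m0).
exists N => n nN; rewrite sumE.
rewrite -(sampled_spectrum_inversion hM x hdelta1 ifh hf_supp hpsi_bounded
  hcompatible bF' FF') -mulrBr -cintegralB//; last 2 first.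
- by apply: cintegrable_mul_bounded => //; exact: bounded_fun_on_psum.
- exact: cintegrable_mul_bounded.
rewrite normcM normc_real gtr0_norm// mulrC -ler_pdivlMr//.
apply: le_trans (HN n nN); rewrite le_eqVlt; apply/orP; left; apply/eqP.
by congr normc; apply: eq_cintegral => y _; rewrite /psum_err mulrBr.
Qed.
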